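(* Let $\mathbf{\Phi}$, $Q$, $\boldsymbol{\pi}$, $\boldsymbol{g}$ and the fixed state $j\in E$ be as in the context, and for each $n\ge j$ let ${}_{(n)}\mathbf{\Phi}$ be the Markov chain on ${}_{(n)}E=\{0,1,\dots,n\}$ with the linearly augmented $q$-matrix $${}_{(n)}\widetilde Q={}_{(n)}Q+(-{}_{(n)}Q)\,{}_{(n)}\boldsymbol{e}\,{}_{(n)}\boldsymbol{e}_j^T .$$ Then: (i) the chains can be realized on a common probability space such that, for any initial state $i\in E$ with $i\ne j$ and $n\ge\max\{i,j\}$, the sequences $\{{}_{(n)}\delta_j\}$ and $\{{}_{(n)}\xi_j(|{}_{(n)}\boldsymbol{g}|)\}$ both increase (in $n$) and converge, with probability one, to $\delta_j$ and $\xi_j(|\boldsymbol{g}|)$, respectively; (ii) for any state $i\in E$, $$\lim_{n\to+\infty}{}_{(n)}f_j(i)=f_j(i).$$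
   Context: $\mathbf{\Phi}=\{\Phi_t:t\in\mathbb{R}_+\}$ is an irreducible time-homogeneous continuous-time Markov chain on $E=\mathbb{Z}_+$ with $q$-matrix $Q=(q_{ik})$, which is totally stable ($q_i:=-q_{ii}<\infty$) and regular (conservative, with non-explosive minimal process). $\mathbf{\Phi}$ is positive recurrent with unique invariant probability vector $\boldsymbol{\pi}$. $\boldsymbol{g}$ is a finite-valued (real) function on $E$ with $\boldsymbol{\pi}^T|\boldsymbol{g}|<\infty$, and $\overline{\boldsymbol{g}}=\boldsymbol{g}-(\boldsymbol{\pi}^T\boldsymbol{g})\boldsymbol{e}$, with $\boldsymbol{e}$ the vector of ones. ${}_{(n)}Q$ is the $(n+1)\times(n+1)$ northwest corner truncation of $Q$; ${}_{(n)}\boldsymbol{e}$ is the $(n+1)$-vector of ones and ${}_{(n)}\boldsymbol{e}_j$ the $(n+1)$-vector with $1$ in the $(j+1)$th position (the coordinate of state $j$) and zeros elsewhere; thus all transition rate out of ${}_{(n)}E$ is redirected to $j$. ${}_{(n)}\widetilde Q$ has a unique invariant probability vector ${}_{(n)}\boldsymbol{\pi}$. Under $\mathbb{P}_i$ (expectation $\mathbb{E}_i$) all chains start from $i$. $\delta_j=\inf\{t\ge J_1:\Phi_t=j\}$ is the first return time to $j$, where $J_1$ is the first jump time of $\mathbf{\Phi}$; ${}_{(n)}\delta_j$ is defined in the same way for ${}_{(n)}\mathbf{\Phi}$ with its first jump time ${}_{(n)}J_1$. For a function $\boldsymbol{h}$: $\xi_j(\boldsymbol{h})=\int_0^{\delta_j}h(\Phi_t)\,dt$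 and ${}_{(n)}\xi_j(\boldsymbol{h})=\int_0^{{}_{(n)}\delta_j}h({}_{(n)}\Phi_t)\,dt$. ${}_{(n)}\boldsymbol{g}$ is the restriction of $\boldsymbol{g}$ to ${}_{(n)}E$, ${}_{(n)}\overline{\boldsymbol{g}}={}_{(n)}\boldsymbol{g}-({}_{(n)}\boldsymbol{\pi}^T{}_{(n)}\boldsymbol{g})\,{}_{(n)}\boldsymbol{e}$. $f_j(i)=\mathbb{E}_i[\xi_j(\overline{\boldsymbol{g}})]$ for $i\in E$ (a solution of Poisson's equation $Q\boldsymbol{f}=-\overline{\boldsymbol{g}}$), and ${}_{(n)}f_j(i)=\mathbb{E}_i[{}_{(n)}\xi_j({}_{(n)}\overline{\boldsymbol{g}})]$ for $i\in{}_{(n)}E$. *)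

(* Defs.v *)
From HB Require Import structures.
From mathcomp Require Import all_boot all_order all_algebra.
From mathcomp Require Import all_classical all_reals all_analysis.

Set Implicit Arguments.
Unset Strict Implicit.
Unset Printing Implicit Defensive.

Import Order.TTheory GRing.Theory Num.Theory.
Import numFieldNormedType.Exports.

Local Open Scope classical_set_scope.
Local Open Scope ring_scope.

(* A path is a function x : R -> E; only its values at times t >= 0 matter. *)
Section Paths.
Context {R : realType} {E : countType}.
Implicit Types (x : R -> E) (j : E) (h : E -> R).

(* J_0 = 0 and J_(n+1) = inf {t >= J_n | x_t <> x_(J_n)}, with inf empty = +oo.
   When J_n = +oo, no real t satisfies t >= J_n, so that J_(n+1) = +oo and the
   junk value fine +oo plays no role. *)
Fixpoint jump_time x (n : nat) : \bar R :=
  if n is m.+1 then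
    ereal_inf [set t%:E | t in [set t : R |
      (jump_time x m <= t%:E)%E /\ x t <> x (fine (jump_time x m))]]
  else 0%E.

Definition return_time j x : \bar R :=
  ereal_inf [set t%:E | t in [set t : R |
    (jump_time x 1 <= t%:E)%E /\ x t = j]].

Definition xi j h x : \bar R :=
  (\int[lebesgue_measure]_(t in [set t : R |
      (0 <= t)%R /\ (t%:E < return_time j x)%E]) (h (x t))%:E)%E.

End Paths.

Section Chains.
Context {R : realType} {E : countType} (Q : E -> E -> R).

(* If Q a a = 0 (absorbing state), this is 0 for all b, as r / 0 = 0: the chain
   never jumps out of a. *)
Definition jump_prob (a b : E) : R :=
  if a == b then 0 else Q a b / - Q a a.

Context {d : measure_display} {Omega : measurableType d}.

(* Phi is, under P, the (minimal) continuous-time Markov chain with q-matrix Q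
   started from i, given by its jump chain and holding times: the successive
   states form a Markov chain with transition probabilities jump_prob and,
   given these states, the holding times are independent and exponential with
   parameters - Q (y m) (y m). This is the joint law in the third clause, which
   also says that the holding time of an absorbing state is +oo.
   The last clause is non-explosion: for the law of (states, holding times)
   fixed by the third clause, it says that the minimal process with q-matrix Q
   started from i does not explode. *)
Definition is_ctmc (P : probability Omega R) (i : E) (Phi : R -> Omega -> E) :
    Prop :=
  [/\ forall (t : R) (k : E), 0 <= t -> measurable [set w | Phi t w = k],
      forall (w : Omega) (t : R), 0 <= t ->
        \forall s \near t^'+, Phi s w = Phi t w,
      forall (n : nat) (y : nat -> E) (t : nat -> R),
        (forall m, 0 <= t m) ->
        P [set w | let J := jump_time (Phi ^~ w) in
             [/\ (J n < +oo)%E,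
                 forall m, (m <= n)%N -> Phi (fine (J m)) w = y m &
                 forall m, (m <= n)%N -> (J m + (t m)%:E < J m.+1)%E]]
        = ((y 0%N == i)%:R
           * (\prod_(m < n) jump_prob (y m) (y m.+1))
           * \prod_(m < n.+1) expR (Q (y m) (y m) * t m))%:E
    & {ae P, forall w,
        jump_time (Phi ^~ w) n @[n --> \oo] --> +oo%E}].

(* E_i[xi_j(h)], where P is the law under which Phi starts from i. *)
Definition expected_xi (P : probability Omega R) (Phi : R -> Omega -> E)
    (j : E) (h : E -> R) : \bar R :=
  (\int[P]_w xi j h (Phi ^~ w))%E.

(* Ps i is the probability under which the chain Phi starts from i. *)
Definition irreducible (Ps : E -> probability Omega R)
    (Phi : R -> Omega -> E) : Prop :=
  forall a b : E, exists2 t : R, 0 <= t &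
    (0 < Ps a [set w | Phi t w = b])%E.

Definition positive_recurrent (Ps : E -> probability Omega R)
    (Phi : R -> Omega -> E) : Prop :=
  forall i : E, (\int[Ps i]_w return_time i (Phi ^~ w) < +oo)%E.

End Chains.

Section QMatrices.
Context {R : realType}.
Implicit Types (Q : nat -> nat -> R) (p g : nat -> R).

(* Total stability is the finiteness of Q i i. *)
Definition conservative_qmatrix Q : Prop :=
  (forall i k, i <> k -> 0 <= Q i k) /\
  (forall i, series (Q i) @ \oo --> (0 : R)).

(* p^T Q = 0, for a probability vector p. *)
Definition invariant_prob Q p : Prop :=
  [/\ forall k, 0 <= p k,
      series p @ \oo --> (1 : R)
    & forall k, series (fun i => p i * Q i k) @ \oo --> (0 : R)].

Definition centered p g : nat -> R :=
  fun k => g k - limn (series (fun l => p l * g l)).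

Definition nw_corner Q (n : nat) : 'M[R]_n.+1 := \matrix_(i, k) Q i k.

(* The linear augmentation of a matrix A in column j. *)
Definition augment (n : nat) (A : 'M[R]_n.+1) (j : 'I_n.+1) : 'M[R]_n.+1 :=
  A + (- A) *m (const_mx 1 : 'cV[R]_n.+1) *m (delta_mx j 0 : 'cV[R]_n.+1)^T.

Definition invariant_prob_mx (n : nat) (A : 'M[R]_n.+1) (p : 'cV[R]_n.+1) :
    Prop :=
  [/\ forall k, 0 <= p k 0,
      \sum_k p k 0 = 1
    & p^T *m A = 0].

Definition restrict_to g (n : nat) : 'I_n.+1 -> R := fun k => g k.

Definition centered_mx (n : nat) (p : 'cV[R]_n.+1) (h : 'I_n.+1 -> R) :
    'I_n.+1 -> R :=
  fun k => h k - \sum_l p l 0 * h l.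

(* For j <= n, [inord j : 'I_n.+1] is the state j of {0, ..., n}. *)
Definition Qtilde Q (j n : nat) : 'M[R]_n.+1 :=
  augment (nw_corner Q n) (inord j).

End QMatrices.

Arguments restrict_to {R} g n k.

(* Main.v *)
Require Import Defs.
From HB Require Import structures.
From mathcomp Require Import all_boot all_order all_algebra.
From mathcomp Require Import all_classical all_reals all_analysis.
From mathcomp Require Import measurable_realfun.
From mathcomp Require Import ring lra.

Set Implicit Arguments.
Unset Strict Implicit.
Unset Printing Implicit Defensive.

Import Order.TTheory GRing.Theory Num.Theory.
Import numFieldNormedType.Exports.

Local Open Scope classical_set_scope.
Local Open Scope ring_scope.

(** The augmentation only alters the rates into j. Hence, until it returns to j,
    the truncated chain started from i other than j is the original chain until
    the latter hits j or leaves the window {0, ..., n}, in which case the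
    truncated chain is sent to j.

    Coupling. Let the truncated chain follow the original one until it dies, that
    is, hits j or leaves the window; from then on it must behave as a fresh chain
    with the augmented matrix started from j, independent of the past. The
    randomness for it comes from a second, independent copy of the original chain:
    the variables exp (- q (Y m) * S m), with Y the states and S the holding times
    of the copy, are independent and uniform ([uniform_seq_holding]), and a finite
    chain can be driven by them ([drive_law]). The law of the concatenation is
    computed in [spliced_law], since the probability of dying at a given step is
    the augmented jump probability into j, and [ctmc_of_sojourns] turns the
    concatenated states and sojourns into a chain. On a path started away from j,
    t is less than the return time of the truncated chain when the states visited
    up to t all lie in the window and differ from j ([lt_return_spliced]). These
    sets of times increase with n; as the path does not explode, it visits
    finitely many states up to t, and the union of these sets is the set of times
    before the return of the original chain. On them the two chains agree, so the
    return times converge by comparison and the integrals by monotone convergence.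

    Poisson's equation. Let A be the transition operator of the jump chain killed
    at j. For h >= 0 the expected integral of h up to the return is the potential
    U f = sum_m A^m f of f = h / q, each sojourn contributing its mean. The
    truncated chain has the same formula with A restricted to the window, up to a
    factor at j that tends to 1. The truncated potentials increase to U f, which is
    the least solution of f + A L <= L ([cvg_taboo_potential]). The means of g
    under the invariant vectors are potentials as well: each of them averages over
    an excursion from j, that is, the mean of h is U (h / q) j divided by
    U (1 / q) j. For the original chain the inequality >= comes from iterating the
    invariance, and equality propagates from j to all states by irreducibility
    ([pairing_potential]); for the truncated chain the remainder of the iteration
    vanishes because the state space is finite ([trunc_invariant]). In particular
    U (|g| / q) is finite at j, hence everywhere, and f_j (i) is a continuous
    function of the potentials of g^+, g^- and 1 at i and j, to which the limit
    can be applied termwise ([poisson_limit]). *)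

(** * Step paths *)

Section StepPaths.
Context {R : realType} {E : countType}.
Implicit Types (x : R -> E) (Y : nat -> E) (J : nat -> \bar R).

Definition right_continuous x := forall t, 0 <= t -> \forall s \near t^'+, x s = x t.

Lemma right_continuousP x : right_continuous x <->
  forall t, 0 <= t -> exists2 e, 0 < e & forall s, t <= s < t + e -> x s = x t.
Proof.
split=> H t t0; have := H t t0.
- case/nbhs_ballP => e /= e0 h; exists e => // s /andP[].
  rewrite le_eqVlt => /predU1P[->//|ts] ste; apply: h => //.
  by rewrite /ball /= ltr0_norm ?subr_lt0// opprB ltrBlDl.
- move=> [e e0 h]; apply/nbhs_ballP; exists e => //= s.
  rewrite /ball /= => hs ts; apply: h; rewrite (ltW ts) /=.
  by move: hs; rewrite ltr0_norm ?subr_lt0// opprB ltrBlDl.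
Qed.

Lemma jump_timeS x m : jump_time x m.+1 =
  ereal_inf [set t%:E | t in [set t : R |
    (jump_time x m <= t%:E)%E /\ x t <> x (fine (jump_time x m))]].
Proof. by []. Qed.

Lemma jump_time_le x m : (jump_time x m <= jump_time x m.+1)%E.
Proof. by rewrite jump_timeS; apply: le_ereal_inf_tmp => _ [t [ht _] <-]. Qed.

Lemma jump_time_ge0 x m : (0 <= jump_time x m)%E.
Proof. by elim: m => // m IH; apply: (le_trans IH); apply: jump_time_le. Qed.

Lemma jump_time_nondecreasing x : nondecreasing_seq (jump_time x).
Proof. by apply/nondecreasing_seqP => m; apply: jump_time_le. Qed.

Lemma jump_time_fine x m : (jump_time x m < +oo)%E ->
  jump_time x m = (fine (jump_time x m))%:E.
Proof. by move=> h; rewrite fineK// ge0_fin_numE// jump_time_ge0. Qed.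

Lemma fine_jump_time_ge0 x m : 0 <= fine (jump_time x m).
Proof. by apply: fine_ge0; apply: jump_time_ge0. Qed.

Lemma jump_time_const x m t : (jump_time x m <= t%:E < jump_time x m.+1)%E ->
  x t = x (fine (jump_time x m)).
Proof.
move=> /andP[mt tm]; apply: contraPP tm => ne; apply/negP; rewrite -leNgt jump_timeS.
by apply: ereal_inf_lbound; exists t.
Qed.

Lemma jump_time_lt x m : right_continuous x -> (jump_time x m < +oo)%E ->
  (jump_time x m < jump_time x m.+1)%E.
Proof.
move=> /right_continuousP rc fin.
have [e e0 h] := rc _ (fine_jump_time_ge0 x m).
apply: (@lt_le_trans _ _ (jump_time x m + e%:E)%E).
  by rewrite (jump_time_fine fin) -EFinD lte_fin ltrDl.
rewrite jump_timeS; apply: le_ereal_inf_tmp => _ [t [mt ne] <-].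
rewrite leNgt; apply/negP => tl; apply: ne; apply: h; move: mt tl.
by rewrite (jump_time_fine fin) -EFinD lee_fin lte_fin => -> ->.
Qed.

(** If the path were back at its former value at the jump time, it would keep
    this value for a while, and the infimum that defines the jump time would be
    larger. *)
Lemma jump_time_neq x m : right_continuous x -> (jump_time x m.+1 < +oo)%E ->
  x (fine (jump_time x m.+1)) <> x (fine (jump_time x m)).
Proof.
move=> /right_continuousP rc fin eq.
have [e e0 h] := rc _ (fine_jump_time_ge0 x m.+1).
suff : (jump_time x m.+1 + e%:E <= jump_time x m.+1)%E.
  by rewrite (jump_time_fine fin) -EFinD lee_fin leNgt ltrDl e0.
rewrite {2}jump_timeS; apply: le_ereal_inf_tmp => _ [t [mt ne] <-].
have mt' : (jump_time x m.+1 <= t%:E)%E.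
  by rewrite jump_timeS; apply: ereal_inf_lbound; exists t.
rewrite leNgt; apply/negP => tl; apply: ne; rewrite -eq; apply: h.
move: mt' tl; rewrite {1 2}jump_time_fine// -EFinD lee_fin lte_fin.
by move=> -> ->.
Qed.

(** The values and jump times of a non-explosive path; the value at index m is
    irrelevant when the m-th jump time is +oo. *)
Definition step_path x Y J :=
  [/\ J 0%N = 0%E,
      forall m, (J m <= J m.+1)%E /\ ((J m < +oo)%E -> (J m < J m.+1)%E),
      forall m t, (J m <= t%:E < J m.+1)%E -> x t = Y m,
      forall m, (J m.+1 < +oo)%E -> Y m.+1 <> Y m
    & J n @[n --> \oo] --> +oo%E].

Lemma jump_time_step_path x : right_continuous x ->
  jump_time x n @[n --> \oo] --> +oo%E ->
  step_path x (fun m => x (fine (jump_time x m))) (jump_time x).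
Proof.
move=> rc oo; split => //.
- by move=> m; split; [exact: jump_time_le|exact: jump_time_lt].
- by move=> m t; exact: jump_time_const.
- by move=> m; exact: jump_time_neq.
Qed.

Section Facts.
Variables (x : R -> E) (Y : nat -> E) (J : nat -> \bar R).
Hypothesis xYJ : step_path x Y J.

Lemma step_path_nd : nondecreasing_seq J.
Proof. by case: xYJ => _ h _ _ _; apply/nondecreasing_seqP => m; case: (h m). Qed.

Lemma step_path_ge0 m : (0 <= J m)%E.
Proof. by case: (xYJ) => <- _ _ _ _; apply: step_path_nd. Qed.

Lemma step_path_fine m : (J m < +oo)%E -> J m = (fine (J m))%:E.
Proof. by move=> h; rewrite fineK// ge0_fin_numE// step_path_ge0. Qed.

Lemma step_path_val m : (J m < +oo)%E -> x (fine (J m)) = Y m.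
Proof.
case: (xYJ) => _ hJ hx _ _ fin; apply: hx; rewrite -step_path_fine// lexx /=.
by apply: (hJ m).2.
Qed.

Lemma step_path_locate t : 0 <= t -> exists m, (J m <= t%:E < J m.+1)%E.
Proof.
case: (xYJ) => J0 _ _ _ /cvgeyPgt /(_ t) [N _ hN] t0.
have ex : exists n, (t%:E < J n)%E by exists N; apply: hN => /=.
case: (ex_minnP ex) => -[|m] mt mmin.
  by move: mt; rewrite J0 lte_fin ltNge t0.
exists m; rewrite mt andbT leNgt; apply/negP => /mmin; by rewrite ltnn.
Qed.

Lemma step_path_right_continuous : right_continuous x.
Proof.
apply/right_continuousP => t t0.
have [m /andP[mt tm]] := step_path_locate t0.
case: xYJ => _ _ hx _ _.
have [e e0 he] : exists2 e, 0 < e & ((t + e)%:E <= J m.+1)%E.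
  case: (J m.+1) tm => [r| |//].
  - rewrite lte_fin => tr; exists (r - t); first by rewrite subr_gt0.
    by rewrite lee_fin addrC subrK.
  - by move=> _; exists 1 => //; rewrite leey.
exists e => // s /andP[ts se]; rewrite (hx m t) ?mt ?tm//; apply: hx.
by rewrite (le_trans mt) ?lee_fin//= (lt_le_trans _ he)// lte_fin.
Qed.

(** Consecutive values differ, so that the path determines its jump times. Hence
    a path that is assembled from prescribed sojourns has exactly these sojourns. *)
Lemma step_path_jump_time m : jump_time x m = J m.
Proof.
elim: m => [|m IH] /=; first by case: xYJ.
rewrite IH.
have [fin|] := ltP (J m) +oo%E; last first.
  rewrite leye_eq => /eqP Joo.
  have -> : J m.+1 = +oo%E by apply/eqP; rewrite -leye_eq -Joo step_path_nd.
  rewrite Joo; apply/eqP; rewrite -leye_eq; apply: le_ereal_inf_tmp.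
  by move=> _ [t [h _] <-].
rewrite step_path_val//; apply/eqP; rewrite eq_le; apply/andP; split.
- have [fin'|] := ltP (J m.+1) +oo%E; last first.
    by rewrite leye_eq => /eqP ->; rewrite leey.
  rewrite (step_path_fine fin'); apply: ereal_inf_lbound.
  exists (fine (J m.+1)) => //; split.
    by rewrite -step_path_fine// step_path_nd.
  by rewrite step_path_val//; case: xYJ => _ _ _ h _; exact: h.
- apply: le_ereal_inf_tmp => _ [t [mt ne] <-]; rewrite leNgt; apply/negP => tm.
  by apply: ne; case: xYJ => _ _ h _ _; apply: h; rewrite mt.
Qed.

(** Index 0 is not tested: the return time is at least the first jump time. *)
Definition avoids Y (j : E) m := all (fun l => Y l.+1 != j) (iota 0 m).

Lemma avoidsP (Z : nat -> E) j m :
  reflect (forall l, (0 < l <= m)%N -> Z l <> j) (avoids Z j m).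
Proof.
apply: (iffP allP) => [h [|l]//= lm|h l].
  by apply/eqP; apply: h; rewrite mem_iota.
by rewrite mem_iota /= add0n => lm; apply/eqP; apply: h.
Qed.

Lemma lt_return_time j m t : (J m <= t%:E < J m.+1)%E ->
  (t%:E < return_time j x)%E = avoids Y j m.
Proof.
move=> /andP[mt tm]; case: (xYJ) => J0 hJ hx _ _.
apply/idP/avoidsP => [lt l /andP[l0 lm] Yl|av].
- have Jlt : (J l <= t%:E)%E by apply: le_trans mt; apply: step_path_nd.
  have fin : (J l < +oo)%E by apply: le_lt_trans Jlt _; rewrite ltry.
  suff : (return_time j x <= J l)%E by move=> /(lt_le_trans lt); rewrite ltNge Jlt.
  rewrite step_path_fine//; apply: ereal_inf_lbound; exists (fine (J l)) => //.
  split; last by rewrite step_path_val.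
  by rewrite -step_path_fine// (step_path_jump_time 1); apply: step_path_nd.
- apply: lt_le_trans tm _; apply: le_ereal_inf_tmp => _ [r [+ xr] <-].
  rewrite step_path_jump_time => r1.
  have r0 : 0 <= r by rewrite -lee_fin; apply: le_trans r1; apply: step_path_ge0.
  have [k /andP[kr rk]] := step_path_locate r0.
  have km : (m < k)%N.
    rewrite ltnNge; apply/negP => km; apply: (av k); last by rewrite -(hx _ r) ?kr.
    rewrite km andbT lt0n; apply/eqP => k0; move: rk r1; rewrite k0.
    by move=> /lt_le_trans h /h; rewrite ltxx.
  by apply: le_trans kr; apply: step_path_nd.
Qed.

Lemma measurable_step_set (a b : \bar R) : (0 <= a)%E ->
  measurable [set t : R | (a <= t%:E < b)%E].
Proof.
move=> a0; case: a a0 => [a| |//] a0; last first.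
  rewrite [X in measurable X](_ : _ = set0)//.
  by apply/seteqP; split=> // t /=; rewrite leye_eq.
case: b => [b| |].
- rewrite [X in measurable X](_ : _ = `[a, b[%classic); first exact: measurable_itv.
  by apply/seteqP; split=> t /=; rewrite in_itv /= lee_fin lte_fin.
- rewrite [X in measurable X](_ : _ = `[a, +oo[%classic); first exact: measurable_itv.
  by apply/seteqP; split=> t /=; rewrite in_itv /= lee_fin ltry.
- rewrite [X in measurable X](_ : _ = set0)//.
  by apply/seteqP; split=> // t /=; rewrite ltNge leNye andbF.
Qed.

Lemma lebesgue_step_set (a b : \bar R) : (0 <= a)%E -> (a < b)%E ->
  lebesgue_measure [set t : R | (a <= t%:E < b)%E] = (b - a)%E.
Proof.
case: a => [a| |//] a0 ab; last by move: ab; rewrite ltNge leey.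
case: b ab => [b| |//] ab.
- rewrite [X in lebesgue_measure X](_ : _ = `[a, b[%classic); last first.
    by apply/seteqP; split=> t /=; rewrite in_itv /= lee_fin lte_fin.
  by rewrite lebesgue_measure_itv /= ab.
- rewrite [X in lebesgue_measure X](_ : _ = `[a, +oo[%classic); last first.
    by apply/seteqP; split=> t /=; rewrite in_itv /= lee_fin ltry.
  by rewrite lebesgue_measure_itv /= ltry.
Qed.

Lemma measurable_fun_step_path (h : E -> R) :
  measurable_fun [set t : R | 0 <= t] (fun t => (h (x t))%:E).
Proof.
rewrite (_ : [set t : R | 0 <= t] =
    \bigcup_m [set t : R | (J m <= t%:E < J m.+1)%E]); last first.
  apply/seteqP; split => [t /= t0|t [m _ /= /andP[mt _]]].
    by have [m ?] := step_path_locate t0; exists m.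
  by rewrite -lee_fin; apply: le_trans mt; apply: step_path_ge0.
apply/measurable_fun_bigcup => m.
  by apply: measurable_step_set; apply: step_path_ge0.
apply: (eq_measurable_fun (cst (h (Y m))%:E)) => [t|]; last exact: measurable_cst.
by case: xYJ => _ _ hx _ _; rewrite inE /= => /hx ->.
Qed.

(** The times before the return are the disjoint union of the sojourns before
    the first visit to j. *)
Lemma xi_step_path j (h : E -> R) : (forall k, 0 <= h k) ->
  (forall m, (J m < +oo)%E) ->
  xi j h x = (\sum_(0 <= m <oo)
    if avoids Y j m then (h (Y m) * (fine (J m.+1) - fine (J m)))%:E else 0)%E.
Proof.
move=> h0 fin; rewrite /xi.
case: (xYJ) => J0 hJ hx _ _.
pose F m := if avoids Y j m then [set t : R | (J m <= t%:E < J m.+1)%E] else set0.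
have FJ m t : F m t -> (J m <= t%:E < J m.+1)%E.
  by rewrite /F; case: ifP => //= ->.
have -> : [set t | 0 <= t /\ (t%:E < return_time j x)%E] = \bigcup_m F m.
  apply/seteqP; split => [t [t0 tr]|t [m _ Fmt]].
    have [m ht] := step_path_locate t0; exists m => //.
    by rewrite /F -(lt_return_time _ ht) tr.
  have ht := FJ _ _ Fmt; split.
    rewrite -lee_fin; case/andP: ht => + _; apply: le_trans; exact: step_path_ge0.
  by rewrite (lt_return_time _ ht); move: Fmt; rewrite /F; case: ifP.
have mF m : measurable (F m).
  by rewrite /F; case: ifP => // _; apply: measurable_step_set; exact: step_path_ge0.
rewrite ge0_integral_bigcup//; first last.
- apply/trivIsetP => a b _ _.
  wlog ab : a b / (a < b)%N.
    move=> H ne; have [/H->//|ba|/eqP] := ltngtP a b; last by rewrite (negbTE ne).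
    by rewrite setIC; apply: H => //; rewrite eq_sym.
  move=> _; apply/seteqP; split => // t [/FJ /andP[_ h1] /FJ /andP[h2 _]] /=.
  have := lt_le_trans h1 (le_trans (step_path_nd ab) h2).
  by rewrite ltxx.
- by move=> t _; rewrite lee_fin.
- apply/measurable_fun_bigcup => // m.
  apply: (eq_measurable_fun (cst (h (Y m))%:E)) => [t|]; last exact: measurable_cst.
  by rewrite inE => /FJ /hx ->.
apply: eq_eseriesr => m _.
have [av|nav] := boolP (avoids Y j m); last first.
  by rewrite /F (negbTE nav) integral_set0.
rewrite (eq_integral (cst (h (Y m))%:E)); last by move=> t; rewrite inE => /FJ /hx ->.
have FE : F m = [set t : R | (J m <= t%:E < J m.+1)%E] by rewrite /F av.
rewrite integral_cst; last exact: mF.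
rewrite FE; transitivity ((h (Y m))%:E * (J m.+1 - J m))%E.
  congr (_ * _)%E; apply: lebesgue_step_set; first exact: step_path_ge0.
  by apply: (hJ m).2.
by rewrite (step_path_fine (fin m)) (step_path_fine (fin m.+1)) -EFinB -EFinM.
Qed.

End Facts.
End StepPaths.

(** * Measurability of jump times *)

Section Measurability.
Context {R : realType} {d : measure_display} {Omega : measurableType d}.
Context {E : countType}.

(** Measurability of a map into a countable set, without a sigma-algebra on it. *)
Definition discrete_measurable (f : Omega -> E) :=
  forall k, measurable [set w | f w = k].

Lemma bigcup_count_measurable (F : E -> set Omega) :
  (forall k, measurable (F k)) -> measurable (\bigcup_k F k).
Proof. by move=> mF; apply: countable_bigcupT_measurable. Qed.

Lemma discrete_measurable_pred (f : Omega -> E) (P : E -> Prop) :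
  discrete_measurable f -> measurable [set w | P (f w)].
Proof.
move=> mf.
rewrite [X in measurable X](_ : _ =
    \bigcup_k (if `[< P k >] then [set w | f w = k] else set0)); last first.
  apply/seteqP; split=> w /=.
    by move=> Pf; exists (f w) => //; case: asboolP.
  by move=> [k _]; case: asboolP => // Pk /= ->.
by apply: bigcup_count_measurable => k; case: asboolP => // _; exact: mf.
Qed.

Lemma discrete_measurable_rel (f g : Omega -> E) (P : E -> E -> Prop) :
  discrete_measurable f -> discrete_measurable g ->
  measurable [set w | P (f w) (g w)].
Proof.
move=> mf mg.
rewrite [X in measurable X](_ : _ =
    \bigcup_k ([set w | f w = k] `&` [set w | P k (g w)])); last first.
  apply/seteqP; split=> w /=; first by move=> Pf; exists (f w).
  by move=> [k _ [-> ?]].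
apply: bigcup_count_measurable => k; apply: measurableI; first exact: mf.
exact: (discrete_measurable_pred (P k)).
Qed.

Variables (Phi : R -> Omega -> E).
Hypothesis mPhi : forall t k, 0 <= t -> measurable [set w | Phi t w = k].
Hypothesis rPhi : forall w, right_continuous (Phi ^~ w).

(** By right-continuity, the state at a random time is read off at rational
    times just after it. *)
Lemma measurable_at_time (T : Omega -> R) : measurable_fun setT T ->
  (forall w, 0 <= T w) -> discrete_measurable (fun w => Phi (T w) w).
Proof.
move=> mT T0 k.
have mlt1 (q : R) : measurable [set w | T w < q].
  rewrite -[X in measurable X]setTI.
  have := measurable_fun_ltr mT (measurable_cst q).
  by move=> /(_ measurableT [set true] I).
have mlt2 (q e : R) : measurable [set w | q < T w + e].
  rewrite -[X in measurable X]setTI.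
  have := measurable_fun_ltr (measurable_cst q) (measurable_funD mT (measurable_cst e)).
  by move=> /(_ measurableT [set true] I).
rewrite [X in measurable X](_ : _ = \bigcup_n ~` (\bigcup_(q : rat)
    ([set w | T w < ratr q] `&` [set w | ratr q < T w + n.+1%:R^-1] `&`
     [set w | 0 <= ratr q :> R /\ Phi (ratr q) w <> k]))); last first.
  apply/seteqP; split=> w /=.
  - move=> <-; have [e e0 h] := (right_continuousP _).1 (rPhi w) _ (T0 w).
    have [n hn] : exists n, n.+1%:R^-1 < e.
      exists (Num.truncn e^-1); rewrite invf_plt ?posrE//.
      by apply: truncnS_gt.
    exists n => // -[q _ [[/= q1 q2] [q0 ]]]; apply; apply: h.
    by rewrite (ltW q1)/= (lt_trans q2)// ltrD2l.
  - move=> [n _ h]; have [e e0 he] := (right_continuousP _).1 (rPhi w) _ (T0 w).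
    have e'0 : 0 < Num.min e n.+1%:R^-1 by rewrite lt_min e0 /= invr_gt0.
    have [q] := @rat_in_itvoo R (T w) (T w + Num.min e n.+1%:R^-1) ltac:(by rewrite ltrDl).
    rewrite in_itv /= => /andP[q1 q2].
    rewrite -(he (ratr q)); last first.
      by rewrite (ltW q1)/= (lt_le_trans q2)// lerD2l ge_min lexx.
    apply: contrapT => ne; apply: h; exists q => //=; split; last first.
      by split => //; rewrite (le_trans (T0 w))// ltW.
    by split => //; rewrite (lt_le_trans q2)// lerD2l ge_min lexx orbT.
apply: bigcupT_measurable => n; apply: measurableC.
apply: bigcupT_measurable_rat => q; apply: measurableI; first exact: measurableI.
have [q0|q0] := pselect (0 <= ratr q :> R); last first.
  rewrite [X in measurable X](_ : _ = set0)//.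
  by apply/seteqP; split=> // w [].
rewrite [X in measurable X](_ : _ = ~` [set w | Phi (ratr q) w = k]).
  by apply: measurableC; exact: mPhi.
by apply/seteqP; split=> w /=; [case|].
Qed.

(** By right-continuity, a path that has left its m-th state before time r is out
    of this state at a rational time before r. *)
Lemma measurable_jump_time m :
  measurable_fun setT (fun w => jump_time (Phi ^~ w) m).
Proof.
elim: m => [|m IH]; first exact: measurable_cst.
have mY : discrete_measurable (fun w => Phi (fine (jump_time (Phi ^~ w) m)) w).
  apply: measurable_at_time => [|w]; last exact: fine_jump_time_ge0.
  by apply: measurableT_comp.
suff key (r : R) : measurable [set w | (jump_time (Phi ^~ w) m.+1 < r%:E)%E].
  apply: (measurability _ (ErealGenInftyO.measurableE R)).
  move=> _ [_ [r ->] <-]; rewrite setTI; apply: eq_ind (key r) _ _.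
  by apply/seteqP; split=> w /=; rewrite in_itv.
have -> : [set w | (jump_time (Phi ^~ w) m.+1 < r%:E)%E] = (\bigcup_(q : rat)
   ([set w | (jump_time (Phi ^~ w) m <= (ratr q : R)%:E)%E] `&`
    [set w | 0 <= (ratr q : R) < r /\
      Phi (ratr q) w <> Phi (fine (jump_time (Phi ^~ w) m)) w])).
  apply/seteqP; split=> w.
  - move=> /ereal_inf_ltP [_ [t [mt ne] <-]]; rewrite lte_fin => tr.
    have t0 : 0 <= t by rewrite -lee_fin; apply: le_trans mt; exact: jump_time_ge0.
    have [e e0 he] := (right_continuousP _).1 (rPhi w) _ t0.
    have [q] := @rat_in_itvoo R t (Num.min (t + e) r)
      ltac:(by rewrite lt_min ltrDl e0 tr).
    rewrite in_itv /= lt_min => /andP[q1 /andP[q2 q3]].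
    exists q => //; split => /=; first by rewrite (le_trans mt)// lee_fin ltW.
    rewrite (le_trans t0 (ltW q1)) q3; split => //.
    by rewrite (he (ratr q)) ?q2 ?(ltW q1).
  - move=> [q _ [/= mq [/andP[q0 qr] ne]]].
    apply/ereal_inf_ltP; exists (ratr q)%:E; rewrite ?lte_fin//.
    by exists (ratr q).
apply: bigcupT_measurable_rat => q; apply: measurableI.
  rewrite -[X in measurable X]setTI; apply: emeasurable_fun_infty_c => //.
have [q0|q0] := boolP (0 <= (ratr q : R) < r); last first.
  rewrite [X in measurable X](_ : _ = set0)//.
  by apply/seteqP; split=> // w [].
rewrite [X in measurable X](_ : _ =
  [set w | Phi (ratr q) w <> Phi (fine (jump_time (Phi ^~ w) m)) w]).
  apply: (@discrete_measurable_rel _ _ (fun a b => a <> b)) => //.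
  by move=> k; apply: mPhi; case/andP: q0.
by apply/seteqP; split=> w /=; [case|].
Qed.

Lemma measurable_embedded_chain m :
  discrete_measurable (fun w => Phi (fine (jump_time (Phi ^~ w) m)) w).
Proof.
apply: measurable_at_time => [|w]; last exact: fine_jump_time_ge0.
by apply: measurableT_comp => //; exact: measurable_jump_time.
Qed.

End Measurability.

(** * Null sets and integrands that need not be measurable *)

Section NullSets.
Import HBNNSimple.
Context {R : realType} {d : measure_display} {Omega : measurableType d}.
Variable mu : {measure set Omega -> \bar R}.

Lemma ae_and (A B : Omega -> Prop) : {ae mu, forall w, A w} ->
  {ae mu, forall w, B w} -> {ae mu, forall w, A w /\ B w}.
Proof. by move=> hA hB; apply: filterI. Qed.

Lemma ae_imply (A B : Omega -> Prop) : (forall w, A w -> B w) ->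
  {ae mu, forall w, A w} -> {ae mu, forall w, B w}.
Proof. by move=> h; apply: filterS. Qed.

Lemma negligible_count (T : countType) (F : T -> set Omega) :
  (forall t, mu.-negligible (F t)) -> mu.-negligible (\bigcup_t F t).
Proof.
move=> nF.
apply: (@negligibleS _ _ _ _ (\bigcup_k
  (if unpickle k is Some t then F t else set0))).
  by move=> w [t _ Ftw]; exists (pickle t) => //; rewrite pickleK.
apply: negligible_bigcup => k; case: unpickle => [t|]; first exact: nF.
exact: negligible_set0.
Qed.

Lemma ae_count (T : countType) (A : T -> Omega -> Prop) :
  (forall t, {ae mu, forall w, A t w}) -> {ae mu, forall w, forall t, A t w}.
Proof.
move=> h; rewrite /almost_everywhere.
apply: (@negligibleS _ _ _ _ (\bigcup_t ~` [set w | A t w])).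
  by move=> w /= /existsNP [t nA]; exists t.
exact: negligible_count.
Qed.

Lemma ae_measure_eq (A B : set Omega) : measurable A -> measurable B ->
  {ae mu, forall w, A w <-> B w} -> mu A = mu B.
Proof.
move=> mA mB [N [mN N0 sub]].
have half (C D : set Omega) : measurable C -> measurable D ->
    (forall w, ~ N w -> C w -> D w) -> (mu C <= mu D)%E.
  move=> mC mD CD; apply: (@le_trans _ _ (mu (D `|` N))).
    apply: le_measure; rewrite ?inE//; first exact: measurableU.
    by move=> w Cw; have [?|nN] := pselect (N w); [right|left; exact: CD].
  apply: (le_trans (measureU2 _ mD mN)).
  by rewrite -[leRHS]adde0; apply: leeD => //; rewrite le_eqVlt; apply/orP; left; apply/eqP.
have h w : ~ N w -> A w <-> B w by move=> nN; apply: contrapT => /sub.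
by apply/eqP; rewrite eq_le !half// => w /h [].
Qed.

(** No measurability: the integral of a nonnegative function is a supremum over
    the simple functions below it. *)
Lemma le_integral_nonmeasurable (f g : Omega -> \bar R) :
  (forall w, 0 <= f w)%E -> (forall w, f w <= g w)%E ->
  (\int[mu]_w f w <= \int[mu]_w g w)%E.
Proof.
move=> f0 fg; have g0 w : (0 <= g w)%E by exact: le_trans (f0 w) (fg w).
rewrite !ge0_integralTE//; apply: ereal_sup_le => _ [h hf <-].
by exists h => // w; apply: le_trans (fg w).
Qed.

Let ae_ge0_integral_le (f g : Omega -> \bar R) :
  (forall w, 0 <= f w)%E -> (forall w, 0 <= g w)%E -> measurable_fun setT g ->
  {ae mu, forall w, f w = g w} ->
  (\int[mu]_w f w <= \int[mu]_w g w)%E.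
Proof.
move=> f0 g0 mg aefg; rewrite ge0_integralTE//.
apply: ge_ereal_sup => _ [h hf <-].
rewrite -integralT_nnsfun; apply: ae_ge0_le_integral => //.
- by move=> w _; rewrite lee_fin; exact: fun_ge0.
- by apply/measurable_EFinP; exact: measurable_funPT.
by apply: ae_imply aefg => w <- _.
Qed.

Lemma ae_ge0_integral_eq (f g : Omega -> \bar R) :
  (forall w, 0 <= f w)%E -> (forall w, 0 <= g w)%E -> measurable_fun setT g ->
  {ae mu, forall w, f w = g w} -> (\int[mu]_w f w = \int[mu]_w g w)%E.
Proof.
move=> f0 g0 mg aefg; apply/eqP; rewrite eq_le ae_ge0_integral_le//=.
move: (aefg) => [N [mN N0 sub]].
have mgN : measurable_fun setT ((g \_ (~` N))%E : _ -> \bar R).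
  by apply/(measurable_restrictT _ (measurableC mN)); exact: measurable_funTS.
have -> : (\int[mu]_w g w = \int[mu]_w (g \_ (~` N)) w)%E.
  apply: ae_eq_integral => //.
  exists N; split => // w /= h; apply: contrapT => nN; apply: h => _.
  by rewrite patchE mem_set.
apply: le_integral_nonmeasurable => w; rewrite patchE; case: ifP => //.
by rewrite inE /= => nN; rewrite -(_ : f w = g w)//; apply: contrapT => /sub.
Qed.

(** As a function of the outcome, xi is only known to be almost surely equal to a
    measurable function, which is why f is arbitrary. *)
Lemma ae_integral_eq (f g : Omega -> \bar R) : measurable_fun setT g ->
  {ae mu, forall w, f w = g w} -> (\int[mu]_w f w = \int[mu]_w g w)%E.
Proof.
move=> mg aefg; rewrite (integralE _ _ f) (integralE _ _ g); congr (_ - _)%E.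
- apply: ae_ge0_integral_eq => //; first exact: measurable_funepos.
  by apply: ae_imply aefg => w; rewrite !funeposE => ->.
- apply: ae_ge0_integral_eq => //; first exact: measurable_funeneg.
  by apply: ae_imply aefg => w; rewrite !funenegE => ->.
Qed.

End NullSets.

(** * Jump chains with exponential holding times *)

Section JumpHold.
Context {R : realType} {d : measure_display} {Omega : measurableType d}.

Definition path_prob (Pi : nat -> nat -> R) (i : nat) (y : nat -> nat) n : R :=
  (y 0%N == i)%:R * \prod_(m < n) Pi (y m) (y m.+1).

(** States are coded as naturals and holding times are finite reals, so that
    chains on different state spaces share the same form. *)
Record jump_hold (P : probability Omega R) (q : nat -> R)
    (Pi : nat -> nat -> R) (i : nat)
    (Y : nat -> Omega -> nat) (S : nat -> Omega -> R) : Prop := JumpHold {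
  jh_state : forall m, discrete_measurable (Y m);
  jh_hold : forall m, measurable_fun setT (S m);
  jh_ge0 : forall m w, 0 <= S m w;
  jh_pos : {ae P, forall w, forall m, 0 < S m w};
  jh_law : forall n (y : nat -> nat) (t : nat -> R), (forall m, 0 <= t m) ->
    P [set w | forall m, (m <= n)%N -> Y m w = y m /\ t m < S m w] =
    (path_prob Pi i y n * \prod_(m < n.+1) expR (- (q (y m) * t m)))%:E }.

Lemma measurable_forall_le n (A : nat -> set Omega) :
  (forall m, measurable (A m)) ->
  measurable [set w | forall m, (m <= n)%N -> A m w].
Proof.
by move=> mA; apply: (@bigcap_measurableType _ _ A (fun l => (l <= n)%N)).
Qed.

Lemma measurable_gt (T : Omega -> R) (t : R) : measurable_fun setT T ->
  measurable [set w | t < T w].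
Proof.
move=> mT; rewrite -[X in measurable X]setTI.
have := measurable_fun_ltr (measurable_cst t) mT.
by move=> /(_ measurableT [set true] I).
Qed.

Lemma measurable_lt (T : Omega -> R) (t : R) : measurable_fun setT T ->
  measurable [set w | T w < t].
Proof.
move=> mT; rewrite -[X in measurable X]setTI.
have := measurable_fun_ltr mT (measurable_cst t).
by move=> /(_ measurableT [set true] I).
Qed.

Section FromPath.
Context {E : countType}.
Variables (Q : E -> E -> R) (P : probability Omega R) (i : E).
Variable Phi : R -> Omega -> E.
Hypothesis hPhi : is_ctmc Q P i Phi.
Let J n w := jump_time (Phi ^~ w) n.
Let Y n w := Phi (fine (J n w)) w.

Let rPhi w : right_continuous (Phi ^~ w).
Proof. by case: hPhi => _ h _ _; exact: h. Qed.

Let mPhi (t : R) k : 0 <= t -> measurable [set w | Phi t w = k].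
Proof. by case: hPhi => h _ _ _; exact: h. Qed.

Let Jfine n w : (J n w < +oo)%E -> J n w = (fine (J n w))%:E.
Proof. exact: jump_time_fine. Qed.

Lemma ctmc_measurable_jump_time n : measurable_fun setT (J n).
Proof. exact: measurable_jump_time. Qed.

Lemma ctmc_measurable_embedded n : discrete_measurable (Y n).
Proof. exact: measurable_embedded_chain. Qed.

Lemma measurable_ctmc_event n (y : nat -> E) (t : nat -> R) :
  measurable [set w | [/\ (J n w < +oo)%E,
                 forall m, (m <= n)%N -> Y m w = y m &
                 forall m, (m <= n)%N -> (J m w + (t m)%:E < J m.+1 w)%E]].
Proof.
rewrite [X in measurable X](_ : _ = [set w | (J n w < +oo)%E] `&`
   [set w | forall m, (m <= n)%N -> [set w | Y m w = y m] w] `&`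
   [set w | forall m, (m <= n)%N ->
      [set w | (J m w + (t m)%:E < J m.+1 w)%E] w]); last first.
  by apply/seteqP; split=> w /=; [case|move=> [[]]].
apply: measurableI; first apply: measurableI.
- rewrite -[X in measurable X]setTI; apply: emeasurable_fun_infty_o => //.
  exact: ctmc_measurable_jump_time.
- by apply: measurable_forall_le => m; exact: ctmc_measurable_embedded.
- apply: measurable_forall_le => m; rewrite -[X in measurable X]setTI.
  apply: measurable_lte => //; last exact: ctmc_measurable_jump_time.
  apply: emeasurable_funD; last exact: measurable_cst.
  exact: ctmc_measurable_jump_time.
Qed.

Lemma ctmc_law n (y : nat -> E) (t : nat -> R) : (forall m, 0 <= t m) ->
  P [set w | [/\ (J n w < +oo)%E,
                 forall m, (m <= n)%N -> Y m w = y m &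
                 forall m, (m <= n)%N -> (J m w + (t m)%:E < J m.+1 w)%E]]
  = ((y 0%N == i)%:R
     * (\prod_(m < n) jump_prob Q (y m) (y m.+1))
     * \prod_(m < n.+1) expR (Q (y m) (y m) * t m))%:E.
Proof. by case: hPhi => _ _ h _; exact: h. Qed.

Lemma ctmc_jump_time_shift n w : (J n w < +oo)%E -> (J n w + 0%:E < J n.+1 w)%E.
Proof. by rewrite adde0 => h; exact: jump_time_lt. Qed.

Hypothesis Qneg : forall a, Q a a < 0.

(** On this event the n-th holding time exceeds every integer, and the probability
    that it exceeds k decays exponentially in k. *)
Let no_absorption n (y : nat -> E) : P.-negligible
  [set w | [/\ (J n w < +oo)%E, forall m, (m <= n)%N -> Y m w = y m &
               (J n.+1 w = +oo)%E]].
Proof.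
pose t (K : R) m : R := if m == n then K else 0.
pose F (K : R) := [set w | [/\ (J n w < +oo)%E,
                 forall m, (m <= n)%N -> Y m w = y m &
                 forall m, (m <= n)%N -> (J m w + (t K m)%:E < J m.+1 w)%E]].
have mF K : measurable (F K) by exact: measurable_ctmc_event.
pose G := \bigcap_(k in [set: nat]) F k%:R.
have mG : measurable G by apply: bigcapT_measurable.
have t0 k m : 0 <= t k%:R m by rewrite /t; case: ifP.
pose C := (y 0%N == i)%:R * (\prod_(m < n) jump_prob Q (y m) (y m.+1)).
have PF k : P (F k%:R) = (C * expR (Q (y n) (y n) * k%:R))%:E.
  rewrite ctmc_law// big_ord_recr /= /t eqxx [X in _ * (X * _)]big1 ?mul1r//.
  by move=> m _; rewrite ltn_eqF// mulr0 expR0.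
exists G; split => //; last first.
  move=> w [Jn hY Joo] k _; split => // m mn.
  have Jm : (J m w < +oo)%E by apply: le_lt_trans Jn; exact: jump_time_nondecreasing.
  rewrite /t; case: eqP => [->|_]; last exact: ctmc_jump_time_shift.
  by rewrite Joo lte_add_pinfty ?ltry.
have PG k : (P G <= (C * expR (Q (y n) (y n) * k%:R))%:E)%E.
  by rewrite -PF; apply: le_measure; rewrite ?inE//; exact: bigcap_inf.
apply/eqP; rewrite eq_le measure_ge0 andbT.
have finG : P G \is a fin_num by exact: fin_num_measure.
move: PG; rewrite -(fineK finG); set r := fine _ => PG.
rewrite lee_fin leNgt; apply/negP => r0.
pose k := (Num.truncn (C / (r * - Q (y n) (y n)))).+1.
have q0 : 0 < - Q (y n) (y n) by rewrite oppr_gt0.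
have := PG k; rewrite lee_fin leNgt => /negP; apply.
rewrite -[Q (y n) (y n)]opprK mulNr expRN ltr_pdivrMr ?expR_gt0//.
apply: (@lt_le_trans _ _ (r * (1 + - Q (y n) (y n) * k%:R))); last first.
  by rewrite ler_wpM2l ?(ltW r0)// expR_ge1Dx.
rewrite mulrDr mulr1 mulrA (@lt_trans _ _ (r * - Q (y n) (y n) * k%:R))//.
  by rewrite -ltr_pdivrMl ?mulr_gt0// mulrC; exact: truncnS_gt.
by rewrite ltrDr.
Qed.

(** The first infinite jump time is preceded by one of countably many finite
    histories of states. *)
Lemma ctmc_finite_jump_times : {ae P, forall w, forall m, (J m w < +oo)%E}.
Proof.
pose A (s : seq E) w := ~ [/\ (J (size s).-1 w < +oo)%E,
  forall m, (m <= (size s).-1)%N -> Y m w = nth i s m &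
  (J (size s).-1.+1 w = +oo)%E].
apply: (@ae_imply _ _ _ _ (fun w => forall s, A s w)); last first.
  apply: ae_count => s; have := no_absorption (size s).-1 (nth i s).
  by apply: negligibleS => w /contrapT.
move=> w hA m; elim: m => [|m IH]; first exact: ltry.
rewrite ltNge leye_eq; apply/negP => /eqP Joo.
apply: (hA [seq Y l w | l <- iota 0 m.+1]).
rewrite size_map size_iota succnK; split => // l lm.
by rewrite (nth_map 0%N) ?size_iota// nth_iota// add0n.
Qed.

Lemma ctmc_step_path : {ae P, forall w, (forall m, (J m w < +oo)%E) /\
  step_path (Phi ^~ w) (fun m => Y m w) (fun m => J m w)}.
Proof.
case: hPhi => _ _ _ exp; apply: ae_imply (ae_and ctmc_finite_jump_times exp).
by move=> w [fin oo]; split => //; exact: jump_time_step_path.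
Qed.

Definition holding n w : R := fine (J n.+1 w - J n w)%E.

Lemma holdingE n w : (forall m, (J m w < +oo)%E) ->
  holding n w = fine (J n.+1 w) - fine (J n w).
Proof.
move=> fin; rewrite /holding (Jfine (fin n.+1)) (Jfine (fin n)).
by rewrite -EFinB.
Qed.

Lemma holding_ge0 n w : 0 <= holding n w.
Proof.
rewrite /holding; have : (J n w <= J n.+1 w)%E by exact: jump_time_le.
have : (0 <= J n w)%E by exact: jump_time_ge0.
case: (J n w) => [r| |]// _; case: (J n.+1 w) => [s| |]//.
by rewrite lee_fin subr_ge0.
Qed.

(** The inequalities between jump times in the law of the chain are inequalities
    on holding times, because almost surely all jump times are finite. A history
    outside the range of the code c has probability zero on both sides. *)
Lemma ctmc_jump_hold (c : E -> nat) (q : nat -> R) (Pi : nat -> nat -> R) :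
  injective c -> (forall a, q (c a) = - Q a a) ->
  (forall a b, Pi (c a) (c b) = jump_prob Q a b) ->
  (forall a b, (forall e, c e <> b) -> Pi a b = 0) ->
  jump_hold P q Pi (c i) (fun m w => c (Y m w)) holding.
Proof.
move=> cI hq hPi hPi0.
have mc m : discrete_measurable (fun w => c (Y m w)).
  move=> k; apply: (discrete_measurable_pred (fun e => c e = k)).
  exact: ctmc_measurable_embedded.
have mS m : measurable_fun setT (holding m).
  apply: measurableT_comp => //.
  by apply: emeasurable_funB; exact: ctmc_measurable_jump_time.
split => //; first exact: holding_ge0.
  apply: ae_imply ctmc_finite_jump_times => w fin m; rewrite holdingE// subr_gt0.
  rewrite -lte_fin -(Jfine (fin m)) -(Jfine (fin m.+1)).
  by apply: jump_time_lt; [exact: rPhi|exact: fin].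
move=> n y t t0; have [ran|nran] := pselect (forall m, (m <= n)%N -> exists e, c e = y m).
- pose y' m : E := if pselect (exists e, c e = y m) is left h then projT1 (cid h) else i.
  have hy' m : (m <= n)%N -> y m = c (y' m).
    by move=> mn; rewrite /y'; case: pselect => [h|/(_ (ran _ mn))//]; case: cid.
  transitivity (P [set w | [/\ (J n w < +oo)%E,
                 forall m, (m <= n)%N -> Y m w = y' m &
                 forall m, (m <= n)%N -> (J m w + (t m)%:E < J m.+1 w)%E]]).
    apply: ae_measure_eq; last 1 first.
    + apply: ae_imply ctmc_finite_jump_times => w fin; split.
      * move=> h; split => // m mn; have [h1 h2] := h _ mn.
          by apply: cI; rewrite -hy'.
        rewrite holdingE// in h2.
        by rewrite (Jfine (fin m.+1)) (Jfine (fin m)) -EFinD lte_fin -ltrBrDl.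
      * move=> [_ h1 h2] m mn; split; first by rewrite hy'// h1.
        rewrite holdingE//; move: (h2 _ mn).
        by rewrite (Jfine (fin m.+1)) (Jfine (fin m)) -EFinD lte_fin -ltrBrDl.
    + apply: measurable_forall_le => m; apply: measurableI; first exact: mc.
      exact: measurable_gt.
    + exact: measurable_ctmc_event.
  rewrite ctmc_law//; congr (_ * _)%:E.
    rewrite /path_prob hy'// (inj_eq cI); congr (_ * _).
    by apply: eq_bigr => m _; rewrite !hy' ?hPi// ltnW.
  by apply: eq_bigr => m _; rewrite (hy' m (ltn_ord m)) hq mulNr opprK.
- rewrite [X in P X](_ : _ = set0) ?measure0; last first.
    apply/seteqP; split=> // w h; apply: nran => m /h [<- _].
    by exists (Y m w).
  rewrite /path_prob; suff -> : (y 0%N == c i)%:R * \prod_(m < n) Pi (y m) (y m.+1) = 0.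
    by rewrite mul0r.
  have [m mn hm] : exists2 m, (m <= n)%N & forall e, c e <> y m.
    by move: nran => /existsNP [m /not_implyP [mn /forallNP h]]; exists m.
  case: m mn hm => [|m] mn hm; first by case: eqP => [/esym/hm//|_]; rewrite mul0r.
  by rewrite (bigD1 (Ordinal mn)) //= hPi0// mul0r mulr0.
Qed.

End FromPath.
End JumpHold.

(** * Expectations along taboo paths *)

Section TabooOperator.
Context {R : realType}.
Implicit Types (Pi : nat -> nat -> R) (W : pred nat) (f : nat -> \bar R).

(** The transition operator of the jump chain killed outside W. *)
Definition taboo_op Pi W f (i : nat) : \bar R :=
  (\sum_(k <oo | W k) (Pi i k)%:E * f k)%E.

Lemma nneseries_single f (i : nat) : (0 <= f i)%E ->
  (forall k, k != i -> f k = 0%E) -> (\sum_(k <oo) f k = f i)%E.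
Proof.
move=> fi0 h; rewrite (@nneseriesD1 _ _ i xpredT)//; last first.
  by move=> k _; have [->//|/h ->] := eqVneq k i.
by rewrite eseries0 ?adde0// => k _ /= /h.
Qed.

Variables (Pi : nat -> nat -> R) (W : pred nat).
Hypothesis Pi0 : forall a b, 0 <= Pi a b.
Local Notation A := (taboo_op Pi W).

Lemma taboo_op_ge0 f : (forall k, 0 <= f k)%E -> forall k, (0 <= A f k)%E.
Proof.
move=> f0 k; apply: nneseries_ge0 => l _ _.
by rewrite mule_ge0// lee_fin.
Qed.

Lemma iter_taboo_op_ge0 n f : (forall k, 0 <= f k)%E ->
  forall k, (0 <= iter n A f k)%E.
Proof. by move=> f0; elim: n => //= n IH; exact: taboo_op_ge0. Qed.

Lemma le_taboo_op f g : (forall k, 0 <= f k)%E ->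
  (forall k, f k <= g k)%E -> forall k, (A f k <= A g k)%E.
Proof.
move=> f0 fg k; apply: lee_nneseries => [l _ _|l _].
  by rewrite mule_ge0// lee_fin.
by rewrite lee_wpmul2l// lee_fin.
Qed.

Lemma le_iter_taboo_op n f g : (forall k, 0 <= f k)%E ->
  (forall k, f k <= g k)%E -> forall k, (iter n A f k <= iter n A g k)%E.
Proof.
move=> f0 fg; elim: n => //= n IH; apply: le_taboo_op => //.
exact: iter_taboo_op_ge0.
Qed.

Lemma taboo_opD f g : (forall k, 0 <= f k)%E -> (forall k, 0 <= g k)%E ->
  forall k, (A (f \+ g)%E k = A f k + A g k)%E.
Proof.
move=> f0 g0 k; rewrite /taboo_op -nneseriesD; first last.
- by move=> l _ _; rewrite mule_ge0// lee_fin.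
- by move=> l _ _; rewrite mule_ge0// lee_fin.
by apply: eq_eseriesr => l _ /=; rewrite ge0_muleDr.
Qed.

Lemma taboo_opZ (r : R) f : (forall k, 0 <= f k)%E -> 0 <= r ->
  forall k, (A (fun l => r%:E * f l) k = r%:E * A f k)%E.
Proof.
move=> f0 r0 k; rewrite /taboo_op -nneseriesZl//.
  by apply: eq_eseriesr => l _; rewrite muleCA.
by move=> l _; rewrite mule_ge0// lee_fin.
Qed.

End TabooOperator.

Lemma eq_taboo_op {R : realType} (Pi : nat -> nat -> R) W f g :
  f =1 g -> taboo_op Pi W f =1 taboo_op Pi W g.
Proof. by move=> fg k; apply: eq_eseriesr => l _; rewrite fg. Qed.

Section PathIntegral.
Context {R : realType} {d : measure_display} {Omega : measurableType d}.
Variables (P : probability Omega R) (Y : nat -> Omega -> nat).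
Variables (Pi : nat -> nat -> R) (W : pred nat) (i m : nat).
Variables (Z : Omega -> \bar R) (c : nat -> \bar R).
Hypothesis mY : forall m, discrete_measurable (Y m).
Hypothesis Pi0 : forall a b, 0 <= Pi a b.
Hypothesis mZ : measurable_fun setT Z.
Hypothesis Z0 : forall w, (0 <= Z w)%E.
Hypothesis c0 : forall k, (0 <= c k)%E.
Hypothesis hZ : forall y : nat -> nat,
  (\int[P]_(w in [set w | forall l, (l <= m)%N -> Y l w = y l]) Z w =
   (path_prob Pi i y m)%:E * c (y m))%E.

Let path_ge0 y n : 0 <= path_prob Pi i y n.
Proof. by rewrite mulr_ge0// prodr_ge0. Qed.

Let ev r (y : nat -> nat) : set Omega :=
  [set w | (forall l, (l <= r)%N -> Y l w = y l) /\
           (forall l, (r < l <= m)%N -> W (Y l w))].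

Let mev r y : measurable (ev r y).
Proof.
rewrite [X in measurable X](_ : _ =
  [set w | forall l, (l <= r)%N -> [set w | Y l w = y l] w] `&`
  [set w | forall l, (l <= m)%N -> [set w | (r < l)%N -> W (Y l w)] w]).
  apply: measurableI; apply: measurable_forall_le => l; first exact: mY.
  exact: (discrete_measurable_pred (fun k => (r < l)%N -> W k)).
apply/seteqP; split=> w /= [h1 h2]; split => // l.
  by move=> h3 h4; apply: h2; rewrite h4.
by case/andP => h3 h4; exact: h2.
Qed.

(** Summing out one coordinate of the path at a time, from the last to the
    first, applies the operator once for each coordinate. *)
Let integral_ev k r y : (r + k = m)%N ->
  (\int[P]_(w in ev r y) Z w =
   (path_prob Pi i y r)%:E * iter k (taboo_op Pi W) c (y r))%E.
Proof.
elim: k r y => [|k IH] r y rkm.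
  rewrite addn0 in rkm; rewrite rkm /= -hZ; congr integral.
  apply/seteqP; split=> w; [by case|move=> h; split => // l].
  by move=> /andP[/leq_trans h1 /h1]; rewrite ltnn.
pose upd s l := if l == r.+1 then s else y l.
pose F s := if W s then ev r.+1 (upd s) else set0.
have updr s : upd s r = y r by rewrite /upd ltn_eqF.
have updr1 s : upd s r.+1 = s by rewrite /upd eqxx.
have updl s l : (l <= r)%N -> upd s l = y l by move=> lr; rewrite /upd ltn_eqF.
have -> : ev r y = \bigcup_s F s.
  apply/seteqP; split => [w [h1 h2]|w [s _]].
  - exists (Y r.+1 w) => //; rewrite /F.
    have -> : W (Y r.+1 w) by apply: h2; rewrite ltnSn -rkm addnS ltnS leq_addr.
    split => [l|l /andP[rl lm]]; last by apply: h2; rewrite lm (ltn_trans _ rl).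
    rewrite leq_eqVlt => /predU1P[->|]; first by rewrite updr1.
    by rewrite ltnS => lr; rewrite updl// h1.
  - rewrite /F; case: ifP => // Ws [h1 h2]; split => [l lr|l /andP[rl lm]].
      by rewrite h1 ?updl// ltnW.
    move: rl; rewrite leq_eqVlt => /predU1P[<-|rl]; last by apply: h2; rewrite rl.
    by rewrite h1// updr1.
rewrite ge0_integral_bigcup//; first last.
- apply/trivIsetP => a b _ _ ab; apply/seteqP; split => // w [].
  rewrite /F; case: ifP => // _; case: ifP => // _ [h1 _] [h2 _].
  by move: ab; rewrite -(updr1 a) -(updr1 b) -h1// -h2// eqxx.
- exact: measurable_funTS.
- by move=> s; rewrite /F; case: ifP => _; [exact: mev|exact: measurable0].
rewrite iterS /taboo_op -nneseriesZl; last first.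
  by move=> s _; rewrite mule_ge0// ?lee_fin// iter_taboo_op_ge0.
rewrite [RHS]eseries_mkcond; apply: eq_eseriesr => s _; rewrite /F.
case: ifP => Ws; last by rewrite integral_set0.
rewrite IH ?addSnnS// updr1 muleA -EFinM; congr (_%:E * _)%E.
rewrite /path_prob big_ord_recr /= updr updr1 -mulrA; congr (_ * (_ * _)).
by apply: eq_bigr => l _; rewrite !updl// ltnW.
Qed.

(** The weight Z is arbitrary: the indicator of the whole space gives the taboo
    probabilities, a sojourn time gives its contribution to an expected integral,
    and an event independent of the states is averaged over all histories. *)
Lemma integral_taboo_path :
  (\int[P]_(w in [set w | forall l, (0 < l <= m)%N -> W (Y l w)]) Z w =
   iter m (taboo_op Pi W) c i)%E.
Proof.
have -> : [set w | forall l, (0 < l <= m)%N -> W (Y l w)] =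
    \bigcup_s ev 0 (fun=> s).
  apply/seteqP; split=> [w h|w [s _ []//]].
  by exists (Y 0%N w) => //; split => // l; rewrite leqn0 => /eqP ->.
rewrite ge0_integral_bigcup//; first last.
- apply/trivIsetP => a b _ _ ab; apply/seteqP; split => // w [[h1 _] [h2 _]].
  by move: ab; rewrite -(h1 0%N)// -(h2 0%N)// eqxx.
- exact: measurable_funTS.
rewrite (nneseries_single (i := i)).
- by rewrite (integral_ev _ (add0n m)) /path_prob eqxx big_ord0 mulr1 mul1e.
- exact: integral_ge0.
- move=> s si; rewrite (integral_ev _ (add0n m)) /path_prob.
  by rewrite (negbTE si) mul0r mul0e.
Qed.

End PathIntegral.

Section ExponentialMean.
Context {R : realType} {d : measure_display} {Omega : measurableType d}.
Variable P : probability Omega R.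

Lemma integral_expR_tail (p q : R) : 0 <= p -> 0 < q ->
  (\int[lebesgue_measure]_(r in `[0%R, +oo[) (p * expR (- (q * r)))%:E = (p / q)%:E)%E.
Proof.
move=> p0 q0; rewrite -[RHS]mule1 -(integral_exponential_pdf q0).
rewrite -ge0_integralZl//; first last.
- by rewrite lee_fin divr_ge0// ltW.
- by move=> x _; rewrite lee_fin exponential_pdf_ge0// ltW.
- by apply/measurable_EFinP; apply: measurable_exponential_pdf.
rewrite [LHS]integral_mkcond; apply: eq_integral => x _.
rewrite /exponential_pdf !patchE; case: ifP => _; last by rewrite mule0.
by rewrite -EFinM mulrA divfK ?gt_eqF// mulNr.
Qed.

(** The mean of a nonnegative variable is the integral of its tail. *)
Lemma integral_exponential_on (B : set Omega) (S : Omega -> R) (p q : R) :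
  measurable B -> measurable_fun setT S -> (forall w, 0 <= S w) ->
  0 <= p -> 0 < q ->
  (forall t, 0 <= t -> P (B `&` [set w | t < S w]) = (p * expR (- (q * t)))%:E) ->
  (\int[P]_(w in B) (S w)%:E = (p / q)%:E)%E.
Proof.
move=> mB mS S0 p0 q0 tail.
pose X0 w := S w * \1_B w.
have mX0 : measurable_fun setT X0 by apply: measurable_funM.
pose X : {RV P >-> R} := HB.pack X0 (isMeasurableFun.Build _ _ _ _ X0 mX0).
have X0_ge0 w : 0 <= X w by rewrite mulr_ge0.
have := ge0_expectation_ccdf X0_ge0; rewrite expectation.unlock => EX.
transitivity (\int[P]_w (X w)%:E)%E.
  rewrite [LHS]integral_mkcond; apply: eq_integral => w _.
  by rewrite patchE /X /= /X0 indicE; case: ifP => _; rewrite ?mulr1 ?mulr0.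
rewrite EX -integral_expR_tail//; apply: eq_integral => t.
rewrite inE /= in_itv /= andbT => t0.
rewrite /ccdf /distribution /pushforward -tail//; congr (P _).
apply/seteqP; split=> w /=; rewrite in_itv /= andbT /X0 indicE.
  have [/set_mem Bw|_] := boolP (w \in B); first by rewrite mulr1.
  by rewrite mulr0 ltNge t0.
by move=> [Bw tS]; rewrite mem_set// mulr1.
Qed.

End ExponentialMean.

(** * Expected integrals up to the return time *)

Section ExpectedIntegrals.
Context {R : realType}.

Definition taboo_potential (Pi : nat -> nat -> R) (W : pred nat)
    (f : nat -> \bar R) (i : nat) : \bar R :=
  (\sum_(m <oo) iter m (taboo_op Pi W) f i)%E.

Context {d : measure_display} {Omega : measurableType d}.

Lemma discrete_measurable_fun d' (T : measurableType d') (E : countType)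
    (f : Omega -> E) (h : E -> T) :
  discrete_measurable f -> measurable_fun setT (fun w => h (f w)).
Proof.
move=> mf _ B mB; rewrite setTI.
exact: (discrete_measurable_pred (fun e => B (h e))).
Qed.

Section Law.
Variables (P : probability Omega R) (q : nat -> R) (Pi : nat -> nat -> R).
Variables (i : nat) (Y : nat -> Omega -> nat) (S : nat -> Omega -> R).
Hypothesis law : jump_hold P q Pi i Y S.
Hypothesis q0 : forall k, 0 < q k.
Hypothesis Pi0 : forall a b, 0 <= Pi a b.
Variable W : pred nat.

Let path_ge0 y n : 0 <= path_prob Pi i y n.
Proof. by rewrite mulr_ge0// prodr_ge0. Qed.

Let mpath m (y : nat -> nat) :
  measurable [set w | forall l, (l <= m)%N -> Y l w = y l].
Proof. by apply: measurable_forall_le => l; exact: (jh_state law). Qed.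

Lemma path_hold_prob m (y : nat -> nat) (t : R) : 0 <= t ->
  P ([set w | forall l, (l <= m)%N -> Y l w = y l] `&` [set w | t < S m w]) =
  (path_prob Pi i y m * expR (- (q (y m) * t)))%:E.
Proof.
move=> t0; pose t' l : R := if l == m then t else 0.
have t'0 l : 0 <= t' l by rewrite /t'; case: ifP.
have t'm : t' m = t by rewrite /t' eqxx.
have := jh_law law m y t'0; rewrite big_ord_recr /= t'm big1 ?mul1r.
  move=> <-; apply: ae_measure_eq.
  - by apply: measurableI => //; apply: measurable_gt; exact: (jh_hold law).
  - apply: measurable_forall_le => l; apply: measurableI.
      exact: (jh_state law).
    by apply: measurable_gt; exact: (jh_hold law).
  - apply: ae_imply (jh_pos law) => w Spos; split.
      move=> [h1 /= h2] l lm; split; first exact: h1.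
      by rewrite /t'; case: eqP => [->|_].
    move=> h; split => [l /h []//|/=]; have [_] := h m (leqnn m).
    by rewrite t'm.
by move=> l _; rewrite /t' ltn_eqF// mulr0 oppr0 expR0.
Qed.

Lemma path_probE m (y : nat -> nat) :
  P [set w | forall l, (l <= m)%N -> Y l w = y l] = (path_prob Pi i y m)%:E.
Proof.
rewrite -[RHS]/((path_prob Pi i y m)%:E) -[path_prob Pi i y m]mulr1 -expR0 -oppr0.
rewrite -[in RHS](mulr0 (q (y m))) -path_hold_prob//.
apply: ae_measure_eq => //.
  by apply: measurableI => //; apply: measurable_gt; exact: (jh_hold law).
by apply: ae_imply (jh_pos law) => w Spos; split => [h|[]//]; split => //=.
Qed.

Lemma expected_taboo_hold (h : nat -> R) m : (forall k, 0 <= h k) ->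
  (\int[P]_(w in [set w | forall l, (0 < l <= m)%N -> W (Y l w)])
     (h (Y m w) * S m w)%:E =
   iter m (taboo_op Pi W) (fun k => (h k / q k)%:E) i)%E.
Proof.
move=> h0; apply: integral_taboo_path => //.
- exact: (jh_state law).
- apply/measurable_EFinP; apply: measurable_funM; last exact: (jh_hold law).
  by apply: (discrete_measurable_fun h); exact: (jh_state law).
- by move=> w; rewrite lee_fin mulr_ge0//; exact: (jh_ge0 law).
- by move=> k; rewrite lee_fin divr_ge0// ltW.
- move=> y.
  rewrite (eq_integral (fun w => (h (y m))%:E * (S m w)%:E)%E); last first.
    by move=> w; rewrite inE /= => hw; rewrite hw// EFinM.
  rewrite ge0_integralZl//; first last.
  + by rewrite lee_fin.
  + by move=> w _; rewrite lee_fin; exact: (jh_ge0 law).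
  + by apply/measurable_EFinP; apply: measurable_funTS; exact: (jh_hold law).
  rewrite (@integral_exponential_on _ _ _ _ _ _ (path_prob Pi i y m) (q (y m)))//.
  + by rewrite -!EFinM mulrCA.
  + exact: (jh_hold law).
  + exact: (jh_ge0 law).
  + by move=> t t0; exact: path_hold_prob.
Qed.

Lemma taboo_prob m :
  P [set w | forall l, (0 < l <= m)%N -> W (Y l w)] =
  iter m (taboo_op Pi W) (fun=> 1%E) i.
Proof.
rewrite -(@integral_taboo_path _ _ _ P Y Pi W i m (fun=> 1%E) (fun=> 1%E))//.
- rewrite integral_cst ?mul1e//.
  rewrite [X in measurable X](_ : _ =
    [set w | forall l, (l <= m)%N -> [set w | (0 < l)%N -> W (Y l w)] w]).
    apply: measurable_forall_le => l.
    by apply: (discrete_measurable_pred (fun k => (0 < l)%N -> W k)); exact: (jh_state law).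
  by apply/seteqP; split=> w /= h l; [move=> h1 h2; apply: h; rewrite h2|case/andP => h1 h2; apply: h].
- exact: (jh_state law).
- by move=> y; rewrite integral_cst// mul1e mule1; exact: path_probE.
Qed.

End Law.

Section Xi.
Context {E : countType}.
Variables (Q : E -> E -> R) (P : probability Omega R) (i j : E).
Variable Phi : R -> Omega -> E.
Hypothesis hPhi : is_ctmc Q P i Phi.
Hypothesis Qneg : forall a, Q a a < 0.
Variables (c : E -> nat) (q : nat -> R) (Pi : nat -> nat -> R).
Hypothesis c_inj : injective c.
Hypothesis qE : forall a, q (c a) = - Q a a.
Hypothesis PiE : forall a b, Pi (c a) (c b) = jump_prob Q a b.
Hypothesis Pi_out : forall a b, (forall e, c e <> b) -> Pi a b = 0.
Hypothesis q0 : forall k, 0 < q k.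
Hypothesis Pi0 : forall a b, 0 <= Pi a b.

Let J n w := jump_time (Phi ^~ w) n.
Let Y n w := Phi (fine (J n w)) w.
Let law := ctmc_jump_hold hPhi Qneg c_inj qE PiE Pi_out.

(** A measurable version of xi j h: the two agree on step paths, hence almost
    surely. *)
Let X (h : E -> R) w : \bar R := (\sum_(m <oo)
  if avoids (fun l => Y l w) j m then (h (Y m w) * holding Phi m w)%:E else 0)%E.

Let mterm (h : E -> R) m : measurable_fun setT (fun w =>
  (if avoids (fun l => Y l w) j m then (h (Y m w) * holding Phi m w)%:E else 0)%E).
Proof.
apply: measurable_fun_ifT => //=.
- rewrite /avoids; elim: (iota 0 m) => [|l s IH] /=; first exact: measurable_cst.
  apply: measurable_and => //.
  apply: (discrete_measurable_fun (fun e => e != j)).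
  exact: (ctmc_measurable_embedded hPhi).
- apply/measurable_EFinP; apply: measurable_funM; last exact: (jh_hold law).
  by apply: (discrete_measurable_fun h); exact: (ctmc_measurable_embedded hPhi).
Qed.

Let term_ge0 (h : E -> R) m w : (forall k, 0 <= h k) -> (0 <=
  if avoids (fun l => Y l w) j m then (h (Y m w) * holding Phi m w)%:E else 0)%E.
Proof.
by move=> h0; case: ifP => // _; rewrite lee_fin mulr_ge0//; exact: holding_ge0.
Qed.

Let mX h : (forall k, 0 <= h k) -> measurable_fun setT (X h).
Proof.
move=> h0; apply: ge0_emeasurable_sum => [m w _ _|m _]; first exact: term_ge0.
exact: mterm.
Qed.

Let X_ge0 h w : (forall k, 0 <= h k) -> (0 <= X h w)%E.
Proof. by move=> h0; apply: nneseries_ge0 => m _ _; exact: term_ge0. Qed.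

Let xi_ae h : (forall k, 0 <= h k) -> {ae P, forall w, xi j h (Phi ^~ w) = X h w}.
Proof.
move=> h0; apply: ae_imply (ctmc_step_path hPhi Qneg) => w [fin step].
rewrite (xi_step_path step)//; apply: eq_eseriesr => m _.
by rewrite holdingE.
Qed.

Let integral_X h (hn : nat -> R) : (forall k, 0 <= hn k) ->
  (forall e, hn (c e) = h e) ->
  (\int[P]_w X h w = taboo_potential Pi (predC1 (c j)) (fun k => (hn k / q k)%:E) (c i))%E.
Proof.
move=> hn0 hE; have h0 e : 0 <= h e by rewrite -hE.
rewrite integral_nneseries//; first last.
- by move=> m w _; exact: term_ge0.
apply: eq_eseriesr => m _.
rewrite -(expected_taboo_hold law)// [RHS]integral_mkcond.
apply: eq_integral => w _; rewrite patchE; congr (if _ then _ else _); last by rewrite hE.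
apply/avoidsP/idP => [h'|/set_mem h' l lm].
  by apply/mem_set => l lm; apply/eqP => /c_inj; exact: h'.
by have /eqP h'' := h' l lm; move=> /(congr1 c).
Qed.

(** The Lebesgue integral of a signed function is by definition the difference
    of those of its positive and negative parts, on every path. *)
Lemma expected_xi_signed h (hn : nat -> R) : (forall e, hn (c e) = h e) ->
  (taboo_potential Pi (predC1 (c j)) (fun k => (Num.max (hn k) 0 / q k)%:E) (c i) < +oo)%E ->
  (taboo_potential Pi (predC1 (c j)) (fun k => (Num.max (- hn k) 0 / q k)%:E) (c i) < +oo)%E ->
  expected_xi P Phi j h =
  (taboo_potential Pi (predC1 (c j)) (fun k => (Num.max (hn k) 0 / q k)%:E) (c i) -
   taboo_potential Pi (predC1 (c j)) (fun k => (Num.max (- hn k) 0 / q k)%:E) (c i))%E.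
Proof.
move=> hE finp finn.
pose hp e := Num.max (h e) 0; pose hm e := Num.max (- h e) 0.
have hp0 e : 0 <= hp e by rewrite le_max lexx orbT.
have hm0 e : 0 <= hm e by rewrite le_max lexx orbT.
have hpE e : Num.max (hn (c e)) 0 = hp e by rewrite hE.
have hmE e : Num.max (- hn (c e)) 0 = hm e by rewrite hE.
have maxn0 k : 0 <= Num.max (hn k) 0 by rewrite le_max lexx orbT.
have maxm0 k : 0 <= Num.max (- hn k) 0 by rewrite le_max lexx orbT.
rewrite -(integral_X maxn0 hpE) -(integral_X maxm0 hmE) in finp finn *.
have xiE x : xi j h x = (xi j hp x - xi j hm x)%E.
  rewrite /xi integralE; congr (_ - _)%E; apply: eq_integral => t _.
    by rewrite funeposE EFin_max.
  by rewrite funenegE EFin_max.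
transitivity (\int[P]_w (X hp w - X hm w))%E.
  apply: ae_integral_eq; first by apply: emeasurable_funB; exact: mX.
  apply: ae_imply (ae_and (xi_ae hp0) (xi_ae hm0)) => w [e1 e2].
  by rewrite xiE e1 e2.
apply: integralB => //.
- apply/integrableP; split; first exact: mX.
  by under eq_integral do rewrite gee0_abs ?X_ge0//.
- apply/integrableP; split; first exact: mX.
  by under eq_integral do rewrite gee0_abs ?X_ge0//.
Qed.

Let return_time_ge0 w : (0 <= return_time j (Phi ^~ w))%E.
Proof.
apply: le_ereal_inf_tmp => _ [t [ht _] <-]; apply: le_trans ht.
exact: jump_time_ge0.
Qed.

Let return_time_ae : {ae P, forall w, return_time j (Phi ^~ w) = X (fun=> 1) w}.
Proof.
apply: ae_imply (ae_and (xi_ae (fun=> ler01)) (ctmc_step_path hPhi Qneg)) => w.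
move=> [<- [fin step]]; rewrite /xi.
rewrite integral_cst; last first.
  rewrite (_ : [set t | _] = [set t | (0 <= t%:E < return_time j (Phi ^~ w))%E]).
    exact: measurable_step_set.
  by apply/seteqP; split => t /=; rewrite lee_fin; [move=> [-> ->]|move=> /andP[-> ->]].
rewrite mul1e; have := return_time_ge0 w; rewrite le_eqVlt => /predU1P[rt|].
  rewrite -rt (_ : [set t | _] = set0) ?measure0//.
  by apply/seteqP; split => // t /= []; rewrite lte_fin leNgt => /negP.
move=> rt.
rewrite (_ : [set t | _] = [set t | (0 <= t%:E < return_time j (Phi ^~ w))%E]).
  by rewrite -[LHS]sube0; apply: esym; exact: lebesgue_step_set.
by apply/seteqP; split => t /=; rewrite lee_fin; [move=> [-> ->]|move=> /andP[-> ->]].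
Qed.

Lemma expected_return_time :
  (\int[P]_w return_time j (Phi ^~ w) =
   taboo_potential Pi (predC1 (c j)) (fun k => (1 / q k)%:E) (c i))%E.
Proof.
rewrite -(@integral_X (fun=> 1) (fun=> 1))//.
by apply: ae_ge0_integral_eq => // [w|]; [exact: X_ge0|exact: mX].
Qed.

(** A path that never returns to j has an infinite return time, because it does
    not explode; a finite mean return time therefore excludes such paths. *)
Lemma taboo_prob_cvg0 :
  (taboo_potential Pi (predC1 (c j)) (fun k => (1 / q k)%:E) (c i) < +oo)%E ->
  iter n (taboo_op Pi (predC1 (c j))) (fun=> 1%E) (c i) @[n --> \oo] --> 0%E.
Proof.
rewrite -(@integral_X (fun=> 1) (fun=> 1))// => fin.
pose F n := [set w | forall l, (0 < l <= n)%N -> predC1 (c j) (c (Y l w))].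
have mF n : measurable (F n).
  rewrite (_ : F n = [set w | forall l, (l <= n)%N ->
      [set w | (0 < l)%N -> predC1 (c j) (c (Y l w))] w]).
    apply: measurable_forall_le => l.
    apply: (discrete_measurable_pred (fun k => (0 < l)%N -> predC1 (c j) (c k))).
    exact: (ctmc_measurable_embedded hPhi).
  by apply/seteqP; split=> w /= h l; [move=> h1 h2; apply: h; rewrite h2|case/andP => h1 h2; apply: h].
under eq_fun do rewrite -(taboo_prob law)//.
have Fnull : P (\bigcap_n F n) = 0%E.
  apply: measure_negligible; first exact: bigcapT_measurable.
  have intX : P.-integrable setT (X (fun=> 1)).
    apply/integrableP; split; first exact: mX.
    by under eq_integral do rewrite gee0_abs ?X_ge0//.
  have := integrable_ae measurableT intX => aefin.
  suff : {ae P, forall w, ~ (\bigcap_n F n) w}.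
    by apply: negligibleS => w h /(_ h).
  apply: ae_imply (ae_and (ae_and aefin return_time_ae) (ctmc_step_path hPhi Qneg)).
  move=> w [[/(_ I) Xfin rt] [Jfin step]] hF.
  have Jrt m : (J m w < return_time j (Phi ^~ w))%E.
    rewrite /J (jump_time_fine (Jfin m)) (@lt_return_time _ _ _ _ _ step j m).
      apply/avoidsP => l lm; have := hF m Logic.I l lm.
      by move=> /eqP + /(congr1 c).
    rewrite -(jump_time_fine (Jfin m)) lexx /=.
    by case: step => _ hJ _ _ _; apply: (hJ m).2.
  case: step => _ _ _ _ /cvgeyPgt /(_ (fine (X (fun=> 1) w))) [n _ /(_ n (leqnn n)) /=].
  by rewrite fineK// -rt => /lt_trans/(_ (Jrt n)); rewrite ltxx.
rewrite -Fnull; apply: nonincreasing_cvg_mu => //.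
- by rewrite (@le_lt_trans _ _ 1%E) ?probability_le1 ?ltry.
- exact: bigcapT_measurable.
- apply/nonincreasing_seqP => n; apply/subsetPset => w /= h l /andP[l0 ln].
  by apply: h; rewrite l0 ltnW.
Qed.

End Xi.
End ExpectedIntegrals.

(** * Potential theory of the killed jump chain *)

Section Potential.
Context {R : realType}.
Variables (Pi : nat -> nat -> R).
Hypothesis Pi0 : forall a b, 0 <= Pi a b.
Implicit Types (W : pred nat) (f : nat -> \bar R).
Local Notation nonneg f := (forall k, 0 <= f k)%E.
Local Notation A W := (taboo_op Pi W).
Local Notation U W := (taboo_potential Pi W).

Lemma nneseries_le f W (b : \bar R) : (forall k, W k -> 0 <= f k)%E ->
  (forall n, \sum_(0 <= k < n | W k) f k <= b)%E -> (\sum_(k <oo | W k) f k <= b)%E.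
Proof.
move=> f0 fb; apply: lime_le; last exact: nearW.
by apply: is_cvg_nneseries => k _; exact: f0.
Qed.

Lemma nneseries_shift f : nonneg f ->
  (\sum_(m <oo) f m = f 0%N + \sum_(m <oo) f m.+1)%E.
Proof.
move=> f0; rewrite nneseries_recl// -(nneseries_addn 1%N)//.
by congr (_ + _)%E; apply: eq_eseriesr => k _; rewrite addn1.
Qed.

Lemma nneseries_term_cvg0 f : nonneg f -> (\sum_(m <oo) f m < +oo)%E ->
  f m @[m --> \oo] --> 0%E.
Proof.
move=> f0 fin; have := @nneseries_tail_cvg R f xpredT fin (fun k _ => f0 k).
apply: (@squeeze_cvge _ _ _ _ (cst 0%E)); last exact: cvg_cst.
apply: nearW => m; rewrite f0 /=.
have := @nneseries_lim_ge R f xpredT m m.+1 (fun k _ _ => f0 k).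
by rewrite big_nat1.
Qed.

Lemma nneseriesZr (a : nat -> R) (c : \bar R) : (forall i, 0 <= a i) -> (0 <= c)%E ->
  (\sum_(i <oo) ((a i)%:E * c) = (\sum_(i <oo) (a i)%:E) * c)%E.
Proof.
move=> a0; case: c => [r| |//] c0.
  rewrite [RHS]muleC -nneseriesZl; last by move=> i _; rewrite lee_fin.
  by apply: eq_eseriesr => i _; rewrite muleC.
have [az|/existsNP[i /eqP ai]] := pselect (forall i, a i = 0).
  by rewrite !eseries0 ?mul0e// => i _ _; rewrite az ?mul0e.
have ai0 : 0 < a i by rewrite lt_neqAle eq_sym ai a0.
rewrite [LHS](@nneseries_pinfty _ _ _ i)//; first last.
- by rewrite gt0_muley// lte_fin.
- by move=> l _; rewrite mule_ge0 ?lee_fin.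
rewrite gt0_muley//; apply: (@lt_le_trans _ _ (a i)%:E); rewrite ?lte_fin//.
rewrite (@nneseriesD1 _ _ i xpredT)//; last by move=> l _; rewrite lee_fin.
by rewrite leeDl// nneseries_ge0// => l _ _; rewrite lee_fin.
Qed.

Lemma taboo_potential_ge0 W f : nonneg f -> nonneg (U W f).
Proof. by move=> f0 k; apply: nneseries_ge0 => m _ _; exact: iter_taboo_op_ge0. Qed.

Lemma le_taboo_potential W f g : nonneg f -> (forall k, f k <= g k)%E ->
  forall k, (U W f k <= U W g k)%E.
Proof.
move=> f0 fg k; apply: lee_nneseries => m _; first by move=> _; exact: iter_taboo_op_ge0.
exact: le_iter_taboo_op.
Qed.

Lemma eq_taboo_potential W f g : f =1 g -> U W f =1 U W g.
Proof.
move=> fg k; apply: eq_eseriesr => m _; elim: m k => //= m IH k; exact: eq_taboo_op IH k.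
Qed.

Lemma taboo_potentialD W f g : nonneg f -> nonneg g ->
  forall k, (U W (f \+ g)%E k = U W f k + U W g k)%E.
Proof.
move=> f0 g0 k; rewrite /taboo_potential -nneseriesD; first last.
- by move=> m _ _; exact: iter_taboo_op_ge0.
- by move=> m _ _; exact: iter_taboo_op_ge0.
apply: eq_eseriesr => m _ /=; elim: m k => //= m IH k.
rewrite (eq_taboo_op _ _ IH) taboo_opD//; exact: iter_taboo_op_ge0.
Qed.

Lemma taboo_potentialZ W (r : R) f : nonneg f -> 0 <= r ->
  forall k, (U W (fun l => r%:E * f l) k = r%:E * U W f k)%E.
Proof.
move=> f0 r0 k; rewrite /taboo_potential -nneseriesZl; last first.
  by move=> m _; exact: iter_taboo_op_ge0.
apply: eq_eseriesr => m _ /=; elim: m k => //= m IH k.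
rewrite (eq_taboo_op _ _ IH) taboo_opZ//; exact: iter_taboo_op_ge0.
Qed.

Lemma taboo_potentialE W f : nonneg f ->
  forall k, (U W f k = f k + A W (U W f) k)%E.
Proof.
move=> f0 k; rewrite {1}/taboo_potential nneseries_shift; last first.
  by move=> m; exact: iter_taboo_op_ge0.
congr (_ + _)%E; rewrite [RHS]/taboo_op.
under [RHS]eq_eseriesr => l _.
  rewrite -nneseriesZl; last by move=> m _; exact: iter_taboo_op_ge0.
  over.
rewrite nneseries_interchange//.
by move=> a b; rewrite mule_ge0// ?lee_fin// iter_taboo_op_ge0.
Qed.

(** Iterating the inequality from L >= 0 bounds each partial sum of the potential
    by L. *)
Lemma taboo_potential_minimal W f (L : nat -> \bar R) : nonneg f -> nonneg L ->
  (forall k, f k + A W L k <= L k)%E -> forall k, (U W f k <= L k)%E.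
Proof.
move=> f0 L0 super k; apply: nneseries_le => [m _|n].
  exact: iter_taboo_op_ge0.
rewrite big_mkord; elim: n k => [|n IH] k; first by rewrite big_ord0.
apply: le_trans (super k); rewrite big_ord_recl /=; apply: leeD => //.
apply: (@le_trans _ _ (A W (fun l => \sum_(m < n) iter m (A W) f l)%E k)); last first.
  by apply: le_taboo_op => // l; apply: sume_ge0 => m _; exact: iter_taboo_op_ge0.
rewrite le_eqVlt; apply/orP; left; apply/eqP.
elim: n {IH} => [|n IH].
  rewrite big_ord0 /taboo_op eseries0// => l _ _.
  by rewrite big_ord0 mule0.
rewrite big_ord_recr IH /= -taboo_opD//; first last.
- exact: iter_taboo_op_ge0.
- by move=> l; apply: sume_ge0 => m _; exact: iter_taboo_op_ge0.
by apply: eq_taboo_op => l; rewrite big_ord_recr.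
Qed.

Lemma subset_taboo_potential W W' f : nonneg f -> (forall k, W k -> W' k) ->
  forall k, (U W f k <= U W' f k)%E.
Proof.
move=> f0 WW' k; apply: lee_nneseries => m _; first by move=> _; exact: iter_taboo_op_ge0.
elim: m k => //= m IH k.
apply: (@le_trans _ _ (A W (iter m (A W') f) k)).
  by apply: le_taboo_op => //; exact: iter_taboo_op_ge0.
apply: subset_lee_nneseries => // l _.
by rewrite mule_ge0// ?lee_fin// iter_taboo_op_ge0.
Qed.

(** The truncated potentials increase and stay below the potential of W. Their
    limit L satisfies f + A L <= L, so that it is above this potential too. *)
Lemma cvg_taboo_potential W f : nonneg f -> forall i,
  U [pred k | W k && (k <= n)%N] f i @[n --> \oo] --> U W f i.
Proof.
move=> f0; pose V n : nat -> \bar R := U [pred k | W k && (k <= n)%N] f.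
have Vnd i : {homo (V ^~ i) : n m / (n <= m)%N >-> (n <= m)%E}.
  move=> n m nm; apply: subset_taboo_potential => // k /= /andP[-> kn] /=.
  exact: leq_trans kn nm.
have V0 n : nonneg (V n) by exact: taboo_potential_ge0.
pose L i := ereal_sup (range (V ^~ i)).
have VL i : V n i @[n --> \oo] --> L i by exact: ereal_nondecreasing_cvgn.
have V_le_L n i : (V n i <= L i)%E by apply: ereal_sup_ubound; exists n.
have L0 : nonneg L by move=> i; apply: le_trans (V0 0%N i) _.
have LU i : (L i <= U W f i)%E.
  apply: ge_ereal_sup => _ [n _ <-]; apply: subset_taboo_potential => // k /=.
  by case/andP.
suff UL i : (U W f i <= L i)%E.
  move=> i; have -> : U W f i = L i by apply/eqP; rewrite eq_le LU UL.
  exact: VL.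
apply: taboo_potential_minimal => // {}i.
have fA : (0 <= A W L i)%E by exact: taboo_op_ge0.
suff AL K : (f i + \sum_(0 <= k < K | W k) (Pi i k)%:E * L k <= L i)%E.
  have -> : (f i + A W L i = \sum_(k <oo) if k is l.+1 then
      (if W l then (Pi i l)%:E * L l else 0) else f i)%E.
    rewrite nneseries_shift.
      by rewrite /taboo_op eseries_mkcond.
    by move=> [|k] //; case: ifP => // _; rewrite mule_ge0 ?lee_fin.
  apply: nneseries_le => [[|k] _//|[|n]].
  - by case: ifP => // _; rewrite mule_ge0 ?lee_fin.
  - by rewrite big_geq//.
  - rewrite big_nat_recl// (le_trans _ (AL n))// leeD2l//.
    by rewrite [leRHS]big_mkcond.
apply: (@cvge_to_le _ \oo _ _ (fun n => (f i + \sum_(0 <= k < K | W k) (Pi i k)%:E * V n k)%E)).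
  apply: (@cvgeD _ _ _ _ (cst (f i)) (fun n => \sum_(0 <= k < K | W k) (Pi i k)%:E * V n k)%E
    (f i) (\sum_(0 <= k < K | W k) (Pi i k)%:E * L k)%E); [|exact: cvg_cst|].
    rewrite ge0_adde_def// inE//; apply: sume_ge0 => k _.
    by rewrite mule_ge0 ?lee_fin.
  apply: cvg_nnesum => [k _|k _]; first by apply: nearW => n; rewrite mule_ge0 ?lee_fin.
  by apply: cvgeZl.
near=> n.
apply: le_trans (V_le_L n i); rewrite /V taboo_potentialE// leeD2l//.
apply: le_trans (nneseries_lim_ge K _); last first.
  by move=> k _ _; rewrite mule_ge0 ?lee_fin//; exact: taboo_potential_ge0.
rewrite le_eqVlt; apply/orP; left; apply/eqP.
rewrite big_nat_cond [RHS]big_nat_cond; apply: eq_bigl => k /=.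
case: (ltnP k K) => //= kK; case: (W k) => //=; apply/esym.
rewrite (leq_trans (ltnW kK))//; near: n; exact: nbhs_infty_ge.
Unshelve. all: by end_near. Qed.

Section Invariant.
Variables (nu : nat -> R) (j : nat).
Hypothesis nu0 : forall k, 0 <= nu k.
Hypothesis nuPi : forall k, (\sum_(i <oo) (nu i * Pi i k)%:E = (nu k)%:E)%E.
Local Notation W := (predC1 j).

Definition pairing (f : nat -> \bar R) : \bar R := (\sum_(i <oo) (nu i)%:E * f i)%E.

Lemma pairing_ge0 f : nonneg f -> (0 <= pairing f)%E.
Proof. by move=> f0; apply: nneseries_ge0 => i _ _; rewrite mule_ge0 ?lee_fin. Qed.

Lemma pairingD f g : nonneg f -> nonneg g ->
  (pairing (f \+ g)%E = pairing f + pairing g)%E.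
Proof.
move=> f0 g0; rewrite /pairing -nneseriesD; first last.
- by move=> i _ _; rewrite mule_ge0 ?lee_fin.
- by move=> i _ _; rewrite mule_ge0 ?lee_fin.
by apply: eq_eseriesr => i _ /=; rewrite ge0_muleDr.
Qed.

Lemma eq_pairing f g : f =1 g -> pairing f = pairing g.
Proof. by move=> fg; apply: eq_eseriesr => i _; rewrite fg. Qed.

(** By invariance, nu k is the mass that flows into k. This is substituted for
    every k but j, where the operator kills. *)
Lemma pairing_step f : nonneg f ->
  (pairing f = (nu j)%:E * f j + pairing (A W f))%E.
Proof.
move=> f0; rewrite [in LHS]/pairing (@nneseriesD1 _ _ j xpredT)//; last first.
  by move=> i _; rewrite mule_ge0 ?lee_fin.
congr (_ + _)%E; rewrite /pairing /taboo_op.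
under [RHS]eq_eseriesr => i _.
  rewrite -nneseriesZl; last by move=> k _; rewrite mule_ge0 ?lee_fin.
  over.
rewrite nneseries_interchange; last by move=> a b; rewrite !mule_ge0 ?lee_fin.
apply: eq_eseriesr => k _; rewrite -nuPi -nneseriesZr//.
  by apply: eq_eseriesr => i _; rewrite muleA.
by move=> i; rewrite mulr_ge0.
Qed.

Lemma pairing_iter M f : nonneg f ->
  (pairing f = (nu j)%:E * (\sum_(m < M) iter m (A W) f j) + pairing (iter M (A W) f))%E.
Proof.
move=> f0; elim: M => [|M IH]; first by rewrite big_ord0 mule0 add0e.
rewrite IH (pairing_step (iter_taboo_op_ge0 _ _ M f0))// big_ord_recr /=.
rewrite ge0_muleDr ?addeA//; last exact: iter_taboo_op_ge0.
by apply: sume_ge0 => m _; exact: iter_taboo_op_ge0.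
Qed.

(** The remainder in pairing_iter is nonnegative. *)
Lemma pairing_ge_potential f : nonneg f ->
  ((nu j)%:E * U W f j <= pairing f)%E.
Proof.
move=> f0; rewrite /taboo_potential -nneseriesZl; last first.
  by move=> m _; exact: iter_taboo_op_ge0.
apply: nneseries_le => [m _|n].
  by rewrite mule_ge0 ?lee_fin//; exact: iter_taboo_op_ge0.
rewrite big_mkord -ge0_sume_distrr; last by move=> m _; exact: iter_taboo_op_ge0.
by rewrite (pairing_iter n f0) leeDl// pairing_ge0//; exact: iter_taboo_op_ge0.
Qed.

(** For a measure of finite support, the remainder in pairing_iter is a finite sum
    of general terms of convergent series, and vanishes in the limit. *)
Lemma pairing_potential_fin_support n f : nonneg f ->
  (forall k, (n < k)%N -> nu k = 0) ->
  (forall k, (k <= n)%N -> U W f k < +oo)%E ->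
  (pairing f = (nu j)%:E * U W f j)%E.
Proof.
move=> f0 supp fin.
have pairing_sum g : nonneg g -> (pairing g = \sum_(0 <= k < n.+1) (nu k)%:E * g k)%E.
  move=> g0; rewrite /pairing (nneseries_split 0 n.+1)//.
    by rewrite [X in (_ + X)%E]eseries0 ?adde0// => k; rewrite add0n => nk _; rewrite supp ?mul0e.
  by move=> k _; rewrite mule_ge0 ?lee_fin.
have rem : pairing (iter M (A W) f) @[M --> \oo] --> 0%E.
  have lim : (\sum_(k <- index_iota 0 n.+1 | (k <= n)%N) (nu k)%:E * iter M (A W) f k)%E @[M --> \oo]
      --> (\sum_(k <- index_iota 0 n.+1 | (k <= n)%N) (nu k)%:E * 0)%E.
    apply: cvg_nnesum => k kn.
      by apply: nearW => M; rewrite mule_ge0 ?lee_fin//; exact: iter_taboo_op_ge0.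
    apply: cvgeZl => //; apply: nneseries_term_cvg0; last exact: fin.
    by move=> m; exact: iter_taboo_op_ge0.
  rewrite big1 in lim; last by move=> k _; rewrite mule0.
  under eq_fun => M.
    rewrite pairing_sum; last exact: iter_taboo_op_ge0.
    rewrite big_nat (eq_bigl (fun k => (k <= n)%N)); last by move=> k; rewrite leq0n ltnS.
    over.
  exact: lim.
have main : ((nu j)%:E * (\sum_(m < M) iter m (A W) f j) + pairing (iter M (A W) f))%E
    @[M --> \oo] --> ((nu j)%:E * U W f j + 0)%E.
  apply: (@cvgeD _ _ _ _ (fun M => (nu j)%:E * (\sum_(m < M) iter m (A W) f j))%E
    (fun M => pairing (iter M (A W) f))) => //.
    by rewrite ge0_adde_def// inE// mule_ge0 ?lee_fin//; exact: taboo_potential_ge0.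
  apply: cvgeZl => //; under eq_fun do rewrite -(big_mkord xpredT (fun m => iter m (A W) f j)).
  by apply: is_cvg_nneseries => m _ _; exact: iter_taboo_op_ge0.
rewrite adde0 in main; move: main.
under eq_fun => M do rewrite -(pairing_iter M f0).
by move=> /(cvg_lim (@ereal_hausdorff R)) <-; rewrite lim_cst.
Qed.

Definition at_state (b : nat) : nat -> \bar R := fun k => ((k == b)%:R)%:E.

Lemma at_state_ge0 b : nonneg (at_state b).
Proof. by move=> k; rewrite lee_fin. Qed.

Lemma pairing_at_state b : pairing (at_state b) = (nu b)%:E.
Proof.
rewrite /pairing (nneseries_single (i := b)); first by rewrite /at_state eqxx mule1.
  by rewrite mule_ge0 ?lee_fin.
by move=> k kb; rewrite /at_state (negbTE kb) mule0.
Qed.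

Lemma taboo_op_at_state b : b != j -> forall k, A W (at_state b) k = (Pi k b)%:E.
Proof.
move=> bj k; rewrite /taboo_op eseries_mkcond (nneseries_single (i := b)).
- by rewrite /= bj /at_state eqxx mule1.
- by case: ifP => // _; rewrite mule_ge0 ?lee_fin.
- by move=> l lb; rewrite /at_state (negbTE lb) mule0; case: ifP.
Qed.

Lemma taboo_potential_at_base : U W (at_state j) j = 1%E.
Proof.
have Az k : A W (at_state j) k = 0%E.
  by rewrite /taboo_op eseries0// => l _ /=; rewrite /at_state => /negbTE ->; rewrite mule0.
rewrite /taboo_potential nneseries_shift; last first.
  by move=> m; apply: iter_taboo_op_ge0 => //; exact: at_state_ge0.
rewrite /= /at_state eqxx eseries0 ?adde0// => m _ _.
suff H k : iter m.+1 (A W) (at_state j) k = 0%E by exact: H.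
elim: m k => [|m IH] k; first exact: Az.
by rewrite iterS /taboo_op eseries0// => l _ _; rewrite IH mule0.
Qed.

Section Recurrent.
Hypothesis recurrent : (U W (fun k => (Pi k j)%:E) j = 1)%E.

(** For b other than j the column b of Pi is A 1_b, and the potentials differ by
    their first term, which is 0; for b = j both sides are 1, the left one by
    recurrence. *)
Let potential_column b : U W (fun k => (Pi k b)%:E) j = U W (at_state b) j.
Proof.
have [->|bj] := eqVneq b j; first by rewrite recurrent taboo_potential_at_base.
rewrite [RHS]/taboo_potential nneseries_shift; last first.
  by move=> m; apply: iter_taboo_op_ge0 => //; exact: at_state_ge0.
rewrite /= {1}/at_state eq_sym (negbTE bj) add0e.
apply: eq_eseriesr => m _; rewrite -iterS iterSr.
suff H k : iter m (A W) (fun k => (Pi k b)%:E) k = iter m (A W) (A W (at_state b)) k by exact: H.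
by elim: m k => [|m IH] k /=; [rewrite taboo_op_at_state|exact: eq_taboo_op IH k].
Qed.

(** The inequality nu b >= nu j * U 1_b j propagates equality from b to every a
    with Pi a b > 0: both sides satisfy the same balance equation at b. *)
Let propagate a b : 0 < Pi a b -> ((nu j)%:E * U W (at_state b) j = (nu b)%:E)%E ->
  ((nu j)%:E * U W (at_state a) j = (nu a)%:E)%E.
Proof.
move=> Pab eqb.
pose f1 k := ((Pi a b)%:E * at_state a k)%E.
pose f2 k := (if k == a then 0 else (Pi k b)%:E)%E.
have f1_ge0 : nonneg f1 by move=> k; rewrite mule_ge0 ?lee_fin.
have f2_ge0 : nonneg f2 by move=> k; rewrite /f2; case: ifP; rewrite ?lee_fin.
have split12 : (fun k => (Pi k b)%:E) =1 (f1 \+ f2)%E.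
  move=> k; rewrite /= /f1 /f2 /at_state; case: eqP => [->|_].
    by rewrite mule1 adde0.
  by rewrite mule0 add0e.
have := potential_column b; rewrite (eq_taboo_potential _ split12) taboo_potentialD//.
rewrite taboo_potentialZ//; last exact: at_state_ge0.
move=> Ueq.
have pf1 : pairing f1 = ((Pi a b)%:E * (nu a)%:E)%E.
  rewrite -pairing_at_state /pairing -nneseriesZl; last first.
    by move=> k _; rewrite mule_ge0 ?lee_fin.
  by apply: eq_eseriesr => k _; rewrite muleCA.
have psum : ((nu b)%:E = pairing f1 + pairing f2)%E.
  rewrite -pairingD// -(eq_pairing split12) -nuPi.
  by apply: eq_eseriesr => i _; rewrite EFinM.
have ge1 := pairing_ge_potential (at_state_ge0 a).
have ge2 := pairing_ge_potential f2_ge0.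
rewrite pairing_at_state in ge1.
move: psum; rewrite -eqb -Ueq pf1 ge0_muleDr ?mule_ge0 ?lee_fin//; first last.
- exact: taboo_potential_ge0.
- exact: (taboo_potential_ge0 _ (at_state_ge0 a)).
rewrite muleCA.
have nn1 : (0 <= (nu j)%:E * U W (at_state a) j)%E.
  by rewrite mule_ge0 ?lee_fin//; exact: (taboo_potential_ge0 _ (at_state_ge0 a)).
have nn2 : (0 <= (nu j)%:E * U W f2 j)%E.
  by rewrite mule_ge0 ?lee_fin//; exact: taboo_potential_ge0.
have pf2 : pairing f2 \is a fin_num.
  rewrite ge0_fin_numE ?pairing_ge0//; apply: (@le_lt_trans _ _ (nu b)%:E); rewrite ?ltry//.
  rewrite -pairing_at_state (_ : pairing (at_state b) = pairing f1 + pairing f2)%E.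
    by rewrite leeDr ?pairing_ge0.
  rewrite pairing_at_state -pairingD// -(eq_pairing split12) -nuPi.
  by apply: eq_eseriesr => i _; rewrite EFinM.
move: ge2 nn2 ge1 nn1; rewrite -(fineK pf2).
case: (_ * U W f2 j)%E => [x| |]//.
case: (_ * U W (at_state a) j)%E => [y| |]//.
rewrite -!EFinM -!EFinD !lee_fin => xz _ yn _ [] e; congr (_%:E).
apply/eqP; rewrite eq_le yn /= -(ler_pM2l Pab).
by rewrite -(lerD2r (fine (pairing f2))) -e lerD2l.
Qed.

Hypothesis reach : forall a, exists m (y : nat -> nat),
  [/\ y 0%N = a, y m = j & forall l, (l < m)%N -> 0 < Pi (y l) (y l.+1)].

(** The equality holds at j, and propagates backwards along a path from a to j. *)
Lemma invariant_at_state a : ((nu j)%:E * U W (at_state a) j = (nu a)%:E)%E.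
Proof.
have [m [y [<- ym pos]]] := reach a.
suff H l : (l <= m)%N -> ((nu j)%:E * U W (at_state (y (m - l)%N)) j = (nu (y (m - l)%N))%:E)%E.
  by have := H m (leqnn m); rewrite subnn.
elim: l => [_|l IH lm].
  by rewrite subn0 ym taboo_potential_at_base mule1.
apply: propagate (IH (ltnW lm)); rewrite -[in X in _ < X](subnSK lm).
by apply: pos; rewrite subnSK// leq_subr.
Qed.

(** The average of h under nu is, up to the factor nu j, its sum over an excursion
    from j. The inequality that is left is approached by the functions of finite
    support, which are combinations of indicators. *)
Lemma pairing_potential (h : nat -> R) : (forall k, 0 <= h k) ->
  (pairing (fun k => (h k)%:E) = (nu j)%:E * U W (fun k => (h k)%:E) j)%E.
Proof.
move=> h0; apply/eqP; rewrite eq_le pairing_ge_potential ?andbT//.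
apply: nneseries_le => [k _|n]; first by rewrite mule_ge0 ?lee_fin.
pose hn n (k : nat) : \bar R := (if (k < n)%N then h k else 0)%:E.
have hn0 m : nonneg (hn m) by move=> k; rewrite lee_fin; case: ifP.
apply: (@le_trans _ _ ((nu j)%:E * U W (hn n) j)%E); last first.
  rewrite lee_wpmul2l ?lee_fin//; apply: le_taboo_potential => // k.
  by rewrite lee_fin; case: ifP.
elim: n => [|n IH]; first by rewrite big_geq// mule_ge0 ?lee_fin//; exact: taboo_potential_ge0.
rewrite big_nat_recr//=.
have hnS : hn n.+1 =1 (hn n \+ (fun k => (h n)%:E * at_state n k))%E.
  move=> k; rewrite /= /hn /at_state ltnS -EFinM -EFinD; congr (_%:E).
  by case: (ltngtP k n) => [||->]; rewrite ?mulr0 ?mulr1 ?addr0 ?add0r.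
have at0 := at_state_ge0 n.
rewrite (eq_taboo_potential _ hnS) taboo_potentialD//; last first.
  by move=> k; rewrite mule_ge0 ?lee_fin.
rewrite taboo_potentialZ// ge0_muleDr; first last.
- by rewrite mule_ge0 ?lee_fin//; exact: taboo_potential_ge0.
- exact: taboo_potential_ge0.
by rewrite leeD// [leRHS]muleCA invariant_at_state muleC.
Qed.

End Recurrent.
End Invariant.
End Potential.

(** * Consequences of irreducibility and recurrence *)

Section Reach.
Context {R : realType} {d : measure_display} {Omega : measurableType d}.
Context {E : countType}.
Variables (Q : E -> E -> R) (P : probability Omega R) (i : E).
Variable Phi : R -> Omega -> E.
Hypothesis hPhi : is_ctmc Q P i Phi.

(** A state charged at some time is reached by the jump chain along a path of
    positive probability, because there are countably many finite paths. *)
Lemma ctmc_reach (b : E) (t : R) : 0 <= t -> (0 < P [set w | Phi t w = b])%E ->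
  exists m (y : nat -> E), [/\ y 0%N = i, y m = b &
    forall l, (l < m)%N -> jump_prob Q (y l) (y l.+1) != 0].
Proof.
move=> t0 Pb; apply: contrapT => no.
have [mPhi rc _ exp] := hPhi.
pose J n w := jump_time (Phi ^~ w) n.
pose Y n w := Phi (fine (J n w)) w.
pose F (s : seq E) := [set w | [/\ (J (size s).-1 w < +oo)%E,
   forall m, (m <= (size s).-1)%N -> Y m w = nth i s m &
   forall m, (m <= (size s).-1)%N -> (J m w + ((fun=> 0) m)%:E < J m.+1 w)%E]].
have nullF s : nth i s (size s).-1 = b -> P.-negligible (F s).
  move=> sb; have mF : measurable (F s) by exact: (measurable_ctmc_event hPhi).
  exists (F s); split => //; rewrite (ctmc_law hPhi)//.
  suff -> : (nth i s 0 == i)%:R *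
      \prod_(m < (size s).-1) jump_prob Q (nth i s m) (nth i s m.+1) = 0 by rewrite mul0r.
  apply: contrapT => /eqP; rewrite mulf_eq0 => /norP[s0 sm]; apply: no.
  exists (size s).-1, (nth i s); split => //.
    by move: s0; rewrite pnatr_eq0 eqb0 negbK => /eqP.
  move=> l lm; apply/eqP => l0; move: sm.
  by rewrite (bigD1 (Ordinal lm)) //= l0 mul0r eqxx.
have : P.-negligible [set w | Phi t w = b].
  have aeF : {ae P, forall w, forall s, ~ (nth i s (size s).-1 = b /\ F s w)}.
    apply: ae_count => s; have [sb|nsb] := pselect (nth i s (size s).-1 = b); last first.
      by apply: ae_imply exp => w _ [].
    by apply: (negligibleS _ (nullF s sb)) => w /= /contrapT [].
  suff : {ae P, forall w, Phi t w <> b} by apply: negligibleS => w /= ->; exact.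
  apply: ae_imply (ae_and aeF exp) => w [hF oo] wb.
  have step := jump_time_step_path (rc w) oo.
  have [m /andP[Jm Jm1]] := step_path_locate step t0.
  have Jfin : (J m w < +oo)%E by rewrite (le_lt_trans Jm)// ltry.
  pose s := [seq Y l w | l <- iota 0 m.+1].
  have sz : (size s).-1 = m by rewrite size_map size_iota.
  have snth l : (l <= m)%N -> nth i s l = Y l w.
    by move=> lm; rewrite (nth_map 0%N) ?size_iota// nth_iota// add0n.
  apply: (hF s); rewrite /F /mkset sz; split.
    rewrite snth// -wb; apply/esym.
    by case: step => _ _ h _ _; apply: h; rewrite Jm.
  split => // l lm; first by rewrite snth.
  apply: (ctmc_jump_time_shift hPhi).
  by apply: le_lt_trans Jfin; exact: jump_time_nondecreasing.
move=> /(measure_negligible (mPhi t b t0)) Pb0.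
by move: Pb; rewrite Pb0 ltxx.
Qed.

End Reach.

Section Chain.
Context {R : realType}.

Lemma nneseries_cvg_series (u : nat -> R) (l : R) : series u @ \oo --> l ->
  (\sum_(k <oo) (u k)%:E = l%:E)%E.
Proof.
move=> ul; apply/cvg_lim => //.
rewrite (_ : (fun n => _) = EFin \o series u); first by apply/fine_cvgP; split; [exact: nearW|exact: ul].
by apply/funext => n; rewrite /= /series /= sumEFin.
Qed.

(** For the rows of Q and the columns of p Q, whose terms are nonnegative off the
    diagonal: without the diagonal term they are sums of extended reals. *)
Lemma nneseries_offdiag (u v : nat -> R) (a : nat) (l : R) :
  series u @ \oo --> l -> v a = 0 -> (forall k, k != a -> v k = u k) ->
  (\sum_(k <oo) (v k)%:E = (l - u a)%:E)%E.
Proof.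
move=> ul va vu; apply: nneseries_cvg_series.
have : (series u n - u a) @[n --> \oo] --> l - u a by apply: cvgB => //; exact: cvg_cst.
apply: cvg_trans; apply: near_eq_cvg; near=> n.
have an : (a < n)%N by near: n; exact: nbhs_infty_gt.
rewrite /series /= !big_mkord (bigD1 (Ordinal an))//= [RHS](bigD1 (Ordinal an))//=.
rewrite va add0r addrAC subrr add0r; apply: eq_bigr => k ka.
by rewrite vu// -(inj_eq val_inj).
Unshelve. all: by end_near. Qed.

Variable Q : nat -> nat -> R.
Hypothesis hQ : conservative_qmatrix Q.

Lemma qmatrix_diag_le0 a : Q a a <= 0.
Proof.
have := @nneseries_offdiag (Q a) (fun k => if k == a then 0 else Q a k) a 0 (hQ.2 a).
rewrite eqxx sub0r => /(_ erefl) /(_ (fun k ka => ifN_eq _ _ ka)) e.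
rewrite -oppr_ge0 -lee_fin -e; apply: nneseries_ge0 => k _ _; rewrite lee_fin.
by case: eqP => // ka; apply: hQ.1 => /esym.
Qed.

Lemma jump_prob_ge0 a b : 0 <= jump_prob Q a b.
Proof.
rewrite /jump_prob; case: eqP => // ab; rewrite divr_ge0 ?hQ.1//.
by rewrite oppr_ge0 qmatrix_diag_le0.
Qed.

Lemma jump_prob_neq0_diag a b : jump_prob Q a b != 0 -> Q a a < 0.
Proof.
move=> ab; rewrite lt_neqAle qmatrix_diag_le0 andbT; apply: contraNN ab => /eqP Qa.
by rewrite /jump_prob Qa oppr0 invr0 mulr0; case: ifP.
Qed.

Hypothesis Qneg : forall a, Q a a < 0.

Lemma jump_prob_sum1 a : (\sum_(b <oo) (jump_prob Q a b)%:E = 1)%E.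
Proof.
have Qa : - Q a a != 0 by rewrite oppr_eq0 lt_eqF.
have h : series (fun k => Q a k / - Q a a) @ \oo --> (0 : R).
  rewrite (_ : series _ = (fun n => series (Q a) n * (- Q a a)^-1)).
    by rewrite -[X in _ --> X](mul0r ((- Q a a)^-1)); apply: cvgMl; exact: hQ.2.
  by apply/funext => n; rewrite /series /= mulr_suml.
rewrite (nneseries_offdiag (a := a) h).
- by rewrite sub0r -mulNr divff.
- by rewrite /jump_prob eqxx.
- by move=> k ka; rewrite /jump_prob eq_sym (negbTE ka).
Qed.

(** The jump chain does not see the holding times: the weight p k is replaced by
    the flow p k * q k out of k. *)
Lemma invariant_jump_chain (p : nat -> R) : invariant_prob Q p -> forall k,
  (\sum_(i <oo) ((p i * - Q i i) * jump_prob Q i k)%:E = (p k * - Q k k)%:E)%E.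
Proof.
move=> [p0 _ pQ] k; rewrite (nneseries_offdiag (a := k) (pQ k)).
- by rewrite sub0r mulrN.
- by rewrite /jump_prob eqxx mulr0.
- move=> i ik; rewrite /jump_prob (negbTE ik) -mulrA; congr (_ * _).
  by rewrite mulrCA divff ?mulr1// oppr_eq0 lt_eqF.
Qed.

Variable j : nat.
Local Notation Pi := (jump_prob Q).
Local Notation W := (predC1 j).
Local Notation A := (taboo_op Pi W).
Local Notation U := (taboo_potential Pi W).

Lemma taboo_op_one k : (A (fun=> 1%E) k + (Pi k j)%:E = 1)%E.
Proof.
rewrite -[RHS](jump_prob_sum1 k) [RHS](@nneseriesD1 _ _ j xpredT)//; last first.
  by move=> l _; rewrite lee_fin jump_prob_ge0.
by rewrite addeC; congr (_ + _)%E; apply: eq_eseriesr => l _; rewrite mule1.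
Qed.

(** Either the chain returns to j within n steps or it survives them; when the
    probability of survival tends to 0 the return is certain. *)
Lemma recurrent_potential :
  iter n A (fun=> 1%E) j @[n --> \oo] --> 0%E -> (U (fun k => (Pi k j)%:E) j = 1)%E.
Proof.
move=> A0.
have Pi0 := jump_prob_ge0.
have c0 (k : nat) : (0 <= (Pi k j)%:E)%E by rewrite lee_fin.
have key n k : (\sum_(m < n) iter m A (fun k => (Pi k j)%:E) k + iter n A (fun=> 1) k = 1)%E.
  elim: n => [|n IH]; first by rewrite big_ord0 add0e.
  rewrite big_ord_recr /= -[RHS]IH -addeA; congr (_ + _)%E.
  rewrite -iterS iterSr -[RHS]/(iter n A (fun=> 1) k)%E.
  have -> : iter n A (fun=> 1%E) k =
      iter n A ((fun k => (Pi k j)%:E) \+ A (fun=> 1))%E k.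
    congr (iter n A _ k); apply/funext => l /=.
    by rewrite addeC taboo_op_one.
  have A10 : forall l, (0 <= A (fun=> 1) l)%E by apply: taboo_op_ge0.
  elim: n k {IH} => //= n IH k.
  by rewrite (eq_taboo_op _ _ (fun l => esym (IH l))) taboo_opD//;
    exact: iter_taboo_op_ge0.
have : (\sum_(m < n) iter m A (fun k => (Pi k j)%:E) j + iter n A (fun=> 1) j)%E
    @[n --> \oo] --> (U (fun k => (Pi k j)%:E) j + 0)%E.
  apply: (@cvgeD _ _ _ _ (fun n => \sum_(m < n) iter m A (fun k => (Pi k j)%:E) j)%E
     (fun n => iter n A (fun=> 1) j)%E) => //.
    by rewrite ge0_adde_def// inE//; exact: taboo_potential_ge0.
  under eq_fun do rewrite -(big_mkord xpredT (fun m => iter m A (fun k => (Pi k j)%:E) j)).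
  by apply: is_cvg_nneseries => m _ _; exact: iter_taboo_op_ge0.
under eq_fun do rewrite key.
by rewrite adde0 => /(cvg_lim (@ereal_hausdorff R)) <-; rewrite lim_cst.
Qed.

Hypothesis reach : forall a b, exists m (y : nat -> nat),
  [/\ y 0%N = a, y m = b & forall l, (l < m)%N -> 0 < Pi (y l) (y l.+1)].

(** The potential at l is at least Pi l k times the potential at k, so that
    finiteness spreads from j to every state that j leads to. *)
Lemma taboo_potential_fin f : (forall k, 0 <= f k)%E -> (U f j < +oo)%E ->
  forall i, (U f i < +oo)%E.
Proof.
move=> f0 Uj i; have [m [y [y0 <- pos]]] := reach j i.
have Pi0 := jump_prob_ge0.
have U0 := taboo_potential_ge0 Pi0 W f0.
suff H l : (l <= m)%N -> (U f (y l) < +oo)%E by exact: H.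
elim: l => [_|l IH lm]; first by rewrite y0.
have [->//|yj] := eqVneq (y l.+1) j.
have : ((Pi (y l) (y l.+1))%:E * U f (y l.+1) <= U f (y l))%E.
  rewrite [leRHS]taboo_potentialE//; apply: (@le_trans _ _ (A (U f) (y l))).
    rewrite /taboo_op (@nneseriesD1 _ _ (y l.+1) W)//; last first.
      by move=> k _; rewrite mule_ge0 ?lee_fin.
    by rewrite leeDl// nneseries_ge0// => k _ _; rewrite mule_ge0 ?lee_fin.
  by rewrite leeDr.
move=> /le_lt_trans /(_ (IH (ltnW lm))).
case: (U f (y l.+1)) (U0 (y l.+1)) => [r| |]// _; first by move=> _; exact: ltry.
by rewrite gt0_muley ?lte_fin ?pos.
Qed.

End Chain.

(** * The augmented truncations *)

Section Truncation.
Context {R : realType}.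
Variables (Q : nat -> nat -> R) (j n : nat).
Hypothesis hQ : conservative_qmatrix Q.
Hypothesis Qneg : forall a, Q a a < 0.
Hypothesis jn : (j <= n)%N.
Local Notation Qt := (Qtilde Q j n).
Local Notation Pi := (jump_prob Q).

Lemma QtildeE (a b : 'I_n.+1) :
  Qt a b = Q a b - (if b == j :> nat then \sum_(k < n.+1) Q a k else 0).
Proof.
rewrite /Qtilde /augment !mxE; congr (_ + _).
rewrite big_ord1 !mxE eqxx andbT -(inj_eq val_inj) /= inordK//.
case: eqP => _; last by rewrite mulr0 oppr0.
rewrite mulr1 -sumrN; apply: eq_bigr => k _.
by rewrite !mxE mulr1.
Qed.

Lemma Qtilde_offj (a b : 'I_n.+1) : b != j :> nat -> Qt a b = Q a b.
Proof. by move=> bj; rewrite QtildeE (negbTE bj) subr0. Qed.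

Lemma Qtilde_basis : Qt (inord j) (inord j) = - \sum_(k < n.+1 | k != j :> nat) Q j k.
Proof.
rewrite QtildeE !inordK// eqxx (bigD1 (inord j : 'I_n.+1))//= !inordK//.
rewrite opprD addrA subrr sub0r; congr (- _); apply: eq_bigl => k.
by rewrite -(inj_eq val_inj) /= inordK.
Qed.

Lemma Qtilde_diag_le0 (a : 'I_n.+1) : Qt a a <= 0.
Proof.
have [aj|aj] := eqVneq (a : nat) j; last by rewrite Qtilde_offj// ltW.
have -> : a = inord j by apply/val_inj; rewrite /= inordK.
rewrite Qtilde_basis oppr_le0 sumr_ge0// => k kj.
by apply: hQ.1 => /esym/eqP; rewrite (negbTE kj).
Qed.

Lemma Qtilde_row_sum (a : 'I_n.+1) : \sum_b Qt a b = 0.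
Proof.
under eq_bigr do rewrite QtildeE.
rewrite big_split /= [X in _ + X](bigD1 (inord j))//= inordK// eqxx.
rewrite [X in _ + (_ + X)]big1 ?addr0 ?subrr// => b bj.
rewrite ifN ?oppr0//; apply: contraNN bj => /eqP bj.
by apply/eqP/val_inj; rewrite /= inordK.
Qed.

Lemma qmatrix_partial_row_le0 (a : 'I_n.+1) : \sum_(k < n.+1) Q a k <= 0.
Proof.
pose v (k : nat) : R := if k == a then 0 else Q a k.
have := @nneseries_offdiag _ (Q a) v a 0 (hQ.2 a).
rewrite /v eqxx sub0r => /(_ erefl) /(_ (fun k ka => ifN_eq _ _ ka)) e.
have v0 k : (0 <= (v k)%:E)%E.
  by rewrite lee_fin /v; case: eqP => // ka; apply: hQ.1 => /esym.
have := @nneseries_lim_ge _ (fun k => (v k)%:E) xpredT 0%N n.+1 (fun k _ _ => v0 k).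
rewrite e sumEFin lee_fin big_mkord (bigD1 a)//= {1}/v eqxx add0r => h.
rewrite (bigD1 a)//= -lerBrDl sub0r (le_trans _ h)//.
rewrite le_eqVlt; apply/orP; left; apply/eqP; apply: eq_bigr => k ka.
by rewrite /v ifN// (inj_eq val_inj).
Qed.

Lemma Qtilde_offdiag_ge0 (a b : 'I_n.+1) : a != b -> 0 <= Qt a b.
Proof.
move=> ab; have Qab : 0 <= Q a b.
  by rewrite hQ.1// => /val_inj/eqP; rewrite (negbTE ab).
rewrite QtildeE; case: ifP => _; last by rewrite subr0.
by rewrite addr_ge0// oppr_ge0 qmatrix_partial_row_le0.
Qed.

Hypothesis Qtj_neg : Qt (inord j) (inord j) < 0.

Lemma Qtilde_diag_lt0 (a : 'I_n.+1) : Qt a a < 0.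
Proof.
have [aj|aj] := eqVneq (a : nat) j; last by rewrite Qtilde_offj.
by have -> : a = inord j by apply/val_inj; rewrite /= inordK.
Qed.

(** The truncated chain read on all naturals: no transition leads beyond n, where
    the rate 1 is a positive placeholder. *)
Definition trunc_rate (a : nat) : R :=
  if (a <= n)%N then - Qt (inord a) (inord a) else 1.

Definition trunc_prob (a b : nat) : R :=
  if (a <= n)%N && (b <= n)%N then jump_prob Qt (inord a) (inord b) else 0.

Local Notation qn := trunc_rate.
Local Notation Pin := trunc_prob.
Local Notation q := (fun k => - Q k k).
Local Notation W := (predC1 j).
Local Notation Wn := [pred k | predC1 j k && (k <= n)%N].

Lemma trunc_rate_ord (a : 'I_n.+1) : qn a = - Qt a a.
Proof. by rewrite /qn leq_ord inord_val. Qed.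

Lemma trunc_prob_ord (a b : 'I_n.+1) : Pin a b = jump_prob Qt a b.
Proof. by rewrite /Pin !leq_ord !inord_val. Qed.

Lemma trunc_prob_out (a b : nat) : (forall e : 'I_n.+1, (e : nat) <> b) -> Pin a b = 0.
Proof.
move=> h; rewrite /Pin; case: ifP => // /andP[_ bn].
by case: (h (inord b)); rewrite inordK.
Qed.

Lemma trunc_rate_gt0 a : 0 < qn a.
Proof. by rewrite /qn; case: ifP => // an; rewrite oppr_gt0 Qtilde_diag_lt0. Qed.

Lemma trunc_prob_ge0 a b : 0 <= Pin a b.
Proof.
rewrite /Pin; case: ifP => // _; rewrite /jump_prob; case: ifPn => // ab.
by rewrite divr_ge0 ?Qtilde_offdiag_ge0// oppr_ge0 Qtilde_diag_le0.
Qed.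

Lemma inord_eq (a b : nat) : (a <= n)%N -> (b <= n)%N ->
  ((inord a : 'I_n.+1) == inord b) = (a == b).
Proof. by move=> an bn; rewrite -(inj_eq val_inj) /= !inordK. Qed.

(** Started away from j, the killed truncated chain is the chain killed on
    leaving the truncation; at j only the holding rate differs. *)
Definition base_factor (a : nat) : R := if a == j then - Q j j / qn j else 1.

Lemma trunc_rateE a : (a <= n)%N -> base_factor a / - Q a a = (qn a)^-1.
Proof.
rewrite /base_factor => an; case: eqP => [->|/eqP aj].
  by rewrite mulrAC divff ?mul1r// oppr_eq0 lt_eqF.
by rewrite mul1r /qn an Qtilde_offj ?inordK.
Qed.

Lemma trunc_probE a b : (a <= n)%N -> (b <= n)%N -> b != j ->
  Pin a b = base_factor a * Pi a b.
Proof.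
move=> an bn bj; rewrite /Pin an bn /jump_prob inord_eq//; case: eqP => [_|ab].
  by rewrite mulr0.
have -> : - Qt (inord a) (inord a) = qn a by rewrite /qn an.
rewrite -(trunc_rateE an) [in LHS]Qtilde_offj ?inordK//.
by rewrite mulrCA.
Qed.

Lemma trunc_potentialE (h : nat -> R) i : (i <= n)%N -> (forall k, 0 <= h k) ->
  (taboo_potential Pin W (fun k => (h k / qn k)%:E) i =
   (base_factor i)%:E * taboo_potential Pi Wn (fun k => (h k / - Q k k)%:E) i)%E.
Proof.
move=> i_n h0; have Pi0 := jump_prob_ge0 hQ.
have f0 k : (0 <= (h k / - Q k k)%:E)%E.
  by rewrite lee_fin divr_ge0// oppr_ge0 ltW.
rewrite /taboo_potential -nneseriesZl; last first.
  by move=> m _; exact: iter_taboo_op_ge0.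
apply: eq_eseriesr => m _; elim: m i i_n => [|m IH] i i_n /=.
  by rewrite -EFinM mulrCA trunc_rateE.
rewrite {1 3}/taboo_op -nneseriesZl; last first.
  by move=> k _; rewrite mule_ge0 ?lee_fin//; exact: iter_taboo_op_ge0.
rewrite eseries_mkcond [RHS]eseries_mkcond; apply: eq_eseriesr => k _ /=.
have [kj|kj] := eqVneq k j; first by [].
have [kn|kn] := leqP k n; last first.
  have kn' : (k <= n)%N = false by rewrite leqNgt kn.
  by rewrite /Pin kn' !andbF mul0e.
rewrite IH// trunc_probE// muleA -EFinM muleA -EFinM.
by rewrite /base_factor (negbTE kj) mulr1.
Qed.

(** The flow p k * qn k is invariant for the truncated jump chain and has a finite
    support, so that p averages over excursions from j. *)
Lemma trunc_invariant (p : 'cV[R]_n.+1) : invariant_prob_mx Qt p ->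
  forall h : nat -> R, (forall k, 0 <= h k) ->
  (forall k, taboo_potential Pi W (fun k => (h k / - Q k k)%:E) k < +oo)%E ->
  ((\sum_l p l 0 * h l)%:E = (p (inord j) 0 * - Q j j)%:E *
    taboo_potential Pi Wn (fun k => (h k / - Q k k)%:E) j)%E.
Proof.
move=> [p0 _ pQ] h h0 fin; have Pi0 := jump_prob_ge0 hQ.
have f0 k : (0 <= (h k / - Q k k)%:E)%E.
  by rewrite lee_fin divr_ge0// oppr_ge0 ltW.
have fn0 k : (0 <= (h k / qn k)%:E)%E.
  by rewrite lee_fin divr_ge0// ltW// trunc_rate_gt0.
pose nu (k : nat) := if (k <= n)%N then p (inord k) 0 * qn k else 0.
have nu_out k : (n < k)%N -> nu k = 0 by move=> nk; rewrite /nu leqNgt nk.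
have nuE (k : 'I_n.+1) : nu k = p k 0 * qn k by rewrite /nu leq_ord inord_val.
have nu0 k : 0 <= nu k.
  by rewrite /nu; case: ifP => // _; rewrite mulr_ge0// ltW// trunc_rate_gt0.
have sum_supp (u : nat -> R) : (forall k, (n < k)%N -> u k = 0) ->
    (\sum_(k <oo) (u k)%:E = (\sum_(k < n.+1) u k)%:E)%E.
  move=> u0; apply/cvg_lim => //; apply: cvg_near_cst; near=> m.
  have nm : (n < m)%N by near: m; exact: nbhs_infty_gt.
  rewrite sumEFin; congr (_%:E).
  rewrite (big_cat_nat (n := n.+1))//= [X in _ + X]big_nat_cond [X in _ + X]big1 ?addr0.
    by rewrite big_mkord.
  by move=> k /andP[/andP[nk _] _]; exact: u0.
have nuPi k : (\sum_(i <oo) (nu i * Pin i k)%:E = (nu k)%:E)%E.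
  rewrite (sum_supp (fun i => nu i * Pin i k)); last by move=> i ni; rewrite nu_out ?mul0r.
  congr (_%:E); have [kn|kn] := leqP k n; last first.
    rewrite nu_out// big1// => i _.
    by rewrite /Pin [(k <= n)%N]leqNgt kn andbF mulr0.
  have kE : k = (inord k : 'I_n.+1) by rewrite inordK.
  move: (inord k : 'I_n.+1) kE => {kn} k' ->; rewrite nuE.
  have e : p k' 0 * Qt k' k' + \sum_(i < n.+1 | i != k') p i 0 * Qt i k' = 0.
    have pT i : p^T 0 i = p i 0 by rewrite mxE.
    have := congr1 (fun M : 'rV_n.+1 => M 0 k') pQ.
    rewrite [X in X = _]mxE [X in _ = X -> _]mxE => e; rewrite -[RHS]e.
    rewrite [RHS](bigD1 k')//= pT; congr (_ + _).
    by apply: eq_bigr => i _; rewrite pT.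
  rewrite (bigD1 k')//=.
  have -> : nu k' * Pin k' k' = 0 by rewrite trunc_prob_ord /jump_prob eqxx mulr0.
  rewrite add0r trunc_rate_ord mulrN; apply/eqP; rewrite -addr_eq0 addrC.
  rewrite -[X in _ == X]e; apply/eqP; congr (_ + _); apply: eq_bigr => i ik.
  rewrite nuE trunc_prob_ord /jump_prob (negbTE ik) trunc_rate_ord -mulrA; congr (_ * _).
  by rewrite mulrCA divff ?mulr1// oppr_eq0 lt_eqF// Qtilde_diag_lt0.
have Ufin k : (k <= n)%N ->
    (taboo_potential Pin W (fun k => (h k / qn k)%:E) k < +oo)%E.
  move=> kn; rewrite trunc_potentialE//.
  have VU : (taboo_potential Pi Wn (fun k => (h k / - Q k k)%:E) k < +oo)%E.
    apply: le_lt_trans (fin k).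
    by apply: subset_taboo_potential => // l /= /andP[].
  have : (0 <= taboo_potential Pi Wn (fun k => (h k / - Q k k)%:E) k)%E.
    exact: taboo_potential_ge0.
  by case: taboo_potential VU => // r _ _; rewrite -EFinM ltry.
have := @pairing_potential_fin_support _ Pin trunc_prob_ge0 nu j nu0 nuPi n _ fn0 nu_out Ufin.
rewrite trunc_potentialE// muleA -EFinM.
have -> : nu j * base_factor j = p (inord j) 0 * - Q j j.
  rewrite /nu jn /base_factor eqxx -mulrA; congr (_ * _).
  by rewrite mulrCA divff ?mulr1// gt_eqF// trunc_rate_gt0.
move=> <-; rewrite /pairing; under [RHS]eq_eseriesr do rewrite -EFinM.
rewrite (sum_supp (fun k => nu k * (h k / qn k))); last by move=> k nk; rewrite nu_out ?mul0r.
congr (_%:E); apply: eq_bigr => k _; rewrite nuE -mulrA; congr (_ * _).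
by rewrite mulrCA divff ?mulr1// gt_eqF// trunc_rate_gt0.
Unshelve. all: by end_near. Qed.

End Truncation.

(** * Convergence of the solutions of Poisson's equation *)

Section SignedPotential.
Context {R : realType}.
Variables (Pi : nat -> nat -> R) (q : nat -> R) (W : pred nat) (i : nat).
Hypothesis Pi0 : forall a b, 0 <= Pi a b.
Hypothesis q0 : forall k, 0 < q k.

Definition rate_potential (f : nat -> R) : \bar R :=
  taboo_potential Pi W (fun k => (f k / q k)%:E) i.

Local Notation T := rate_potential.

Let fq0 (f : nat -> R) : (forall k, 0 <= f k) -> forall k, (0 <= (f k / q k)%:E)%E.
Proof. by move=> f0 k; rewrite lee_fin divr_ge0// ltW. Qed.

Lemma rate_potential_ge0 f : (forall k, 0 <= f k) -> (0 <= T f)%E.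
Proof. by move=> f0; apply: taboo_potential_ge0 => //; exact: fq0. Qed.

Lemma rate_potentialD f h : (forall k, 0 <= f k) -> (forall k, 0 <= h k) ->
  T (fun k => f k + h k) = (T f + T h)%E.
Proof.
move=> f0 h0; rewrite /T -taboo_potentialD//; try exact: fq0.
by apply: eq_taboo_potential => k /=; rewrite mulrDl.
Qed.

Lemma rate_potential_cst a : 0 <= a -> T (fun=> a) = (a%:E * T (fun=> 1%R))%E.
Proof.
move=> a0; rewrite /T -taboo_potentialZ//; last exact: fq0.
by apply: eq_taboo_potential => k; rewrite -EFinM mul1r.
Qed.

Lemma le_rate_potential f h : (forall k, 0 <= f k) -> (forall k, f k <= h k) ->
  (T f <= T h)%E.
Proof.
move=> f0 fh; apply: le_taboo_potential => //; first exact: fq0.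
by move=> k; rewrite lee_fin ler_wpM2r// invr_ge0 ltW.
Qed.

Lemma pos_neg_part (x : R) : Num.max x 0 - Num.max (- x) 0 = x.
Proof.
by have [] := leP x 0; have [] := leP (- x) 0; lra.
Qed.

(** The identity (g - c)^+ + g^- + c^+ = (g - c)^- + g^+ + c^- only has nonnegative
    terms, to which the additivity of the potential applies. *)
Lemma rate_potential_shift (g : nat -> R) (c : R) :
  (T (fun k => Num.max (g k) 0%R) < +oo)%E ->
  (T (fun k => Num.max (- g k)%R 0%R) < +oo)%E -> (T (fun=> 1%R) < +oo)%E ->
  [/\ (T (fun k => Num.max (g k - c)%R 0%R) < +oo)%E,
      (T (fun k => Num.max (- (g k - c))%R 0%R) < +oo)%E &
      fine (T (fun k => Num.max (g k - c) 0)) - fine (T (fun k => Num.max (- (g k - c)) 0)) =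
      fine (T (fun k => Num.max (g k) 0)) - fine (T (fun k => Num.max (- g k) 0))
      - c * fine (T (fun=> 1%R))].
Proof.
move=> finp finm fin1.
have max0 (u : nat -> R) k : 0 <= Num.max (u k) 0 by rewrite le_max lexx orbT.
pose a := Num.max c 0; pose b := Num.max (- c) 0.
have a0 : 0 <= a by rewrite le_max lexx orbT.
have b0 : 0 <= b by rewrite le_max lexx orbT.
have cE : c = a - b by rewrite pos_neg_part.
pose gp k := Num.max (g k) 0; pose gm k := Num.max (- g k) 0.
pose hp k := Num.max (g k - c) 0; pose hm k := Num.max (- (g k - c)) 0.
have gp0 : forall k, 0 <= gp k by exact: max0.
have gm0 : forall k, 0 <= gm k by exact: (max0 (fun k => - g k)).
have hp0 : forall k, 0 <= hp k by exact: (max0 (fun k => g k - c)).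
have hm0 : forall k, 0 <= hm k by exact: (max0 (fun k => - (g k - c))).
have fn (f : nat -> R) : (forall k, 0 <= f k) -> (T f < +oo)%E -> T f \is a fin_num.
  by move=> f0 ?; rewrite ge0_fin_numE// rate_potential_ge0.
have Ta : T (fun=> a) = (a * fine (T (fun=> 1%R)))%:E.
  by rewrite rate_potential_cst// EFinM fineK// fn.
have Tb : T (fun=> b) = (b * fine (T (fun=> 1%R)))%:E.
  by rewrite rate_potential_cst// EFinM fineK// fn.
have Tgp : T gp = (fine (T gp))%:E by rewrite fineK// fn.
have Tgm : T gm = (fine (T gm))%:E by rewrite fineK// fn.
have dec k : hp k - hm k = gp k - gm k - (a - b).
  by rewrite !pos_neg_part.
have finhp : (T hp < +oo)%E.
  apply: (@le_lt_trans _ _ (T (fun k => gp k + b))).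
    apply: le_rate_potential => // k; rewrite /hp ge_max addr_ge0// andbT.
    rewrite lerBlDr -addrA; apply: ler_wpDr; first by rewrite cE addrC subrK.
    by rewrite le_max lexx.
  by rewrite rate_potentialD// Tgp Tb -EFinD ltry.
have finhm : (T hm < +oo)%E.
  apply: (@le_lt_trans _ _ (T (fun k => gm k + a))).
    apply: le_rate_potential => // k; rewrite /hm ge_max addr_ge0// andbT opprB addrC.
    by rewrite lerD// ?le_max lexx.
  by rewrite rate_potentialD// Tgm Ta -EFinD ltry.
split => //.
have : T (fun k => hp k + (gm k + a)) = T (fun k => hm k + (gp k + b)).
  apply: eq_taboo_potential => k; congr ((_ / _)%:E).
  have := dec k => /eqP; rewrite subr_eq => /eqP ->.
  rewrite addrACA addrC !opprB; ring.
rewrite !rate_potentialD//; try by move=> k; rewrite addr_ge0.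
rewrite Ta Tb Tgp Tgm -(fineK (fn _ hp0 finhp)) -(fineK (fn _ hm0 finhm)) -!EFinD.
move=> [] e; rewrite -/gp -/gm -/hp -/hm cE.
set x := fine (T hp) in e *; set y := fine (T hm) in e *.
set z := fine (T gp) in e *; set t := fine (T gm) in e *.
set o := fine (T _) in e *.
apply/eqP; rewrite subr_eq; apply/eqP.
have -> : x = y + (z + b * o) - (t + a * o) by rewrite -e addrK.
rewrite /=; ring.
Qed.

End SignedPotential.

Section PartTwo.
Context {R : realType}.
Variables (Q : nat -> nat -> R) (d : measure_display) (Omega : measurableType d).
Variables (P : nat -> probability Omega R) (Phi : R -> Omega -> nat).
Variables (p g : nat -> R) (j : nat).
Hypothesis hQ : conservative_qmatrix Q.
Hypothesis hPhi : forall i : nat, is_ctmc Q (P i) i Phi.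
Hypothesis hirr : irreducible P Phi.
Hypothesis hrec : positive_recurrent P Phi.
Hypothesis hp : invariant_prob Q p.
Hypothesis hg : cvgn (series (fun k => p k * `|g k|)).
Local Notation Pi := (jump_prob Q).
Local Notation q := (fun k => - Q k k).
Local Notation W := (predC1 j).

Lemma chain_reach a b : exists m (y : nat -> nat),
  [/\ y 0%N = a, y m = b & forall l, (l < m)%N -> 0 < Pi (y l) (y l.+1)].
Proof.
have [t t0 Pt] := hirr a b.
have [m [y [y0 ym h]]] := ctmc_reach (hPhi a) t0 Pt.
exists m, y; split => // l lm.
by rewrite lt_neqAle eq_sym h// jump_prob_ge0.
Qed.

Lemma chain_no_absorption a : Q a a < 0.
Proof.
have [[|m] [y [y0 ym h]]] := chain_reach a a.+1.
  by move: ym; rewrite y0 => /eqP; rewrite ltn_eqF.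
by apply: (@jump_prob_neq0_diag _ _ hQ a (y 1%N)); rewrite -{1}y0 gt_eqF// h.
Qed.

Let Qneg := chain_no_absorption.
Let Pi0 := jump_prob_ge0 hQ.
Let q0 k : 0 < - Q k k. Proof. by rewrite oppr_gt0. Qed.

Local Notation T := (rate_potential Pi q W).
Local Notation Tn n := (rate_potential Pi q [pred k | predC1 j k && (k <= n)%N]).

Let Pi_out (a b : nat) : (forall e : nat, id e <> b) -> Pi a b = 0.
Proof. by move=> /(_ b). Qed.

Lemma return_time_potential : (T j (fun=> 1%R) < +oo)%E.
Proof.
have := hrec j; rewrite (expected_return_time j (hPhi j) Qneg (c := id) (q := q) (Pi := Pi))//.
Qed.

Lemma chain_recurrent : (taboo_potential Pi W (fun k => (Pi k j)%:E) j = 1)%E.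
Proof.
apply: recurrent_potential => //.
apply: (taboo_prob_cvg0 (hPhi j) Qneg (c := id) (q := q) (Pi := Pi)) => //.
exact: return_time_potential.
Qed.

Let nu k := p k * - Q k k.

Lemma stationary_potential (f : nat -> R) : (forall k, 0 <= f k) ->
  (\sum_(k <oo) (p k * f k)%:E = (nu j)%:E * T j f)%E.
Proof.
move=> f0; have [p0 _ _] := hp.
have nu0 k : 0 <= nu k by rewrite mulr_ge0// ltW.
have := pairing_potential Pi0 nu0 (invariant_jump_chain Qneg hp) chain_recurrent
  (fun a => chain_reach a j) (h := fun k => f k / - Q k k).
move=> <-; last by move=> k; rewrite divr_ge0// ltW.
apply: eq_eseriesr => k _; rewrite -EFinM /nu -mulrA; congr (_ * _)%:E.
by rewrite mulrCA divff ?mulr1// gt_eqF.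
Qed.

Let nuT1 : ((nu j)%:E * T j (fun=> 1%R) = 1)%E.
Proof.
rewrite -stationary_potential//; have [_ p1 _] := hp.
by rewrite -(nneseries_cvg_series p1); apply: eq_eseriesr => k _; rewrite mulr1.
Qed.

Let nu_gt0 : 0 < nu j.
Proof.
have [p0 _ _] := hp; rewrite lt_neqAle mulr_ge0 ?p0 ?ltW// andbT eq_sym.
by apply/eqP => nu0; move: nuT1; rewrite nu0 mul0e => /eqP; rewrite eqe eq_sym oner_eq0.
Qed.

Lemma rate_potential_fin (f : nat -> R) i : (forall k, 0 <= f k) ->
  (forall k, f k <= `|g k|) -> (T i f < +oo)%E.
Proof.
move=> f0 fg; have [p0 _ _] := hp.
apply: (taboo_potential_fin hQ chain_reach) => [k|].
  by rewrite lee_fin divr_ge0// ltW.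
have := stationary_potential f0.
have lt : (\sum_(k <oo) (p k * f k)%:E < +oo)%E.
  apply: (@le_lt_trans _ _ (\sum_(k <oo) (p k * `|g k|)%:E)%E).
    by apply: lee_nneseries => k _; rewrite lee_fin ?mulr_ge0// ler_wpM2l.
  by rewrite (nneseries_cvg_series hg) ltry.
move=> e; rewrite e in lt; move: lt; rewrite -/(rate_potential Pi q W j f).
have := rate_potential_ge0 W j Pi0 q0 f0.
case: (rate_potential Pi q W j f) => [r _ _|_|//]; first exact: ltry.
by rewrite gt0_muley ?lte_fin.
Qed.

Let gp k := Num.max (g k) 0.
Let gm k := Num.max (- g k) 0.
Let gp0 k : 0 <= gp k. Proof. by rewrite le_max lexx orbT. Qed.
Let gm0 k : 0 <= gm k. Proof. by rewrite le_max lexx orbT. Qed.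
Let Tgp i : (T i gp < +oo)%E.
Proof.
by apply: rate_potential_fin => // k; rewrite ge_max normr_ge0 andbT ler_norm.
Qed.
Let Tgm i : (T i gm < +oo)%E.
Proof.
by apply: rate_potential_fin => // k; rewrite ge_max normr_ge0 andbT -normrN ler_norm.
Qed.
Let T1 i : (T i (fun=> 1%R) < +oo)%E.
Proof.
apply: (taboo_potential_fin hQ chain_reach) => [k|]; last exact: return_time_potential.
by rewrite lee_fin divr_ge0// ltW.
Qed.

Let T_fin i (f : nat -> R) : (forall k, 0 <= f k) -> (T i f < +oo)%E ->
  T i f = (fine (T i f))%:E.
Proof. by move=> f0 h; rewrite fineK// ge0_fin_numE// rate_potential_ge0. Qed.

(** The constant function 1 has mean 1, which fixes the factor nu j. *)
Lemma stationary_mean : limn (series (fun k => p k * g k)) =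
  (fine (T j gp) - fine (T j gm)) / fine (T j (fun=> 1%R)).
Proof.
have t1 : nu j * fine (T j (fun=> 1%R)) = 1.
  by apply: EFin_inj; rewrite EFinM -T_fin.
have nuE : (fine (T j (fun=> 1%R)))^-1 = nu j.
  have h : fine (T j (fun=> 1%R)) != 0.
    by apply/eqP => h; move: t1; rewrite h mulr0 => /esym/eqP; rewrite oner_eq0.
  by apply: (mulIf h); rewrite mulVf// t1.
have cvg_part (f : nat -> R) : (forall k, 0 <= f k) -> (T j f < +oo)%E ->
    series (fun k => p k * f k) @ \oo --> nu j * fine (T j f).
  move=> f0 Tf; have [p0 _ _] := hp.
  have := stationary_potential f0; rewrite (T_fin f0 Tf) -EFinM => e.
  have h : (fun n => \sum_(0 <= k < n) (p k * f k)%:E)%E @ \oo -->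
      (nu j * fine (T j f))%:E.
    rewrite -e; apply: is_cvg_nneseries => k _ _.
    by rewrite lee_fin mulr_ge0.
  move/fine_cvgP : h => [_]; apply: cvg_trans; apply: near_eq_cvg; apply: nearW => n.
  by rewrite /= sumEFin.
apply/cvg_lim => //.
rewrite nuE mulrBl mulrC [fine (T j gm) * _]mulrC.
rewrite (_ : series _ = series (fun k => p k * gp k) \- series (fun k => p k * gm k)).
  by apply: cvgB; apply: cvg_part.
apply/funext => n; rewrite /series /= -sumrB; apply: eq_bigr => k _.
by rewrite -mulrBr pos_neg_part.
Qed.

Lemma expected_xi_centered i : expected_xi (P i) Phi j (centered p g) =
  (fine (T i gp) - fine (T i gm)
   - (fine (T j gp) - fine (T j gm)) / fine (T j (fun=> 1%R)) * fine (T i (fun=> 1%R)))%:E.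
Proof.
rewrite -stationary_mean; set c := limn _.
have [fp fm e] := rate_potential_shift Pi0 q0 c (Tgp i) (Tgm i) (T1 i).
rewrite -e (expected_xi_signed (hPhi i) Qneg (c := id) (q := q) (Pi := Pi) _ _ _ _ _ _
  (hn := centered p g))//.
rewrite -/(rate_potential Pi q W i _) EFinB !fineK//.
- by rewrite ge0_fin_numE// rate_potential_ge0// => k; rewrite le_max lexx orbT.
- by rewrite ge0_fin_numE// rate_potential_ge0// => k; rewrite le_max lexx orbT.
Qed.

Section Limit.
Variables (dn : nat -> measure_display) (Omegan : forall n, measurableType (dn n)).
Variable Pn : forall n : nat, 'I_n.+1 -> probability (Omegan n) R.
Variable Phin : forall n : nat, R -> Omegan n -> 'I_n.+1.
Variable pn : forall n : nat, 'cV[R]_n.+1.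
Hypothesis hPhin : forall n : nat, (j <= n)%N -> forall i : 'I_n.+1,
  is_ctmc (Qtilde Q j n) (@Pn n i) i (@Phin n).
Hypothesis hpn : forall n : nat, (j <= n)%N -> invariant_prob_mx (Qtilde Q j n) (pn n).

Let base_rate n := - Qtilde Q j n (inord j) (inord j).

(** The row of j sums to 0, hence the rate that is redirected from outside the
    window to j itself tends to 0. *)
Let base_rate_cvg : base_rate n @[n --> \oo] --> - Q j j.
Proof.
have := hQ.2 j; rewrite -(cvg_shiftS (series (Q j))) => h.
have : (- Q j j + series (Q j) n.+1) @[n --> \oo] --> - Q j j + 0.
  by apply: cvgD => //; exact: cvg_cst.
rewrite addr0; apply: cvg_trans; apply: near_eq_cvg; near=> n.
have jn : (j <= n)%N by near: n; exact: nbhs_infty_ge.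
rewrite /base_rate QtildeE// inordK// eqxx opprB addrC; congr (_ + _).
by rewrite /series /= big_mkord.
Unshelve. all: by end_near. Qed.

Let Tn_fin n i (f : nat -> R) : (forall k, 0 <= f k) -> (T i f < +oo)%E ->
  (Tn n i f < +oo)%E.
Proof.
move=> f0; apply: le_lt_trans; apply: subset_taboo_potential => //.
- by move=> k; rewrite lee_fin divr_ge0// ltW.
- by move=> k /= /andP[].
Qed.

Let Tn_fineK n i (f : nat -> R) : (forall k, 0 <= f k) -> (T i f < +oo)%E ->
  Tn n i f = (fine (Tn n i f))%:E.
Proof.
move=> f0 h; rewrite fineK// ge0_fin_numE ?rate_potential_ge0//.
exact: Tn_fin.
Qed.

Let Tn_cvg i (f : nat -> R) : (forall k, 0 <= f k) -> (T i f < +oo)%E ->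
  fine (Tn n i f) @[n --> \oo] --> fine (T i f).
Proof.
move=> f0 h; apply: fine_cvg; rewrite -T_fin//.
by apply: cvg_taboo_potential => // k; rewrite lee_fin divr_ge0// ltW.
Qed.

Lemma trunc_mean n : (j <= n)%N -> base_rate n > 0 ->
  \sum_l pn n l 0 * g l =
  (fine (Tn n j gp) - fine (Tn n j gm)) / fine (Tn n j (fun=> 1%R)).
Proof.
move=> jn b0; have [p0 p1 _] := hpn jn.
have Qtj : Qtilde Q j n (inord j) (inord j) < 0 by rewrite -oppr_gt0.
have inv (f : nat -> R) : (forall k, 0 <= f k) -> (forall i, T i f < +oo)%E ->
    \sum_l pn n l 0 * f l = pn n (inord j) 0 * - Q j j * fine (Tn n j f).
  move=> f0 fin; have := trunc_invariant hQ Qneg jn Qtj (hpn jn) f0 fin.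
  by rewrite -/(rate_potential Pi q _ j f) (Tn_fineK n f0 (fin j)) -EFinM => -[].
have e1 := inv (fun=> 1%R) (fun=> ler01) T1.
have ep := inv gp gp0 Tgp; have em := inv gm gm0 Tgm.
have {}e1 : pn n (inord j) 0 * - Q j j * fine (Tn n j (fun=> 1%R)) = 1.
  by rewrite -e1 -[RHS]p1; apply: eq_bigr => l _; rewrite mulr1.
have -> : \sum_l pn n l 0 * g l = \sum_l pn n l 0 * gp l - \sum_l pn n l 0 * gm l.
  by rewrite -sumrB; apply: eq_bigr => l _; rewrite -mulrBr pos_neg_part.
rewrite ep em -mulrBr; set a := _ * - _ in e1 *; set t := fine _ in e1 *.
have t0 : t != 0 by apply/eqP => h; move: e1; rewrite h mulr0 => /esym/eqP; rewrite oner_eq0.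
by apply: (mulIf t0); rewrite divfK// mulrAC e1 mul1r.
Qed.

Lemma trunc_expected_xi n i : (maxn i j <= n)%N -> base_rate n > 0 ->
  expected_xi (@Pn n (inord i)) (@Phin n) (inord j)
    (centered_mx (pn n) (restrict_to g n)) =
  ((if i == j then - Q j j / base_rate n else 1) *
   (fine (Tn n i gp) - fine (Tn n i gm)
   - (fine (Tn n j gp) - fine (Tn n j gm)) / fine (Tn n j (fun=> 1%R)) *
     fine (Tn n i (fun=> 1%R))))%:E.
Proof.
rewrite geq_max => /andP[i_n jn] b0; rewrite -trunc_mean//; set c := \sum_l _.
have Qtj : Qtilde Q j n (inord j) (inord j) < 0 by rewrite -oppr_gt0.
have [fp fm e] := rate_potential_shift Pi0 q0 c (Tn_fin n gp0 (Tgp i))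
  (Tn_fin n gm0 (Tgm i)) (Tn_fin n (fun=> ler01) (T1 i)).
have max0 (u : nat -> R) k : 0 <= Num.max (u k) 0 by rewrite le_max lexx orbT.
have hp0 k : 0 <= Num.max (g k - c) 0 by exact: (max0 (fun k => g k - c)).
have hm0 k : 0 <= Num.max (- (g k - c)) 0 by exact: (max0 (fun k => - (g k - c))).
have ij : (inord i : 'I_n.+1) = i :> nat by rewrite inordK.
have jj : (inord j : 'I_n.+1) = j :> nat by rewrite inordK.
have tE f : (forall k, 0 <= f k) ->
  (taboo_potential (trunc_prob Q j n) (predC1 ((inord j : 'I_n.+1) : nat))
    (fun k => (f k / trunc_rate Q j n k)%:E) (inord i : 'I_n.+1) =
   (base_factor Q j n i)%:E * Tn n i f)%E.
  by move=> f0; rewrite ij jj trunc_potentialE.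
rewrite (expected_xi_signed (hPhin jn (inord i)) (Qtilde_diag_lt0 Qneg jn Qtj)
   (c := fun e : 'I_n.+1 => e : nat) (q := trunc_rate Q j n) (Pi := trunc_prob Q j n)
   (@val_inj _ _ _) (@trunc_rate_ord _ _ _ _) (@trunc_prob_ord _ _ _ _)
   (@trunc_prob_out _ _ _ _) (trunc_rate_gt0 Qneg jn Qtj) (trunc_prob_ge0 hQ Qneg jn)
   (hn := fun k => g k - c))//; rewrite ?(tE _ hp0) ?(tE _ hm0).
- have -> : base_factor Q j n i = if i == j then - Q j j / base_rate n else 1.
    by rewrite /base_factor /trunc_rate jn.
  rewrite -e mulrBr EFinB !EFinM !fineK// ge0_fin_numE// rate_potential_ge0//.
- rewrite -(fineK (_ : Tn n i _ \is a fin_num)) -?EFinM ?ltry//.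
  by rewrite ge0_fin_numE// rate_potential_ge0.
- rewrite -(fineK (_ : Tn n i _ \is a fin_num)) -?EFinM ?ltry//.
  by rewrite ge0_fin_numE// rate_potential_ge0.
Qed.

(** Both sides are the same continuous function of the potentials of g^+, g^- and
    1 at i and j, and the truncated potentials converge. *)
Lemma poisson_limit i :
  expected_xi (@Pn n (inord i)) (@Phin n) (inord j)
     (centered_mx (pn n) (restrict_to g n)) @[n --> \oo]
     --> expected_xi (P i) Phi j (centered p g).
Proof.
rewrite expected_xi_centered.
have t0 : fine (T j (fun=> 1%R)) != 0.
  apply/eqP => h; have := nuT1; rewrite T_fin// h mule0 => /esym/eqP.
  by rewrite eqe oner_eq0.
have lim : (if i == j then - Q j j / base_rate n else 1) *
   (fine (Tn n i gp) - fine (Tn n i gm)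
   - (fine (Tn n j gp) - fine (Tn n j gm)) / fine (Tn n j (fun=> 1%R)) *
     fine (Tn n i (fun=> 1%R))) @[n --> \oo] -->
   1 * (fine (T i gp) - fine (T i gm)
   - (fine (T j gp) - fine (T j gm)) / fine (T j (fun=> 1%R)) * fine (T i (fun=> 1%R))).
  apply: cvgM.
    case: eqP => _; last exact: cvg_cst.
    rewrite -(divff (lt0r_neq0 (q0 j))); apply: cvgM; first exact: cvg_cst.
    by apply: cvgV => //; exact: lt0r_neq0.
  apply: cvgB; first by apply: cvgB; exact: Tn_cvg.
  apply: cvgM; last exact: Tn_cvg.
  apply: cvgM; first by apply: cvgB; exact: Tn_cvg.
  by apply: cvgV => //; exact: Tn_cvg.
rewrite mul1r in lim; apply/fine_cvgP.
have xiE : \forall n \near \oo, expected_xi (@Pn n (inord i)) (@Phin n) (inord j)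
    (centered_mx (pn n) (restrict_to g n)) =
  ((if i == j then - Q j j / base_rate n else 1) *
   (fine (Tn n i gp) - fine (Tn n i gm)
   - (fine (Tn n j gp) - fine (Tn n j gm)) / fine (Tn n j (fun=> 1%R)) *
     fine (Tn n i (fun=> 1%R))))%:E.
  near=> n; apply: trunc_expected_xi; first by near: n; exact: nbhs_infty_ge.
  near: n; exact: (cvgr_gt (- Q j j) base_rate_cvg 0 (q0 j)).
split; first by near=> n; rewrite (near xiE n).
apply: cvg_trans lim; apply: near_eq_cvg; near=> n => /=.
by rewrite (near xiE n).
Unshelve. all: by end_near. Qed.

End Limit.
End PartTwo.

(** * Chains built from states and sojourns *)

Section Sojourns.
Context {R : realType} {d : measure_display} {Omega : measurableType d}.
Context {E : countType}.
Variables (e0 : E) (Y : nat -> Omega -> E) (S : nat -> Omega -> \bar R).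

Definition arrival m w : \bar R := (\sum_(l < m) S l w)%E.

Definition regular_sojourns w :=
  [/\ forall m, (0 < S m w)%E,
      forall m, (S m w < +oo)%E -> Y m.+1 w <> Y m w
    & forall K : nat, exists m, (K%:R%:E < arrival m w)%E].

(** Outside the regular sojourns the path is frozen at e0, so that it is
    right-continuous for every outcome. *)
Definition sojourn_path (t : R) w : E :=
  xget e0 [set e | regular_sojourns w /\
    exists2 m, (arrival m w <= t%:E < arrival m.+1 w)%E & Y m w = e].

Local Notation J := arrival.
Local Notation X := sojourn_path.

Lemma arrivalS m w : (J m.+1 w = J m w + S m w)%E.
Proof. by rewrite /arrival big_ord_recr. Qed.

Section Regular.
Variable w : Omega.
Hypothesis reg : regular_sojourns w.

Lemma arrival_ge0 m : (0 <= J m w)%E.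
Proof. by apply: sume_ge0 => l _; case: reg => h _ _; exact: ltW. Qed.

Lemma arrival_nd : nondecreasing_seq (J ^~ w).
Proof.
apply/nondecreasing_seqP => m; rewrite arrivalS leeDl//.
by case: reg => h _ _; exact: ltW.
Qed.

Lemma arrival_lt m : (J m w < +oo)%E -> (J m w < J m.+1 w)%E.
Proof.
move=> fin; rewrite arrivalS; case: reg => /(_ m) + _ _.
have := arrival_ge0 m; case: (J m w) fin => [r _ _| |]//.
case: (S m w) => [s| |]//; last by move=> _; rewrite addey ?ltry.
by rewrite -EFinD !lte_fin ltrDl.
Qed.

Lemma sojourn_pathE m t : (J m w <= t%:E < J m.+1 w)%E -> X t w = Y m w.
Proof.
move=> /andP[mt tm].
have [|_ [k /andP[kt tk] h]] := @xgetPex _ e0 [set e | regular_sojourns w /\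
    exists2 m, (J m w <= t%:E < J m.+1 w)%E & Y m w = e].
  by exists (Y m w); split => //; exists m; rewrite ?mt.
rewrite /X -h; congr (Y _ w); case: (ltngtP k m) => // km.
- by have := lt_le_trans tk (le_trans (arrival_nd km) mt); rewrite ltxx.
- by have := lt_le_trans tm (le_trans (arrival_nd km) kt); rewrite ltxx.
Qed.

Lemma arrival_cvgy : J n w @[n --> \oo] --> +oo%E.
Proof.
apply/cvgeyPgt => A; case: reg => _ _ /(_ (Num.truncn `|A|).+1) [m hm].
exists m => // n /= mn; apply: lt_le_trans (arrival_nd mn).
apply: lt_trans hm; rewrite lte_fin; apply: le_lt_trans (ler_norm A) _.
exact: truncnS_gt.
Qed.

Lemma step_sojourn_path : step_path (X ^~ w) (Y ^~ w) (J ^~ w).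
Proof.
split => [|m|m t|m fin|].
- by rewrite /arrival big_ord0.
- by split; [exact: arrival_nd|exact: arrival_lt].
- exact: sojourn_pathE.
- case: (reg) => _ + _; apply; move: fin; rewrite arrivalS.
  have := arrival_ge0 m; case: (J m w) => [r| |]//; last first.
    move=> _; case: reg => /(_ m); case: (S m w) => [s| |]//.
  by move=> _; case: (S m w) => [s| |]// _; rewrite ?ltry.
- exact: arrival_cvgy.
Qed.

End Regular.

Lemma sojourn_path_irregular w t : ~ regular_sojourns w -> X t w = e0.
Proof. by move=> nreg; apply: xgetPN => e [/nreg]. Qed.

Lemma sojourn_path_right_continuous w : right_continuous (X ^~ w).
Proof.
have [reg|nreg] := pselect (regular_sojourns w).
  exact: step_path_right_continuous (step_sojourn_path reg).
by move=> t t0; apply: nearW => s; rewrite !sojourn_path_irregular.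
Qed.

Hypothesis mY : forall m, discrete_measurable (Y m).
Hypothesis mS : forall m, measurable_fun setT (S m).

Lemma measurable_arrival m : measurable_fun setT (J m).
Proof. by apply: emeasurable_fun_sum => l; exact: mS. Qed.

Let mlt (f g : Omega -> \bar R) : measurable_fun setT f -> measurable_fun setT g ->
  measurable [set w | (f w < g w)%E].
Proof. by move=> mf mg; rewrite -[X in measurable X]setTI; exact: measurable_lte. Qed.

Lemma measurable_regular_sojourns : measurable [set w | regular_sojourns w].
Proof.
rewrite [X in measurable X](_ : _ =
  \bigcap_m [set w | (0 < S m w)%E] `&`
  \bigcap_m (~` ([set w | (S m w < +oo)%E] `&` [set w | Y m.+1 w = Y m w])) `&`
  \bigcap_(K : nat) \bigcup_m [set w | (K%:R%:E < J m w)%E]); last first.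
  apply/seteqP; split=> w /=.
    move=> [h1 h2 h3]; split; last by move=> K _; have [m hm] := h3 K; exists m.
    by split=> m _; [exact: h1|move=> [/h2]].
  move=> [[h1 h2] h3]; split.
  - by move=> m; exact: (h1 m I).
  - by move=> m fin eq; apply: (h2 m I).
  - by move=> K; have [m _ hm] := h3 K I; exists m.
apply: measurableI; first apply: measurableI.
- by apply: bigcapT_measurable => m; apply: mlt.
- apply: bigcapT_measurable => m; apply: measurableC; apply: measurableI.
    exact: mlt.
  exact: (@discrete_measurable_rel _ _ _ _ _ (fun a b => a = b)).
- apply: bigcapT_measurable => K; apply: bigcupT_measurable => m; apply: mlt => //.
  exact: measurable_arrival.
Qed.

Lemma measurable_sojourn_path t k : 0 <= t -> measurable [set w | X t w = k].
Proof.
move=> t0.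
rewrite [X in measurable X](_ : _ =
  \bigcup_m ([set w | regular_sojourns w] `&` ([set w | (J m w <= t%:E)%E] `&`
     [set w | (t%:E < J m.+1 w)%E] `&` [set w | Y m w = k])) `|`
  (~` [set w | regular_sojourns w] `&` (if e0 == k then setT else set0))).
  apply: measurableU.
    apply: bigcupT_measurable => m; apply: measurableI; first exact: measurable_regular_sojourns.
    apply: measurableI; last exact: mY.
    apply: measurableI; last by apply: mlt => //; exact: measurable_arrival.
    rewrite -[X in measurable X]setTI; apply: emeasurable_fun_infty_c => //.
    exact: measurable_arrival.
  apply: measurableI; first exact/measurableC/measurable_regular_sojourns.
  by case: eqP.
apply/seteqP; split=> w /=.
- have [reg|nreg] := pselect (regular_sojourns w).
    have [m /andP[mt tm]] := step_path_locate (step_sojourn_path reg) t0.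
    rewrite (sojourn_pathE reg (m := m)) ?mt// => Yk.
    by left; exists m.
  by rewrite sojourn_path_irregular// => ->; right; rewrite eqxx.
- move=> [[m _ [reg [[mt tm] <-]]]|[nreg]]; first by rewrite (sojourn_pathE reg (m := m))// mt.
  by rewrite sojourn_path_irregular//; case: eqP.
Qed.

Variables (Q : E -> E -> R) (P : probability Omega R) (i : E).

(** Almost surely the jump times of the path are the partial sums of the sojourns,
    so that the event on jump times is the event on sojourns. *)
Lemma ctmc_of_sojourns : {ae P, forall w, regular_sojourns w} ->
  (forall n (y : nat -> E) (t : nat -> R), (forall m, 0 <= t m) ->
   P [set w | (forall m, (m < n)%N -> (S m w < +oo)%E) /\
     forall m, (m <= n)%N -> Y m w = y m /\ ((t m)%:E < S m w)%E] =
   ((y 0%N == i)%:R * (\prod_(m < n) jump_prob Q (y m) (y m.+1))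
     * \prod_(m < n.+1) expR (Q (y m) (y m) * t m))%:E) ->
  is_ctmc Q P i X.
Proof.
move=> aereg law; split.
- exact: measurable_sojourn_path.
- exact: sojourn_path_right_continuous.
- move=> n y t t0; rewrite -law//; apply: ae_measure_eq.
  + pose F n := [set w | [/\ (jump_time (X ^~ w) n < +oo)%E,
       forall m, (m <= n)%N -> X (fine (jump_time (X ^~ w) m)) w = y m &
       forall m, (m <= n)%N -> (jump_time (X ^~ w) m + (t m)%:E < jump_time (X ^~ w) m.+1)%E]].
    have mJ m : measurable_fun setT (fun w => jump_time (X ^~ w) m).
      apply: measurable_jump_time; [exact: measurable_sojourn_path|exact: sojourn_path_right_continuous].
    have mX m : discrete_measurable (fun w => X (fine (jump_time (X ^~ w) m)) w).
      apply: measurable_embedded_chain; [exact: measurable_sojourn_path|exact: sojourn_path_right_continuous].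
    rewrite [X in measurable X](_ : _ = [set w | (jump_time (X ^~ w) n < +oo)%E] `&`
      [set w | forall m, (m <= n)%N -> [set w | X (fine (jump_time (X ^~ w) m)) w = y m] w] `&`
      [set w | forall m, (m <= n)%N ->
        [set w | (jump_time (X ^~ w) m + (t m)%:E < jump_time (X ^~ w) m.+1)%E] w]); last first.
      by apply/seteqP; split=> w /=; [case|move=> [[]]].
    apply: measurableI; first apply: measurableI.
    * exact: mlt.
    * by apply: measurable_forall_le => m; exact: mX.
    * apply: measurable_forall_le => m; apply: mlt => //.
      by apply: emeasurable_funD.
  + rewrite [X in measurable X](_ : _ =
      [set w | forall m, (m <= n)%N -> [set w | (m < n)%N -> (S m w < +oo)%E] w] `&`
      [set w | forall m, (m <= n)%N ->
        ([set w | Y m w = y m] `&` [set w | ((t m)%:E < S m w)%E]) w]); last first.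
      apply/seteqP; split=> w /= [h1 h2]; split => // m mn; first by move=> /h1.
      exact: (h1 m (ltnW mn)).
    apply: measurableI; apply: measurable_forall_le => m.
      case: (m < n)%N; last by rewrite [X in measurable X](_ : _ = setT)//; apply/seteqP.
      rewrite [X in measurable X](_ : _ = [set w | (S m w < +oo)%E]); first exact: mlt.
      by apply/seteqP; split => w /=; [apply|].
    by apply: measurableI; [exact: mY|exact: (mlt (measurable_cst (t m)%:E) (mS m))].
  + apply: ae_imply aereg => w reg.
    have step := step_sojourn_path reg.
    have JE m : jump_time (X ^~ w) m = J m w by exact: (step_path_jump_time step m).
    have XJ m : (J m w < +oo)%E -> X (fine (J m w)) w = Y m w by exact: (step_path_val step).
    have J0 m := arrival_ge0 reg m.
    have S0 m : (0 < S m w)%E by case: reg.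
    have sumfin m : (J m w < +oo)%E <-> forall l, (l < m)%N -> (S l w < +oo)%E.
      split=> [fin l lm|fin].
        apply: le_lt_trans fin; apply: le_trans (arrival_nd reg lm).
        by rewrite arrivalS leeDr.
      by rewrite /arrival; apply: lte_sum_pinfty => l _; exact: fin.
    have lt_iff m : (J m w < +oo)%E ->
        (J m w + (t m)%:E < J m.+1 w)%E = ((t m)%:E < S m w)%E.
      by move=> fin; rewrite arrivalS lteD2lE// ge0_fin_numE.
    split.
    * case; rewrite JE => fin h1 h2; split; first exact/sumfin.
      move=> m mn; have finm : (J m w < +oo)%E by apply: le_lt_trans fin; exact: arrival_nd.
      split; first by rewrite -(h1 _ mn) JE XJ.
      by have := h2 _ mn; rewrite !JE lt_iff.
    * case=> /sumfin fin h.
      have finm m : (m <= n)%N -> (J m w < +oo)%E.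
        by move=> mn; apply: le_lt_trans fin; exact: arrival_nd.
      split; first by rewrite JE.
        by move=> m mn; rewrite JE XJ ?finm//; case: (h _ mn).
      by move=> m mn; rewrite !JE lt_iff ?finm//; case: (h _ mn).
- apply: ae_imply aereg => w reg.
  under eq_fun do rewrite (step_path_jump_time (step_sojourn_path reg)).
  exact: arrival_cvgy.
Qed.

End Sojourns.

(** * Independent uniform variables from the holding times *)

Section UniformSeq.
Context {R : realType} {d : measure_display} {Omega : measurableType d}.

Record uniform_seq (P : probability Omega R) (V : nat -> Omega -> R) : Prop :=
  UniformSeq {
  us_meas : forall m, measurable_fun setT (V m);
  us_gt0 : forall m w, 0 < V m w;
  us_lt1 : {ae P, forall w, forall m, V m w < 1};
  us_law : forall n (a b : nat -> R), (forall m, 0 <= a m <= b m) ->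
    (forall m, b m <= 1) ->
    P [set w | forall m, (m <= n)%N -> a m <= V m w /\ V m w < b m] =
    (\prod_(m < n.+1) (b m - a m))%:E }.

(** A box is reached from an orthant one coordinate at a time: bounding one more
    coordinate from below subtracts a set of the same form. *)
Lemma uniform_seq_of_orthants (P : probability Omega R) (V : nat -> Omega -> R) :
  (forall m, measurable_fun setT (V m)) -> (forall m w, 0 < V m w) ->
  {ae P, forall w, forall m, V m w < 1} ->
  (forall n (v : nat -> R), (forall m, 0 <= v m <= 1) ->
    P [set w | forall m, (m <= n)%N -> V m w < v m] =
    (\prod_(m < n.+1) v m)%:E) -> uniform_seq P V.
Proof.
move=> mV V0 V1 orth; split => // n a b ab b1.
have a0 m : 0 <= a m by case/andP: (ab m).
have aleb m : a m <= b m by case/andP: (ab m).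
have a1 m : a m <= 1 by exact: le_trans (aleb m) (b1 m).
have b0 m : 0 <= b m by exact: le_trans (a0 m) (aleb m).
pose F k (v : nat -> R) := [set w | forall m, (m <= n)%N ->
  ((m < k)%N -> a m <= V m w) /\ V m w < v m].
have mF k v : measurable (F k v).
  apply: measurable_forall_le => m; apply: measurableI; last exact: measurable_lt.
  case: (m < k)%N; last by rewrite [X in measurable X](_ : _ = setT)//; apply/seteqP.
  rewrite [X in measurable X](_ : _ = ~` [set w | V m w < a m]).
    by apply: measurableC; exact: measurable_lt.
  by apply/seteqP; split => w /=; rewrite leNgt; [move=> h; apply/negP/h|move=> /negP].
have key k : forall v, (k <= n.+1)%N -> (forall m, 0 <= v m <= 1) ->
    (forall m, (m < k)%N -> v m = b m) ->
    P (F k v) = (\prod_(m < n.+1) (if (m < k)%N then v m - a m else v m))%:E.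
  elim: k => [|k IH] v kn v01 vb.
    rewrite -orth//; congr (P _).
    by apply/seteqP; split => w h m mn; [case: (h m mn)|split => //; exact: h].
  pose v' m := if m == k then a k else v m.
  have v'01 m : 0 <= v' m <= 1.
    by rewrite /v'; case: eqP => // _; rewrite a0 a1.
  have FE : F k.+1 v = F k v `\` F k v'.
    apply/seteqP; split => w /=.
      move=> h; split.
        move=> m mn; have [h1 h2] := h m mn; split => // mk; apply: h1.
        by rewrite ltnS ltnW.
      move=> h'; have [_] := h' k kn; have [+ _] := h k kn.
      by rewrite /v' eqxx leNgt ltnSn => /(_ isT) /negP.
    move=> [h h'] m mn; have [h1 h2] := h m mn; split => //.
    rewrite ltnS leq_eqVlt => /predU1P[->|]; last exact: h1.
    rewrite leNgt; apply/negP => Vk; apply: h' => l ln.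
    have [h3 h4] := h l ln; split => //.
    by rewrite /v'; case: eqP => [->|].
  have sub : F k v' `<=` F k v.
    move=> w h m mn; have [h1 h2] := h m mn; split => //.
    move: h2; rewrite /v'; case: eqP => // -> /lt_le_trans; apply.
    by rewrite vb.
  have dP : P (F k v `\` F k v') = (P (F k v) - P (F k v'))%E.
    rewrite measureD//; first by rewrite setIidr.
    by apply: le_lt_trans (probability_le1 P (mF k v)) _; rewrite ltry.
  rewrite FE dP !IH ?(ltnW kn)//; first last.
  - by move=> m mk; rewrite vb// (ltn_trans mk).
  - by move=> m mk; rewrite /v' ltn_eqF// vb// (ltn_trans mk).
  rewrite -EFinB; congr (_%:E).
  rewrite (bigD1 (Ordinal kn))//= [X in _ - X](bigD1 (Ordinal kn))//=.
  rewrite [RHS](bigD1 (Ordinal kn))//= !ltnn /v' eqxx ltnSn mulrBl.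
  have neq (m : 'I_n.+1) : m != Ordinal kn -> (m == k :> nat) = false.
    by move=> mk; apply/negbTE; rewrite -(inj_eq val_inj) in mk.
  congr (_ - _); congr (_ * _); apply: eq_bigr => m mk;
    by rewrite ltnS [(m <= k)%N]leq_eqVlt (neq _ mk).
rewrite (_ : [set w | _] = F n.+1 b); last first.
  apply/seteqP; split => w h m mn; have [h1 h2] := h m mn; split => //.
  by apply: h1; rewrite ltnS.
rewrite key// => [|m]; last by rewrite b0 b1.
by congr (_%:E); apply: eq_bigr => m _; rewrite ltn_ord.
Qed.

Variables (P : probability Omega R) (q : nat -> R) (Pi : nat -> nat -> R).
Variables (i : nat) (Y : nat -> Omega -> nat) (S : nat -> Omega -> R).
Hypothesis law : jump_hold P q Pi i Y S.
Hypothesis q0 : forall k, 0 < q k.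
Hypothesis Pi0 : forall a b, 0 <= Pi a b.
Hypothesis Pi1 : forall a, (\sum_(b <oo) (Pi a b)%:E = 1)%E.

Definition holding_uniform m w := expR (- (q (Y m w) * S m w)).
Local Notation V := holding_uniform.

Lemma measurable_holding_uniform m : measurable_fun setT (V m).
Proof.
apply: measurableT_comp => //; apply: measurable_funN; apply: measurable_funM.
  by apply: (discrete_measurable_fun q); exact: (jh_state law).
exact: (jh_hold law).
Qed.

(** Given the states, the products q (Y m) * S m are independent standard
    exponential variables whatever the states are; summing over the histories of
    states removes the conditioning. *)
Lemma uniform_seq_holding : uniform_seq P V.
Proof.
apply: uniform_seq_of_orthants.
- exact: measurable_holding_uniform.
- by move=> m w; exact: expR_gt0.
- apply: ae_imply (jh_pos law) => w Spos m.
  by rewrite -[ltRHS]expR0 ltr_expR oppr_lt0 mulr_gt0.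
move=> n v v01.
have v0 m : 0 <= v m by case/andP: (v01 m).
have mev (A : set Omega) : measurable A -> measurable_fun setT (EFin \o (\1_A : Omega -> R)).
  by move=> mA; apply/measurable_EFinP; exact: measurable_indic.
pose B := [set w | forall m, (m <= n)%N -> V m w < v m].
have mB : measurable B.
  apply: measurable_forall_le => m; apply: measurable_lt.
  exact: measurable_holding_uniform.
pose c : \bar R := (\prod_(m < n.+1) v m)%:E.
have c0 : (0 <= c)%E by rewrite lee_fin prodr_ge0.
have iterc m k : iter m (taboo_op Pi predT) (fun=> c) k = c.
  elim: m k => //= m IH k; rewrite (eq_taboo_op _ _ IH) /taboo_op.
  by rewrite nneseriesZr// Pi1 mul1e.
have path_ge0 y m : 0 <= path_prob Pi i y m by rewrite mulr_ge0// prodr_ge0.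
have base (y : nat -> nat) :
    (\int[P]_(w in [set w | forall l, (l <= n)%N -> Y l w = y l]) (\1_B w)%:E =
     (path_prob Pi i y n)%:E * c)%E.
  have my : measurable [set w | forall l, (l <= n)%N -> Y l w = y l].
    by apply: measurable_forall_le => l; exact: (jh_state law).
  rewrite integral_indic// -EFinM.
  have [vpos|] := pselect (forall m, (m <= n)%N -> 0 < v m); last first.
    move=> /existsNP[m /not_implyP[mn /negP]]; rewrite -leNgt => vm.
    have vm0 : v m = 0 by apply/eqP; rewrite eq_le vm v0.
    rewrite (_ : _ `&` _ = set0) ?measure0.
      rewrite -ltnS in mn.
      by rewrite (bigD1 (Ordinal mn))//= vm0 mul0r mulr0.
    apply/seteqP; split => // w [h _]; have := h _ mn.
    by rewrite vm0 ltNge expR_ge0.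
  pose t m := if (m <= n)%N then - ln (v m) / q (y m) else 0.
  have t0 m : 0 <= t m.
    rewrite /t; case: leqP => // mn; rewrite divr_ge0 ?(ltW (q0 _))// oppr_ge0.
    by apply: ln_le0; case/andP: (v01 m).
  have := jh_law law n y t0.
  have -> : \prod_(m < n.+1) expR (- (q (y m) * t m)) = \prod_(m < n.+1) v m.
    apply: eq_bigr => m _; rewrite /t leq_ord mulrCA divff ?gt_eqF// mulr1 opprK.
    by rewrite lnK// posrE vpos// leq_ord.
  move=> <-; congr (P _); apply/seteqP; split => w /=.
    move=> [h1 h2] m mn; split; first exact: h2.
    rewrite /t mn ltr_pdivrMr// -(h2 _ mn) mulrC ltrNl -ltr_expR lnK; first exact: h1.
    by rewrite posrE vpos.
  move=> h; split => m mn; have [h1 h2] := h m mn => //.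
  have : expR (- (q (Y m w) * S m w)) < expR (ln (v m)).
    by rewrite ltr_expR -ltrNl mulrC h1 -ltr_pdivrMr//; move: h2; rewrite /t mn.
  by rewrite lnK ?posrE ?vpos.
have ind0 w : (0 <= (EFin \o (\1_B : Omega -> R)) w)%E by rewrite lee_fin.
have := @integral_taboo_path _ _ _ P Y Pi predT i n (EFin \o (\1_B : Omega -> R)) (fun=> c)
  (jh_state law) Pi0 (mev _ mB) ind0 (fun=> c0) base.
rewrite iterc -/c => <-.
rewrite (_ : [set w | forall l, (0 < l <= n)%N -> predT (Y l w)] = setT); last first.
  exact/seteqP.
by rewrite integral_indic// setIT.
Qed.

End UniformSeq.

(** * A finite chain driven by uniform variables *)

Section FiniteChain.
Context {R : realType} {d : measure_display} {Omega : measurableType d}.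
Variables (P : probability Omega R) (V : nat -> Omega -> R).
Hypothesis hV : uniform_seq P V.
Variables (n : nat) (A : 'M[R]_n.+1) (e0 : 'I_n.+1).
Hypothesis A_off : forall a b, a != b -> 0 <= A a b.
Hypothesis A_sum : forall a, \sum_b A a b = 0.

Let A_diag a : A a a = - \sum_(b | b != a) A a b.
Proof. by have /eqP := A_sum a; rewrite (bigD1 a)//= addr_eq0 => /eqP. Qed.

Let A_diag_le0 a : A a a <= 0.
Proof. by rewrite A_diag oppr_le0 sumr_ge0// => b ba; rewrite A_off// eq_sym. Qed.

Let jp_ge0 a b : 0 <= jump_prob A a b.
Proof.
by rewrite /jump_prob; case: ifPn => // ab; rewrite divr_ge0 ?A_off// oppr_ge0.
Qed.

Let jp_sum a : A a a < 0 -> \sum_b jump_prob A a b = 1.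
Proof.
move=> Aa; rewrite (bigD1 a)//= {1}/jump_prob eqxx add0r.
have Aa0 : - A a a != 0 by rewrite oppr_eq0 lt_eqF.
rewrite -(divff Aa0) [in X in _ = X / _]A_diag opprK mulr_suml.
by apply: eq_bigr => b ba; rewrite /jump_prob eq_sym (negbTE ba).
Qed.

Definition cumul (a : 'I_n.+1) (b : nat) : R :=
  \sum_(k < n.+1 | (k < b)%N) jump_prob A a k.

Lemma cumul0 a : cumul a 0 = 0.
Proof. by rewrite /cumul big_pred0. Qed.

Lemma cumulS a (b : 'I_n.+1) : cumul a b.+1 = cumul a b + jump_prob A a b.
Proof.
rewrite /cumul (bigD1 b)//= addrC; congr (_ + _); apply: eq_bigl => k.
by rewrite ltnS -(inj_eq val_inj) /= ltn_neqAle andbC.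
Qed.

Lemma cumul_nd a : {homo cumul a : b c / (b <= c)%N >-> b <= c}.
Proof.
move=> b c bc; rewrite /cumul [leLHS]big_mkcond [leRHS]big_mkcond.
apply: ler_sum => k _; case: ifP => [kb|_].
  by rewrite (leq_trans kb bc).
by case: ifP.
Qed.

Lemma cumul_ge0 a b : 0 <= cumul a b.
Proof. by rewrite sumr_ge0. Qed.

Lemma cumul_last a : A a a < 0 -> cumul a n.+1 = 1.
Proof. by move=> Aa; rewrite -(jp_sum Aa); apply: eq_bigl => k; rewrite ltn_ord. Qed.

Lemma cumul_le1 a b : A a a < 0 -> cumul a b <= 1.
Proof.
move=> Aa; rewrite -(cumul_last Aa) /cumul [leRHS](eq_bigl xpredT); last first.
  by move=> k; rewrite ltn_ord.
by rewrite [leLHS]big_mkcond; apply: ler_sum => k _; case: ifP.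
Qed.

Lemma find_iotaP (p : pred nat) N f : (f <= N)%N ->
  (find p (iota 0 N) == f) = [forall b : 'I_f, ~~ p b] && ((f < N)%N ==> p f).
Proof.
move=> fN; apply/eqP/andP.
  move=> <-; split.
    apply/forallP => b; apply/negbT; have := before_find 0%N (ltn_ord b).
    rewrite nth_iota ?add0n//; apply: leq_trans (ltn_ord b) _.
    by rewrite -[leqRHS](size_iota 0) find_size.
  apply/implyP => fN'; have : has p (iota 0 N) by rewrite has_find size_iota.
  by move=> /(nth_find 0%N); rewrite nth_iota.
move=> [/forallP h1 /implyP h2]; case: (ltngtP (find p (iota 0 N)) f) => // h.
- have : has p (iota 0 N) by rewrite has_find size_iota (leq_trans h).
  move=> /(nth_find 0%N); rewrite nth_iota ?add0n; last exact: leq_trans h fN.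
  by move=> pf; have := h1 (Ordinal h); rewrite pf.
- have fN' : (f < N)%N by rewrite (leq_trans h)// -[leqRHS](size_iota 0) find_size.
  by have := before_find 0%N h; rewrite nth_iota// add0n h2.
Qed.

(** Inverse of the cumulative distribution of the jump out of a. Only the first n
    states are searched, so that the last one is the default. *)
Definition select (a : 'I_n.+1) (v : R) : 'I_n.+1 :=
  inord (find (fun b => v < cumul a b.+1) (iota 0 n)).

Lemma select_eq a v (b : 'I_n.+1) : (select a v == b) =
  [forall c : 'I_b, ~~ (v < cumul a c.+1)] && ((b < n)%N ==> (v < cumul a b.+1)).
Proof.
rewrite /select -(find_iotaP (fun b => v < cumul a b.+1)) ?leq_ord//.
rewrite -(inj_eq val_inj) /= inordK// ltnS -[leqRHS](size_iota 0).
exact: find_size.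
Qed.

Lemma selectP a v (b : 'I_n.+1) : A a a < 0 -> 0 <= v < 1 ->
  select a v = b <-> cumul a b <= v /\ v < cumul a b.+1.
Proof.
move=> Aa /andP[v0 v1].
have h : (select a v == b) = (cumul a b <= v) && (v < cumul a b.+1).
  rewrite select_eq; apply/andP/andP => -[].
  - move=> /forallP h1 /implyP h2; split.
      case: (nat_of_ord b) h1 => [|b'] h1; first by rewrite cumul0.
      by rewrite leNgt; exact: (h1 ord_max).
    have [bn|nb] := ltnP b n; first exact: h2.
    have -> : b = n :> nat by apply/eqP; rewrite eqn_leq nb leq_ord.
    by rewrite cumul_last.
  - move=> h1 h2; split; last by rewrite h2 implybT.
    by apply/forallP => c; rewrite -leNgt (le_trans _ h1)// cumul_nd.
split; first by move/eqP; rewrite h => /andP.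
by move=> /andP; rewrite -h => /eqP.
Qed.

Lemma select_neq a v : A a a < 0 -> 0 <= v < 1 -> select a v <> a.
Proof.
move=> Aa v01 /(selectP _ Aa v01); rewrite cumulS /jump_prob eqxx addr0 => -[h1 h2].
by have := le_lt_trans h1 h2; rewrite ltxx.
Qed.

(** Even variables choose the jumps, odd ones the holding times. *)
Fixpoint drive_state (m : nat) (w : Omega) : 'I_n.+1 :=
  if m is l.+1 then select (drive_state l w) (V l.*2 w) else e0.

Definition drive_hold (m : nat) (w : Omega) : \bar R :=
  let a := drive_state m w in
  if A a a == 0 then +oo%E else (- ln (V m.*2.+1 w) / - A a a)%:E.

Local Notation Y := drive_state.
Local Notation S := drive_hold.

Lemma measurable_drive_state m : discrete_measurable (Y m).
Proof.
elim: m => [|m IH] k.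
  have [<-|ek] := eqVneq e0 k; first by rewrite [X in measurable X](_ : _ = setT)//; apply/seteqP.
  rewrite [X in measurable X](_ : _ = set0)//; apply/seteqP; split => // w /= h.
  by move: ek; rewrite h eqxx.
rewrite [X in measurable X](_ : _ =
  \bigcup_a ([set w | Y m w = a] `&` [set w | select a (V m.*2 w) = k])); last first.
  by apply/seteqP; split => w /=; [move=> h; exists (Y m w)|move=> [a _ [<-]]].
apply: bigcup_count_measurable => a; apply: measurableI; first exact: IH.
rewrite [X in measurable X](_ : _ = [set w | forall c, (c <= n)%N ->
    [set w | (c < k)%N -> ~ (V m.*2 w < cumul a c.+1)] w] `&`
    [set w | (k < n)%N -> V m.*2 w < cumul a k.+1]).
  have mc c : measurable [set w | V m.*2 w < cumul a c.+1].
    by apply: measurable_lt; exact: (us_meas hV).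
  apply: measurableI.
    apply: measurable_forall_le => c; case: (c < k)%N; last first.
      by rewrite [X in measurable X](_ : _ = setT)//; apply/seteqP.
    rewrite [X in measurable X](_ : _ = ~` [set w | V m.*2 w < cumul a c.+1]).
      exact: measurableC.
    by apply/seteqP; split => w /=; [apply|].
  case: (k < n)%N; last by rewrite [X in measurable X](_ : _ = setT)//; apply/seteqP.
  rewrite [X in measurable X](_ : _ = [set w | V m.*2 w < cumul a k.+1])//.
  by apply/seteqP; split => w /=; [apply|].
apply/seteqP; split => w /=.
  move=> /eqP; rewrite select_eq => /andP[/forallP h1 /implyP h2]; split => //.
  by move=> c _ ck; apply/negP; exact: (h1 (Ordinal ck)).
move=> [h1 h2]; apply/eqP; rewrite select_eq; apply/andP; split; last exact/implyP.
apply/forallP => c; apply/negP; apply: h1 => //.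
by apply: leq_trans (ltnW (ltn_ord c)) _; exact: leq_ord.
Qed.

Lemma measurable_drive_hold m : measurable_fun setT (S m).
Proof.
rewrite (_ : S m = (fun w => if A (Y m w) (Y m w) == 0 then +oo%E
   else (- ln (V m.*2.+1 w) / - A (Y m w) (Y m w))%:E))//.
apply: measurable_fun_ifT => //=.
- apply: (discrete_measurable_fun (fun a => A a a == 0)).
  exact: measurable_drive_state.
- apply/measurable_EFinP; apply: measurable_funM.
    apply: measurable_funN; apply: measurableT_comp; first exact: measurable_ln.
    exact: (us_meas hV).
  apply: (discrete_measurable_fun (fun a => (- A a a)^-1)).
  exact: measurable_drive_state.
Qed.

Lemma prod_double (f : nat -> R) N :
  \prod_(l < N.*2) f l = \prod_(m < N) f m.*2 * \prod_(m < N) f m.*2.+1.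
Proof.
elim: N => [|N IH]; first by rewrite !big_ord0 mulr1.
by rewrite doubleS !big_ord_recr /= IH -!mulrA; congr (_ * _); rewrite mulrCA.
Qed.

Lemma drive_hold_gt a (t v : R) : A a a < 0 -> 0 < v ->
  (t < - ln v / - A a a) = (v < expR (A a a * t)).
Proof.
move=> Aa v0; rewrite ltr_pdivlMr ?oppr_gt0// mulrN ltrN2 mulrC.
by rewrite -[in RHS](@lnK _ v) ?posrE// ltr_expR.
Qed.

(** The event is a box for the uniform variables: an even variable selects y m.+1
    on an interval whose length is the jump probability, and an odd one gives a
    holding time above t m when it is below the exponential weight. *)
Lemma drive_law N (y : nat -> 'I_n.+1) (t : nat -> R) : (forall m, 0 <= t m) ->
  (forall m, (m < N)%N -> A (y m) (y m) < 0) ->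
  P [set w | forall m, (m <= N)%N -> Y m w = y m /\ ((t m)%:E < S m w)%E] =
  ((y 0%N == e0)%:R * (\prod_(m < N) jump_prob A (y m) (y m.+1))
     * \prod_(m < N.+1) expR (A (y m) (y m) * t m))%:E.
Proof.
move=> t0 Ay; have [y0|y0] := eqVneq (y 0%N) e0; last first.
  rewrite !mul0r (_ : [set w | _] = set0) ?measure0//.
  apply/seteqP; split => // w h; have [] := h 0%N (leq0n N) => /= h' _.
  by move: y0; rewrite -h' eqxx.
rewrite mul1r.
(* The box. The variable of index N.*2 chooses the state after the last one that is
   prescribed, and is left free. *)
pose lo l := if odd l then 0 else
  if (l./2 < N)%N then cumul (y l./2) (y l./2.+1) else 0.
pose hi l := if odd l then expR (A (y l./2) (y l./2) * t l./2) else
  if (l./2 < N)%N then cumul (y l./2) (y l./2.+1).+1 else 1.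
have lohi l : 0 <= lo l <= hi l.
  rewrite /lo /hi; case: ifP => _; first by rewrite lexx expR_ge0.
  by case: ifP => _; rewrite ?cumul_ge0 ?cumul_nd// lexx ler01.
have hi1 l : hi l <= 1.
  rewrite /hi; case: ifP => _.
    by rewrite -[leRHS]expR0 ler_expR mulr_le0_ge0.
  by case: ifP => // lN; apply: cumul_le1; exact: Ay.
have := us_law hV N.*2.+1 lohi hi1; rewrite -doubleS (prod_double (fun l => hi l - lo l)).
have -> : \prod_(m < N.+1) (hi m.*2 - lo m.*2) = \prod_(m < N) jump_prob A (y m) (y m.+1).
  rewrite big_ord_recr /= /hi /lo odd_double doubleK ltnn subr0 mulr1.
  apply: eq_bigr => m _; rewrite odd_double doubleK ltn_ord cumulS.
  by rewrite addrAC subrr add0r.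
have -> : \prod_(m < N.+1) (hi m.*2.+1 - lo m.*2.+1) =
    \prod_(m < N.+1) expR (A (y m) (y m) * t m).
  apply: eq_bigr => m _; rewrite /hi /lo /= odd_double /= subr0.
  by rewrite uphalf_double.
move=> <-; apply: ae_measure_eq.
- apply: measurable_forall_le => m; apply: measurableI; first exact: measurable_drive_state.
  rewrite -[X in measurable X]setTI; apply: measurable_lte => //.
  exact: measurable_drive_hold.
- apply: measurable_forall_le => m; apply: measurableI; last first.
    by apply: measurable_lt; exact: (us_meas hV).
  rewrite [X in measurable X](_ : _ = ~` [set w | V m w < lo m]).
    by apply: measurableC; apply: measurable_lt; exact: (us_meas hV).
  by apply/seteqP; split => w /=; rewrite leNgt => /negP.
apply: ae_imply (us_lt1 hV) => w V1.
have V01 l : 0 <= V l w < 1 by rewrite V1 andbT ltW// (us_gt0 hV).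
have holdE m : Y m w = y m -> (((t m)%:E < S m w)%E <-> V m.*2.+1 w < hi m.*2.+1).
  move=> Ym; rewrite /S Ym /hi /= odd_double /= uphalf_double; case: eqP => [->|/eqP Am].
    by rewrite mul0r expR0 ltry.
  have Am0 : A (y m) (y m) < 0 by rewrite lt_neqAle Am A_diag_le0.
  by rewrite lte_fin drive_hold_gt// (us_gt0 hV).
have jumpE m : (m < N)%N -> Y m w = y m ->
    (Y m.+1 w = y m.+1 <-> lo m.*2 <= V m.*2 w /\ V m.*2 w < hi m.*2).
  move=> mN Ym; rewrite /= Ym /lo /hi odd_double doubleK mN.
  by apply: selectP => //; exact: Ay.
split.
- move=> h l lN; have lN' : (l./2 <= N)%N.
    by have := half_leq lN; rewrite /= uphalf_double.
  have [odl|evl] := boolP (odd l).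
    have lE : l = l./2.*2.+1 by rewrite -[LHS]odd_double_half odl.
    have [hY hS] := h _ lN'; split; first by rewrite /lo odl; exact/ltW/(us_gt0 hV).
    by rewrite lE; apply/holdE.
  have lE : l = l./2.*2 by rewrite -[LHS]odd_double_half (negbTE evl).
  have [hY hS] := h _ lN'; have [lN2|Nl] := ltnP l./2 N.
    by rewrite lE; apply/(jumpE _ lN2 hY); case: (h _ lN2).
  rewrite /lo /hi (negbTE evl) [(l./2 < N)%N]ltnNge Nl /=.
  by case/andP: (V01 l).
- move=> h; have hY m : (m <= N)%N -> Y m w = y m.
    elim: m => [_|m IH mN]; first by rewrite /= y0.
    apply/(jumpE _ mN (IH (ltnW mN))); apply: h.
    by rewrite (leq_trans _ (leqnSn _))// leq_double ltnW.
  move=> m mN; split; first exact: hY.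
  apply/(holdE _ (hY _ mN)); have [] := h m.*2.+1; last by [].
  by rewrite ltnS leq_double.
Qed.

(** N odd variables all exceed 1/2 with probability 2^-N. Infinitely many of them
    are thus below 1/2, which rules out explosion in regular_drive. *)
Lemma uniform_small_often :
  {ae P, forall w, forall k, exists2 m, (k <= m)%N & V m.*2.+1 w < 2^-1}.
Proof.
apply: ae_count => k.
pose lo l : R := if odd l && (k <= l./2)%N then 2^-1 else 0.
have half1 : (2^-1 : R) <= 1 by rewrite invf_le1// ler1n.
have lohi l : 0 <= lo l <= 1.
  by rewrite /lo; case: ifP; rewrite ?lexx ?ler01 ?invr_ge0 ?ler0n ?half1.
pose F N := [set w | forall l, (l <= (k + N).*2.+1)%N -> lo l <= V l w /\ V l w < 1].
have mF N : measurable (F N).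
  apply: measurable_forall_le => m; apply: measurableI; last first.
    by apply: measurable_lt; exact: (us_meas hV).
  rewrite [X in measurable X](_ : _ = ~` [set w | V m w < lo m]).
    by apply: measurableC; apply: measurable_lt; exact: (us_meas hV).
  by apply/seteqP; split => w /=; rewrite leNgt => /negP.
have PF N : P (F N) = ((2^-1) ^+ N.+1)%:E.
  rewrite (@us_law _ _ _ _ _ hV _ lo (fun=> 1) lohi (fun=> lexx 1)).
  congr (_%:E); rewrite -doubleS (prod_double (fun l => 1 - lo l)).
  rewrite big1 ?mul1r; last by move=> m _; rewrite /lo odd_double subr0.
  have loE m : 1 - lo m.*2.+1 = if (k <= m)%N then 2^-1 else 1.
    rewrite /lo /= odd_double /= uphalf_double; case: ifP => _; last by rewrite subr0.
    lra.
  under eq_bigr do rewrite loE.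
  elim: N {mF} => [|N IH].
    rewrite addn0 big_ord_recr /= leqnn big1 ?mul1r ?expr1// => m _.
    by rewrite leqNgt ltn_ord.
  by rewrite addnS big_ord_recr /= IH -addnS leq_addr [in RHS]exprSr.
have null : P (\bigcap_N F N) = 0%E.
  apply/eqP; rewrite eq_le measure_ge0 andbT.
  have lim : ((2^-1 : R) ^+ N.+1)%:E @[N --> \oo] --> 0%E.
    apply: cvg_EFin; first exact: nearW.
    rewrite (cvg_shiftS (fun N => (2^-1 : R) ^+ N)).
    by apply: cvg_expr; rewrite ger0_norm ?invr_ge0// invf_lt1// ltr1n.
  apply: (cvge_ge _ lim); apply: nearW => N; rewrite -PF.
  by apply: le_measure; rewrite ?inE//; [exact: bigcapT_measurable|exact: bigcap_inf].
have nullset : P.-negligible (\bigcap_N F N).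
  by exists (\bigcap_N F N); split => //; exact: bigcapT_measurable.
have {nullset}: {ae P, forall w, ~ (\bigcap_N F N) w}.
  by apply: negligibleS nullset => w /contrapT.
move=> aeF; apply: ae_imply (ae_and aeF (us_lt1 hV)) => w [nF V1].
apply: contrapT => no; apply: nF => N _ l _; split => //.
rewrite /lo; case: ifP => [/andP[odl kl]|_]; last exact/ltW/(us_gt0 hV).
rewrite leNgt; apply/negP => Vl; apply: no; exists l./2 => //.
by rewrite -(_ : l = l./2.*2.+1)// -[LHS]odd_double_half odl.
Qed.

Lemma regular_drive : {ae P, forall w, regular_sojourns Y S w}.
Proof.
apply: ae_imply (ae_and (us_lt1 hV) uniform_small_often) => w [V1 often].
have V01 l : 0 <= V l w < 1 by rewrite V1 andbT ltW// (us_gt0 hV).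
have Aneg a : A a a != 0 -> A a a < 0 by move=> h; rewrite lt_neqAle h A_diag_le0.
(* The rates are bounded by qm, so that an odd variable below 1/2 yields a holding
   time of at least ln 2 / qm. *)
pose qm : R := 1 + \sum_a - A a a.
have qm_ge a : - A a a <= qm.
  rewrite /qm (bigD1 a)//= addrCA lerDl addr_ge0// sumr_ge0// => b _.
  by rewrite oppr_ge0.
have qm0 : 0 < qm by rewrite ltr_pwDl// sumr_ge0// => b _; rewrite oppr_ge0.
have Spos m : (0 < S m w)%E.
  rewrite /S; case: eqP => [_|/eqP /Aneg Am]; first by rewrite ltry.
  rewrite lte_fin divr_gt0 ?oppr_gt0//.
  by rewrite ln_lt0// V1 (us_gt0 hV).
split => //.
- move=> m; rewrite /S; case: eqP => [_|/eqP /Aneg Am _]; first by rewrite ltxx.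
  exact: select_neq.
- pose c : R := ln 2 / qm.
  have c0 : 0 < c by rewrite divr_gt0// ln_gt0// ltr1n.
  have Sc m : V m.*2.+1 w < 2^-1 -> (c%:E <= S m w)%E.
    move=> Vm; rewrite /S; case: eqP => [_|/eqP /Aneg Am]; first by rewrite leey.
    have lnV : ln 2 <= - ln (V m.*2.+1 w).
      rewrite lerNr -lnV ?posrE//; apply: ltW; rewrite ltr_ln ?posrE ?invr_gt0//.
      exact: (us_gt0 hV).
    rewrite lee_fin /c; apply: ler_pM => //.
    + by rewrite ln_ge0// ler1n.
    + by rewrite invr_ge0 ltW.
    + by rewrite lef_pV2 ?posrE ?oppr_gt0.
  have step N : exists m, ((c *+ N)%:E <= arrival S m w)%E.
    elim: N => [|N [m hm]]; first by exists 0%N; rewrite /arrival big_ord0.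
    have [m' mm' Vm'] := often m; exists m'.+1.
    rewrite arrivalS mulrSr EFinD; apply: leeD; last exact: Sc.
    apply: le_trans hm _; rewrite /arrival.
    rewrite -!(big_mkord xpredT (fun l => S l w)) [leRHS](@big_cat_nat _ _ _ m)//=.
    by rewrite leeDl// sume_ge0// => l _; exact: ltW.
  move=> K; have [m hm] := step (Num.truncn (K%:R / c)).+1; exists m.
  apply: lt_le_trans hm; rewrite lte_fin -[ltRHS]mulr_natl -ltr_pdivrMr//.
  exact: truncnS_gt.
Qed.

End FiniteChain.

(** * Truncated chains coupled to the original chain *)

Section DiscreteSelection.
Context {R : realType} {d : measure_display} {Omega : measurableType d}.

Lemma discrete_measurable_pair (E F : countType) (f : Omega -> E) (g : Omega -> F) :
  discrete_measurable f -> discrete_measurable g ->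
  discrete_measurable (fun w => (f w, g w)).
Proof.
move=> mf mg [a b]; rewrite [X in measurable X](_ : _ =
  [set w | f w = a] `&` [set w | g w = b]); first exact: measurableI.
by apply/seteqP; split=> w /=; [move=> []|move=> [-> ->]].
Qed.

Lemma discrete_measurable_comp (E F : countType) (f : Omega -> E) (G : E -> F) :
  discrete_measurable f -> discrete_measurable (fun w => G (f w)).
Proof. by move=> mf k; exact: (discrete_measurable_pred (fun e => G e = k)). Qed.

Lemma measurable_fun_select (T : countType) (D : Omega -> T) d' (U : measurableType d')
    (f : T -> Omega -> U) : discrete_measurable D ->
  (forall t, measurable_fun setT (f t)) -> measurable_fun setT (fun w => f (D w) w).
Proof.
move=> mD mf _ B mB; rewrite setTI.
rewrite [X in measurable X](_ : _ = \bigcup_t ([set w | D w = t] `&` (f t @^-1` B))).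
  apply: bigcup_count_measurable => t; apply: measurableI; first exact: mD.
  by rewrite -[X in measurable X]setTI; exact: mf.
by apply/seteqP; split=> w /=; [move=> h; exists (D w)|move=> [t _ [<-]]].
Qed.

Lemma discrete_measurable_select (T E : countType) (D : Omega -> T)
    (f : T -> Omega -> E) : discrete_measurable D ->
  (forall t, discrete_measurable (f t)) -> discrete_measurable (fun w => f (D w) w).
Proof.
move=> mD mf k.
rewrite [X in measurable X](_ : _ = \bigcup_t ([set w | D w = t] `&` [set w | f t w = k])).
  by apply: bigcup_count_measurable => t; apply: measurableI; [exact: mD|exact: mf].
by apply/seteqP; split=> w /=; [move=> h; exists (D w)|move=> [t _ [<-]]].
Qed.

End DiscreteSelection.

Section Coupling.
Context {R : realType}.
Variables (d1 d2 : measure_display).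
Variables (Omega1 : measurableType d1) (Omega2 : measurableType d2).
Variables (j n : nat).
Variables (Y : nat -> Omega1 -> nat) (S : nat -> Omega1 -> R).
Variables (Y2 : nat -> Omega2 -> 'I_n.+1) (S2 : nat -> Omega2 -> \bar R).

Definition live (k : nat) := (k != j) && (k <= n)%N.

(** None while the first chain has stayed among the live states, afterwards the
    number of steps made by the second chain. *)
Fixpoint age (m : nat) (w : Omega1) : option nat :=
  if m is l.+1 then
    if age l w is Some k then Some k.+1 else if live (Y m w) then None else Some 0%N
  else if live (Y 0%N w) then None else Some 0%N.

Definition spliced_state (m : nat) (w : Omega1 * Omega2) : 'I_n.+1 :=
  if age m w.1 is Some k then Y2 k w.2 else inord (Y m w.1).

Definition spliced_hold (m : nat) (w : Omega1 * Omega2) : \bar R :=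
  if age m w.1 is Some k then S2 k w.2 else (S m w.1)%:E.

Lemma age_none m w : age m w = None <-> forall l, (l <= m)%N -> live (Y l w).
Proof.
elim: m => [|m IH] /=.
  split; last by move=> /(_ 0%N isT) ->.
  by case: ifP => // h _ l; rewrite leqn0 => /eqP ->.
case: (age m w) IH => [k|] IH; split => //.
- move=> h; suff : Some k = None :> option nat by [].
  by apply/IH => l lm; apply: h; exact: leqW.
- case: ifP => // lv _ l; rewrite leq_eqVlt => /predU1P[->//|].
  by rewrite ltnS => lm; exact: (IH.1 erefl).
- by move=> /(_ m.+1 (leqnn _)) ->.
Qed.

Lemma age_some k w : (forall l, (l < k)%N -> live (Y l w)) -> ~~ live (Y k w) ->
  forall l, age (k + l) w = Some l.
Proof.
move=> before now; elim=> [|l IH]; last by rewrite addnS /= IH.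
rewrite addn0; case: k before now => [|k] before now /=; first by rewrite (negbTE now).
have /age_none -> : forall l, (l <= k)%N -> live (Y l w) by move=> l lk; exact: before.
by rewrite (negbTE now).
Qed.

Lemma age_cases w : (forall l, live (Y l w)) \/
  exists k, (forall l, (l < k)%N -> live (Y l w)) /\ ~~ live (Y k w).
Proof.
have [h|/existsNP[k /negP nk]] := pselect (forall l, live (Y l w)); first by left.
right; have ex : exists k, ~~ live (Y k w) by exists k.
case: (ex_minnP ex) => m nm mmin; exists m; split => // l lm.
by apply/negPn/negP => /mmin; rewrite leqNgt lm.
Qed.

Section Measurability.
Hypothesis mY : forall m, discrete_measurable (Y m).
Hypothesis mS : forall m, measurable_fun setT (S m).
Hypothesis mY2 : forall m, discrete_measurable (Y2 m).
Hypothesis mS2 : forall m, measurable_fun setT (S2 m).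

Lemma measurable_age m : discrete_measurable (age m).
Proof.
elim: m => [|m IH].
  exact: (discrete_measurable_comp (fun k => if live k then None else Some 0%N) (mY 0%N)).
exact: (discrete_measurable_comp (fun p => if p.1 is Some k then Some k.+1
  else if live p.2 then None else Some 0%N)
  (discrete_measurable_pair IH (mY m.+1))).
Qed.

Lemma discrete_measurable_fst (E : countType) (f : Omega1 -> E) :
  discrete_measurable f -> discrete_measurable (fun w : Omega1 * Omega2 => f w.1).
Proof.
move=> mf k; rewrite -[X in measurable X]setTI.
have mfst : measurable_fun [set: Omega1 * Omega2] fst := measurable_fst.
exact: (mfst measurableT _ (mf k)).
Qed.

Lemma discrete_measurable_snd (E : countType) (f : Omega2 -> E) :
  discrete_measurable f -> discrete_measurable (fun w : Omega1 * Omega2 => f w.2).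
Proof.
move=> mf k; rewrite -[X in measurable X]setTI.
have msnd : measurable_fun [set: Omega1 * Omega2] snd := measurable_snd.
exact: (msnd measurableT _ (mf k)).
Qed.

Lemma measurable_spliced_state m : discrete_measurable (spliced_state m).
Proof.
apply: (@discrete_measurable_select _ _ _ _ (fun w : Omega1 * Omega2 => age m w.1)
  (fun o w => if o is Some k then Y2 k w.2 else inord (Y m w.1))).
  by apply: discrete_measurable_fst; exact: measurable_age.
move=> [k|]; first exact: discrete_measurable_snd.
apply: (@discrete_measurable_fst _ (fun w => inord (Y m w) : 'I_n.+1)).
exact: (discrete_measurable_comp (fun k => inord k : 'I_n.+1)).
Qed.

Lemma measurable_spliced_hold m : measurable_fun setT (spliced_hold m).
Proof.
apply: (@measurable_fun_select _ _ _ (fun w : Omega1 * Omega2 => age m w.1) _ _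
  (fun o w => if o is Some k then S2 k w.2 else (S m w.1)%:E)).
  by apply: discrete_measurable_fst; exact: measurable_age.
move=> [k|]; first by apply: measurableT_comp => //; exact: measurable_snd.
have mf : measurable_fun setT (fun w : Omega1 * Omega2 => S m w.1).
  by apply: (measurableT_comp (mS m)); exact: measurable_fst.
by apply/measurable_EFinP.
Qed.

End Measurability.

Variable Q : nat -> nat -> R.
Hypothesis hQ : conservative_qmatrix Q.
Hypothesis Qneg : forall a, Q a a < 0.
Hypothesis jn : (j <= n)%N.
Local Notation Qt := (Qtilde Q j n).
Local Notation Pi := (jump_prob Q).

Variables (P1 : probability Omega1 R) (P2 : probability Omega2 R) (i : nat).
Hypothesis i_n : (i <= n)%N.
Hypothesis law1 : jump_hold P1 (fun k => - Q k k) Pi i Y S.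
Hypothesis mY2 : forall m, discrete_measurable (Y2 m).
Hypothesis mS2 : forall m, measurable_fun setT (S2 m).
Hypothesis Y20 : forall w, Y2 0%N w = inord j.
Hypothesis S2_fin : forall m w, (S2 m w < +oo)%E = (Qt (Y2 m w) (Y2 m w) != 0).
Hypothesis law2 : forall N (y : nat -> 'I_n.+1) (t : nat -> R), (forall m, 0 <= t m) ->
  (forall m, (m < N)%N -> Qt (y m) (y m) < 0) ->
  P2 [set w | forall m, (m <= N)%N -> Y2 m w = y m /\ ((t m)%:E < S2 m w)%E] =
  ((y 0%N == inord j)%:R * (\prod_(m < N) jump_prob Qt (y m) (y m.+1))
     * \prod_(m < N.+1) expR (Qt (y m) (y m) * t m))%:E.

Lemma jump_prob_Qtilde_offj (a b : 'I_n.+1) : a != j :> nat -> b != j :> nat ->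
  jump_prob Qt a b = Pi a b.
Proof.
by move=> aj bj; rewrite /jump_prob !Qtilde_offj// (inj_eq val_inj).
Qed.

(** The augmented rate into j is whatever the other live states leave over. *)
Lemma jump_prob_Qtilde_j (a : 'I_n.+1) : a != j :> nat ->
  jump_prob Qt a (inord j) = 1 - \sum_(b < n.+1 | b != j :> nat) Pi a b.
Proof.
move=> aj; have ja : (a == inord j) = false.
  by apply/negP => /eqP h; move: aj; rewrite h inordK// eqxx.
have Qa : - Q a a != 0 by rewrite oppr_eq0 lt_eqF.
rewrite {1}/jump_prob ja [Qt a a]Qtilde_offj// QtildeE// inordK// eqxx.
apply: (mulIf Qa); rewrite divfK// mulrBl mul1r mulr_suml.
have -> : \sum_(b < n.+1 | b != j :> nat) Pi a b * - Q a a =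
    \sum_(b < n.+1 | (b != j :> nat) && (b != a)) Q a b.
  rewrite [RHS]big_mkcondr; apply: eq_bigr => b _; rewrite /jump_prob.
  rewrite (inj_eq val_inj) eq_sym; case: eqP => //= _; first by rewrite mul0r.
  by rewrite divfK.
rewrite (bigD1 (inord j : 'I_n.+1))//= inordK// (bigD1 a) ?ja//=.
rewrite (eq_bigl (fun b : 'I_n.+1 => (b != j :> nat) && (b != a))); first by rewrite !opprD; ring.
by move=> b; congr (_ && _); rewrite -(inj_eq val_inj) /= inordK.
Qed.

Section Prefix.
Variables (y : nat -> nat) (t : nat -> R) (k : nat).
Hypothesis t0 : forall m, 0 <= t m.

Let B := [set w | forall m, (m < k)%N -> Y m w = y m /\ t m < S m w].
Let C : R := \prod_(m < k) expR (- (- Q (y m) (y m) * t m)).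
Let step (b : nat) : R := if k is l.+1 then path_prob Pi i y l * Pi (y l) b else (b == i)%:R.

Let mB : measurable B.
Proof.
rewrite [X in measurable X](_ : _ = [set w | forall m, (m <= k)%N ->
   [set w | (m < k)%N -> Y m w = y m /\ t m < S m w] w]); last first.
  by apply/seteqP; split => w /= h m; [move=> _; exact: h|move=> mk; apply: h (ltnW mk) mk].
apply: measurable_forall_le => m; case: (m < k)%N; last first.
  by rewrite [X in measurable X](_ : _ = setT)//; apply/seteqP.
rewrite [X in measurable X](_ : _ = [set w | Y m w = y m] `&` [set w | t m < S m w]).
  by apply: measurableI; [exact: (jh_state law1)|apply: measurable_gt; exact: (jh_hold law1)].
by apply/seteqP; split => w /=; [apply|].
Qed.

Let prefix_law b : P1 (B `&` [set w | Y k w = b]) = (step b * C)%:E.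
Proof.
pose y' m := if m == k then b else y m.
pose t' m : R := if m == k then 0 else t m.
have t'0 m : 0 <= t' m by rewrite /t'; case: ifP.
have yl m : (m < k)%N -> y' m = y m by move=> mk; rewrite /y' ltn_eqF.
have tl m : (m < k)%N -> t' m = t m by move=> mk; rewrite /t' ltn_eqF.
have yk : y' k = b by rewrite /y' eqxx.
have tk : t' k = 0 by rewrite /t' eqxx.
transitivity (path_prob Pi i y' k * \prod_(m < k.+1) expR (- (- Q (y' m) (y' m) * t' m)))%:E.
  rewrite -(jh_law law1)//; apply: ae_measure_eq.
  - by apply: measurableI => //; exact: (jh_state law1).
  - apply: measurable_forall_le => m; apply: measurableI; first exact: (jh_state law1).
    by apply: measurable_gt; exact: (jh_hold law1).
  - apply: ae_imply (jh_pos law1) => w Spos; split.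
      move=> [h hk] m; rewrite leq_eqVlt => /predU1P[->|mk]; first by rewrite yk tk.
      by rewrite yl// tl//; exact: h.
    move=> h; split; last by have [] := h k (leqnn k); rewrite yk.
    by move=> m mk; rewrite -yl// -tl//; exact/h/ltnW.
congr (_%:E); rewrite big_ord_recr /= tk mulr0 oppr0 expR0 mulr1; congr (_ * _); last first.
  by apply: eq_bigr => m _; rewrite yl// tl.
rewrite /step; case: k yl yk {tl tk} => [|l] yl yk; first by rewrite /path_prob yk big_ord0 mulr1.
rewrite /path_prob big_ord_recr /= yk (yl l (ltnSn l)) mulrA (yl 0%N (ltn0Sn l)); congr (_ * _ * _).
by apply: eq_bigr => m _; rewrite (yl m (leqW (ltn_ord m))) (yl m.+1 (ltn_ord m)).
Qed.

Let prefix_total : P1 B = ((if k is l.+1 then path_prob Pi i y l else 1) * C)%:E.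
Proof.
rewrite /B /C; case: k => [|l].
  rewrite big_ord0 mulr1 (_ : [set w | _] = setT); first exact: probability_setT.
  by apply/seteqP.
by rewrite -(jh_law law1).
Qed.

(** The probability of dying at step k is what the live continuations of the
    prefix leave over, and the augmentation sends this mass to j. *)
Lemma death_law : (forall m, (m < k)%N -> live (y m)) ->
  P1 (B `&` [set w | ~~ live (Y k w)]) =
  ((if k is l.+1 then path_prob Pi i y l * jump_prob Qt (inord (y l)) (inord j)
    else (i == j)%:R) * C)%:E.
Proof.
move=> ylive.
pose F b := if live b then B `&` [set w | Y k w = b] else set0.
have mF b : measurable (F b).
  by rewrite /F; case: ifP => // _; apply: measurableI => //; exact: (jh_state law1).
have livE : B `&` [set w | live (Y k w)] = \big[setU/set0]_(b < n.+1) F b.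
  rewrite -(bigcup_mkord n.+1 F); apply/seteqP; split => w /=.
    move=> [Bw lv]; exists (Y k w); first by case/andP: lv.
    by rewrite /F lv.
  by move=> [b _]; rewrite /F; case: ifP => // lv [Bw /= h]; split => //; rewrite h.
have mlive : measurable (B `&` [set w | live (Y k w)]).
  by apply: measurableI => //; exact: (discrete_measurable_pred (fun k => live k) (jh_state law1 k)).
have Plive : P1 (B `&` [set w | live (Y k w)]) =
    ((\sum_(b < n.+1 | b != j :> nat) step b) * C)%:E.
  rewrite livE measure_bigsetU_ord//; last first.
    apply/trivIsetP => a b _ _ ab; apply/seteqP; split => // w [].
    rewrite /F; case: ifP => // _ [_ /= h1]; case: ifP => // _ [_ /= h2].
    by move: ab; rewrite -(inj_eq val_inj) /= -h1 -h2 eqxx.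
  rewrite mulr_suml -sumEFin [RHS]big_mkcond; apply: eq_bigr => b _.
  rewrite /F /live leq_ord andbT; case: ifP => _; last exact: measure0.
  exact: prefix_law.
have -> : B `&` [set w | ~~ live (Y k w)] = B `\` (B `&` [set w | live (Y k w)]).
  by apply/seteqP; split => w /= [Bw h]; split => //; [move=> [_]; exact/negP|apply/negP => lv; exact: h].
have dP : P1 (B `\` (B `&` [set w | live (Y k w)])) =
    (P1 B - P1 (B `&` [set w | live (Y k w)]))%E.
  rewrite measureD//; first by rewrite setIA setIid.
  by apply: le_lt_trans (probability_le1 P1 mB) _; rewrite ltry.
rewrite dP Plive prefix_total -EFinB -mulrBl; congr ((_ * _)%:E).
rewrite /step; case: k ylive => [|l] ylive.
  have [ij|ij] := eqVneq i j.
    by rewrite big1 ?subr0// => b bj; rewrite ij (negbTE bj).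
  rewrite (bigD1 (inord i : 'I_n.+1)) ?inordK//= eqxx big1 ?addr0 ?subrr// => b /andP[_ bi].
  by rewrite -(inj_eq val_inj) /= inordK// in bi; rewrite (negbTE bi).
have /andP[yj yn] := ylive l (ltnSn l).
rewrite jump_prob_Qtilde_j ?inordK// mulrBr mulr1 mulr_sumr.
by congr (_ - _); apply: eq_bigr => b _; rewrite inordK.
Qed.

End Prefix.

Lemma prod_ord_split (f : nat -> R) k N : (k <= N)%N ->
  \prod_(m < N) f m = \prod_(m < k) f m * \prod_(m < N - k) f (k + m)%N.
Proof.
move=> kN; rewrite -(big_mkord xpredT f) (@big_cat_nat _ _ _ k)//= big_mkord.
congr (_ * _); rewrite -{1}(add0n k) big_addn big_mkord.
by apply: eq_bigr => m _; rewrite addnC.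
Qed.

Lemma product_rectangle (A1 : set Omega1) (A2 : set Omega2) (x1 x2 : R) :
  measurable A1 -> measurable A2 -> P1 A1 = x1%:E -> P2 A2 = x2%:E ->
  (P1 \x P2)%E (A1 `*` A2) = (x1 * x2)%:E.
Proof.
move=> m1 m2 e1 e2; have := product_measure1E P1 P2 m1 m2.
by move=> ->; rewrite EFinM; congr (_ * _)%E.
Qed.

Let P12 : probability (Omega1 * Omega2)%type R := (P1 \x P2)%E.

(** If y first visits j at step k, the event is a rectangle: the first chain follows
    y and dies at step k, the second one follows y from step k on. The jump into j
    at step k has the augmented probability by death_law, and the other jumps before
    k have the same probability for both matrices. *)
Lemma spliced_law N (y : nat -> 'I_n.+1) (t : nat -> R) : (forall m, 0 <= t m) ->
  P12 [set w | (forall m, (m < N)%N -> (spliced_hold m w < +oo)%E) /\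
    forall m, (m <= N)%N -> spliced_state m w = y m /\ ((t m)%:E < spliced_hold m w)%E] =
  ((y 0%N == inord i)%:R * (\prod_(m < N) jump_prob Qt (y m) (y m.+1))
    * \prod_(m < N.+1) expR (Qt (y m) (y m) * t m))%:E.
Proof.
move=> t0; have Qt_le0 := Qtilde_diag_le0 hQ Qneg jn.
have jj : (inord j : 'I_n.+1) = j :> nat by rewrite inordK.
(* If y leaves an absorbing state, then both sides vanish. *)
have [|nabs] := pselect (exists2 m, (m < N)%N & Qt (y m) (y m) = 0).
  move=> [m mN ym0]; rewrite (_ : [set w | _] = set0) ?measure0.
    rewrite [X in _ * X * _](bigD1 (Ordinal mN))//= {1}/jump_prob ym0 oppr0 invr0 mulr0.
    by rewrite (_ : (if _ then 0 else 0) = 0) ?mul0r ?mulr0 ?mul0r//; case: ifP.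
  apply/seteqP; split => // w [/(_ m mN) hfin /(_ m (ltnW mN)) [hst _]].
  move: hfin hst; rewrite /spliced_hold /spliced_state.
  case am : (age m w.1) => [k|]; first by rewrite S2_fin => /[swap] ->; rewrite ym0 eqxx.
  move=> _ hst; have /age_none /(_ m (leqnn m)) /andP[Yj Yn] := am.
  by move: ym0; rewrite -hst Qtilde_offj ?inordK// => /eqP; rewrite lt_eqF.
have {}nabs m : (m < N)%N -> Qt (y m) (y m) < 0.
  move=> mN; rewrite lt_neqAle Qt_le0 andbT; apply/eqP => h.
  by apply: nabs; exists m.
have fin_auto w : (forall m, (m <= N)%N -> spliced_state m w = y m /\
    ((t m)%:E < spliced_hold m w)%E) ->
    forall m, (m < N)%N -> (spliced_hold m w < +oo)%E.
  move=> h m mN; have [+ _] := h m (ltnW mN); rewrite /spliced_state /spliced_hold.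
  by case: age => [k yk|_]; [rewrite S2_fin yk lt_eqF// nabs|rewrite ltry].
pose ev := [set w | forall m, (m <= N)%N -> spliced_state m w = y m /\
  ((t m)%:E < spliced_hold m w)%E].
rewrite (_ : [set w | _] = ev); last first.
  by apply/seteqP; split => w /=; [case|move=> h; split => //; exact: fin_auto].
have yle m : (y m <= n)%N by rewrite leq_ord.
have before w k : ev w -> (k <= N.+1)%N -> (forall m, (m < k)%N -> y m != j :> nat) ->
    forall m, (m < k)%N -> live (Y m w.1).
  move=> evw kN yj m mk; case: (age_cases w.1) => [//|[l [hl nl]]].
  have [lk|kl] := ltnP l k; last by apply: hl; exact: leq_trans mk kl.
  have al : age l w.1 = Some 0%N by have := age_some hl nl 0; rewrite addn0.
  have [+ _] := evw l (leq_trans lk kN); rewrite /spliced_state al Y20 => yl.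
  by have := yj l lk; rewrite -yl jj eqxx.
have inordE (a : nat) (b : 'I_n.+1) : live a -> (inord a = b <-> a = b :> nat).
  move=> /andP[_ an]; split => [<-|ab]; first by rewrite inordK.
  by apply/val_inj; rewrite /= inordK.
have evE w m : (m <= N)%N -> age m w.1 = None ->
    (spliced_state m w = y m /\ ((t m)%:E < spliced_hold m w)%E) <->
    (Y m w.1 = y m /\ t m < S m w.1).
  move=> mN am; have /age_none /(_ m (leqnn m)) lv := am.
  rewrite /spliced_state /spliced_hold am lte_fin.
  by split => -[h1 h2]; split => //; apply/inordE.
have nonej (l : nat) (w : Omega1) : (forall m, (m <= l)%N -> Y m w = y m) ->
    (forall m, (m <= l)%N -> y m != j :> nat) -> age l w = None.
  by move=> h yj; apply/age_none => m ml; rewrite /live h// yj//=.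
have expE m : y m != j :> nat ->
    expR (- (- Q (y m) (y m) * t m)) = expR (Qt (y m) (y m) * t m).
  by move=> yj; rewrite Qtilde_offj// mulNr opprK.
have [yj|] := pselect (forall m, (m <= N)%N -> y m != j :> nat).
  pose A1 := [set w | forall m, (m <= N)%N -> Y m w = y m /\ t m < S m w].
  have -> : ev = A1 `*` setT.
    apply/seteqP; split => [w evw|w [A1w _] m mN].
      split => // m mN; apply/evE => //; last exact: evw.
      by apply/age_none => l lm; apply: (before w N.+1 evw) => //; exact: leq_trans lm mN.
    apply/evE => //; last exact: A1w.
    apply: nonej => l lm; last exact/yj/(leq_trans lm).
    by have [] := A1w l (leq_trans lm mN).
  have mA1 : measurable A1.
    apply: measurable_forall_le => m; apply: measurableI; first exact: (jh_state law1).
    by apply: measurable_gt; exact: (jh_hold law1).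
  apply: etrans (product_rectangle mA1 measurableT (jh_law law1 N (fun m => y m) t0)
    (probability_setT P2)) _; rewrite mulr1; congr (_ * _)%:E.
    rewrite /path_prob -(inj_eq val_inj) /= inordK//; congr (_ * _).
    by apply: eq_bigr => m _; rewrite jump_prob_Qtilde_offj// yj// ltnW.
  by apply: eq_bigr => m _; rewrite expE// yj// -ltnS.
move=> /existsNP[k0 /not_implyP[k0N /negP/negPn yk0]].
have ex : exists k, y k == j :> nat by exists k0.
case: (ex_minnP ex) => k yk kmin.
have kN : (k <= N)%N by apply: leq_trans k0N; exact: kmin.
have yj m : (m < k)%N -> y m != j :> nat.
  by move=> mk; apply/negP => /kmin; rewrite leqNgt mk.
have ykE : y k = inord j by apply/val_inj; rewrite /= (eqP yk) inordK.
pose A1 := [set w | forall m, (m < k)%N -> Y m w = y m /\ t m < S m w] `&`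
  [set w | ~~ live (Y k w)].
pose A2 := [set w | forall m, (m <= N - k)%N ->
  Y2 m w = y (k + m)%N /\ ((t (k + m)%N)%:E < S2 m w)%E].
have -> : ev = A1 `*` A2.
  apply/seteqP; split => [w evw|w [[B1 nl] A2w] m mN].
    have lv : forall m, (m < k)%N -> live (Y m w.1) by apply: before; rewrite ?leqW.
    have nl : ~~ live (Y k w.1).
      apply/negP => lvk; have ak : age k w.1 = None.
        by apply/age_none => l; rewrite leq_eqVlt => /predU1P[->//|]; exact: lv.
      have [Yk _] := (evE w k kN ak).1 (evw k kN).
      by move: lvk; rewrite /live Yk yk.
    split; first split => // m mk.
      apply/evE; first exact: leq_trans (ltnW mk) kN.
        by apply/age_none => l lm; exact/lv/(leq_ltn_trans lm).
      by apply: evw; exact: leq_trans (ltnW mk) kN.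
    move=> l lN; have := evw (k + l)%N; rewrite -leq_subRL// => /(_ lN).
    by rewrite /spliced_state /spliced_hold (age_some lv nl).
  have lv l : (l < k)%N -> live (Y l w.1).
    by move=> lk; have [-> _] := B1 l lk; rewrite /live yj//= yle.
  have [mk|km] := ltnP m k.
    apply/evE => //; last exact: B1.
    by apply/age_none => l lm; exact/lv/(leq_ltn_trans lm).
  rewrite /spliced_state /spliced_hold -(subnKC km) (age_some lv nl).
  by apply: A2w; rewrite leq_sub2r.
have mA1 : measurable A1.
  apply: measurableI.
    rewrite [X in measurable X](_ : _ = [set w | forall m, (m <= k)%N ->
      [set w | (m < k)%N -> Y m w = y m /\ t m < S m w] w]); last first.
      by apply/seteqP; split => w /= h m; [move=> _; exact: h|move=> mk; apply: h (ltnW mk) mk].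
    apply: measurable_forall_le => m; case: (m < k)%N; last first.
      by rewrite [X in measurable X](_ : _ = setT)//; apply/seteqP.
    rewrite [X in measurable X](_ : _ = [set w | Y m w = y m] `&` [set w | t m < S m w]).
      by apply: measurableI; [exact: (jh_state law1)|apply: measurable_gt; exact: (jh_hold law1)].
    by apply/seteqP; split => w /=; [apply|].
  exact: (discrete_measurable_pred (fun k => ~~ live k) (jh_state law1 k)).
have mA2 : measurable A2.
  apply: measurable_forall_le => m; apply: measurableI; first exact: mY2.
  rewrite -[X in measurable X]setTI; apply: measurable_lte => //.
have ylive m : (m < k)%N -> live (y m) by move=> mk; rewrite /live yj//= yle.
have PA1 := death_law t0 (y := fun m => y m : nat) ylive.
have PA2 := law2 (N := N - k) (y := fun m => y (k + m)%N) (t := fun m => t (k + m)%N)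
  (fun m => t0 _).
have shift m : (m < N - k)%N -> (k + m < N)%N by rewrite ltn_subRL.
have {}PA2 := PA2 (fun m mNk => nabs _ (shift m mNk)).
apply: etrans (product_rectangle mA1 mA2 PA1 PA2) _; congr (_%:E).
rewrite addn0 ykE eqxx mul1r (prod_ord_split (fun m => jump_prob Qt (y m) (y m.+1)) kN).
rewrite (prod_ord_split (fun m => expR (Qt (y m) (y m) * t m)) (leqW kN)) subSn//.
have -> : \prod_(m < k) expR (- (- Q (y m) (y m) * t m)) =
    \prod_(m < k) expR (Qt (y m) (y m) * t m).
  by apply: eq_bigr => m _; rewrite expE// yj.
have -> : \prod_(m < N - k) jump_prob Qt (y (k + m)%N) (y (k + m.+1)%N) =
    \prod_(m < N - k) jump_prob Qt (y (k + m)%N) (y (k + m).+1).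
  by apply: eq_bigr => m _; rewrite addnS.
set head := (X in X * _ * _ = _).
suff -> : head = (y 0%N == inord i)%:R * \prod_(m < k) jump_prob Qt (y m) (y m.+1) by ring.
rewrite /head; case: k yj ykE {kN kmin yk PA1 PA2 mA1 mA2 A1 A2 ylive shift head} => [|l] yj ykE.
  by rewrite big_ord0 mulr1 ykE -(inj_eq val_inj) /= !inordK// eq_sym.
rewrite big_ord_recr /= ykE inord_val mulrA /path_prob -(inj_eq val_inj) /= inordK//.
congr (_ * _ * _); apply: eq_bigr => m _.
by rewrite jump_prob_Qtilde_offj ?yj// ?ltnS ?ltn_ord//; exact: leqW (ltn_ord m).
Qed.

Lemma ae_product_fst (A : Omega1 -> Prop) : {ae P1, forall w, A w} ->
  {ae P12, forall w, A w.1}.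
Proof.
move=> [N [mN N0 sub]]; exists (N `*` setT); split.
- exact: measurableX.
- rewrite -[RHS](mul0e 1%E); apply: etrans (product_measure1E P1 P2 mN measurableT) _.
  by congr (_ * _)%E; [exact: N0|exact: probability_setT].
- by move=> w /= /sub.
Qed.

Lemma ae_product_snd (A : Omega2 -> Prop) : {ae P2, forall w, A w} ->
  {ae P12, forall w, A w.2}.
Proof.
move=> [N [mN N0 sub]]; exists (setT `*` N); split.
- exact: measurableX.
- rewrite -[RHS](mule0 1%E); apply: etrans (product_measure1E P1 P2 measurableT mN) _.
  by congr (_ * _)%E; [exact: probability_setT|exact: N0].
- by move=> w /= /sub.
Qed.

Lemma regular_spliced :
  {ae P1, forall w, [/\ forall m, 0 < S m w, forall m, Y m.+1 w <> Y m w &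
    forall K : nat, exists m, K%:R < \sum_(l < m) S l w]} ->
  {ae P2, forall w, regular_sojourns Y2 S2 w} ->
  {ae P12, forall w, regular_sojourns spliced_state spliced_hold w}.
Proof.
move=> ae1 ae2.
apply: ae_imply (ae_and (ae_product_fst ae1) (ae_product_snd ae2)).
move=> w [[S_pos Y_neq S_sum] [S2_pos Y2_neq S2_sum]].
have hold_pos m : (0 < spliced_hold m w)%E.
  by rewrite /spliced_hold; case: age => [k|]; [exact: S2_pos|rewrite lte_fin].
split => // [m|K].
- rewrite /spliced_hold /spliced_state.
  case am : (age m w.1) => [k|]; first by rewrite /= am; exact: Y2_neq.
  have /age_none /(_ m (leqnn m)) /andP[Yj Yn] := am.
  move=> _; rewrite /= am; case: ifP => [/andP[_ Yn']|_].
    move=> /(congr1 val); rewrite /= !inordK//; exact: Y_neq.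
  rewrite Y20 => /(congr1 val); rewrite /= !inordK// => h.
  by move: Yj; rewrite h eqxx.
- case: (age_cases w.1) => [lv|[k [lv nl]]].
    have [m hm] := S_sum K; exists m.
    rewrite /arrival (eq_bigr (fun l : 'I_m => (S l w.1)%:E)) ?sumEFin ?lte_fin// => l _.
    rewrite /spliced_hold; have /age_none -> // : forall l', (l' <= l)%N -> live (Y l' w.1).
    by move=> l' _; exact: lv.
  have [m hm] := S2_sum K; exists (k + m)%N; apply: lt_le_trans hm _.
  rewrite /arrival big_split_ord /= [X in (_ <= _ + X)%E](eq_bigr (fun l : 'I_m => S2 l w.2)).
    by rewrite leeDr// sume_ge0// => l _; exact: ltW.
  by move=> l _; rewrite /spliced_hold /= (age_some lv nl).
Qed.

End Coupling.

(** * Pathwise comparison of the coupled chains *)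

Section RealTimes.
Context {R : realType}.

(** Return times are compared through the real times below them, which belong to
    some sojourn. *)
Lemma le_real_times (a b : \bar R) : (0 <= b)%E ->
  (forall t, 0 <= t -> (t%:E < a)%E -> (t%:E < b)%E) -> (a <= b)%E.
Proof.
move=> b0 h; rewrite leNgt; apply/negP => ba.
case: b b0 ba h => [r r0 ra /(_ r r0 ra)| _ |//]; first by rewrite ltxx.
by rewrite ltNge leey.
Qed.

Lemma cvg_real_times (u : nat -> \bar R) (a : \bar R) N :
  (0 <= a)%E -> (forall n, (0 <= u n)%E) ->
  (forall n m, (N <= n)%N -> (n <= m)%N -> (u n <= u m)%E) ->
  (forall t, 0 <= t -> (t%:E < a)%E <-> exists2 n, (N <= n)%N & (t%:E < u n)%E) ->
  u n @[n --> \oo] --> a.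
Proof.
move=> a0 u0 nd ua; rewrite -(cvg_shiftn N u).
have -> : a = ereal_sup (range (fun n => u (n + N)%N)).
  apply/eqP; rewrite eq_le; apply/andP; split.
    apply: le_real_times => [|t t0 /(ua t t0)[n Nn tn]].
      by apply: le_trans (u0 (0 + N)%N) _; apply: ereal_sup_ubound; exists 0%N.
    apply: lt_le_trans tn _; apply: ereal_sup_ubound; exists (n - N)%N => //=.
    by rewrite subnK.
  apply: ge_ereal_sup => _ [n _ <-]; apply: le_real_times => // t t0 tu.
  by apply/(ua t t0); exists (n + N)%N => //; rewrite leq_addl.
apply: ereal_nondecreasing_cvgn; apply/nondecreasing_seqP => n /=.
by apply: nd; rewrite ?leq_addl// leq_add2r.
Qed.

Lemma return_time_ge0 (E : countType) (j : E) (x : R -> E) : (0 <= return_time j x)%E.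
Proof.
apply: le_ereal_inf_tmp => _ [t [t1 _] <-]; apply: le_trans t1; exact: jump_time_ge0.
Qed.

End RealTimes.

Section Pathwise.
Context {R : realType}.
Variables (d1 d2 : measure_display).
Variables (Omega1 : measurableType d1) (Omega2 : measurableType d2).
Variables (j : nat) (Y : nat -> Omega1 -> nat) (S : nat -> Omega1 -> R).
Variables (x : R -> nat) (J : nat -> \bar R) (w : Omega1 * Omega2).
Hypothesis step : step_path x (Y ^~ w.1) J.
Hypothesis Jsum : forall m, J m = (\sum_(l < m) S l w.1)%:E.

Local Notation alive n m := (all (fun l => live j n (Y l w.1)) (iota 0 m.+1)).

Let aliveP n m : reflect (forall l, (l <= m)%N -> live j n (Y l w.1)) (alive n m).
Proof.
apply: (iffP allP) => h l; last by rewrite mem_iota add0n ltnS; exact: h.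
by move=> lm; apply: h; rewrite mem_iota add0n ltnS.
Qed.

Section OneTruncation.
Variables (n : nat) (Y2 : nat -> Omega2 -> 'I_n.+1) (S2 : nat -> Omega2 -> \bar R).
Variable (xn : R -> 'I_n.+1).
Hypothesis jn : (j <= n)%N.
Hypothesis start : live j n (Y 0 w.1).
Hypothesis Y20 : Y2 0 w.2 = inord j.
Local Notation Yn := (spliced_state j Y Y2).
Local Notation Jn := (arrival (spliced_hold j n Y S S2)).
Hypothesis stepn : step_path xn (Yn ^~ w) (Jn ^~ w).

Lemma arrival_spliced k : (forall l, (l < k)%N -> live j n (Y l w.1)) -> Jn k w = J k.
Proof.
move=> lv; rewrite Jsum /arrival -sumEFin; apply: eq_bigr => l _; rewrite /spliced_hold.
have /age_none -> // : forall l', (l' <= l)%N -> live j n (Y l' w.1).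
by move=> l' ll; apply: lv; exact: leq_ltn_trans ll (ltn_ord l).
Qed.

Lemma spliced_state_live m : alive n m -> Yn m w = inord (Y m w.1).
Proof. by move/aliveP/age_none => am; rewrite /spliced_state am. Qed.

(** At the time of its death the first chain is replaced by the second one, which
    starts in j. As the starting state is live, this is not the time 0, and the
    spliced path has returned to j. *)
Lemma lt_return_spliced m t : (J m <= t%:E < J m.+1)%E ->
  (t%:E < return_time (inord j) xn)%E = alive n m.
Proof.
move=> mt; case: (aliveP n m) => [lv|dead].
  have mtn : (Jn m w <= t%:E < Jn m.+1 w)%E.
    by rewrite !arrival_spliced// => l lm; apply: lv; rewrite // ltnW.
  rewrite (@lt_return_time _ _ _ _ _ stepn _ m)//.
  apply/avoidsP => l /andP[_ lm]; rewrite spliced_state_live; last first.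
    by apply/aliveP => l' ll; apply: lv; exact: leq_trans ll lm.
  have /andP[lj ln] := lv _ lm.
  by move=> /(congr1 val); rewrite /= !inordK// => e; rewrite e eqxx in lj.
have [lv|[k [lv nl]]] := age_cases j n Y w.1.
  by case: dead => l _; exact: lv.
have km : (k <= m)%N.
  rewrite leqNgt; apply/negP => mk; apply: dead => l lm; apply: lv.
  exact: leq_ltn_trans lm mk.
have k0 : (0 < k)%N by case: k nl {lv km} => //; rewrite start.
have t0 : 0 <= t.
  by rewrite -lee_fin; case/andP: mt => + _; apply: le_trans; exact: (step_path_ge0 step).
have [k' /andP[kt tk]] := step_path_locate stepn t0.
have kk' : (k <= k')%N.
  rewrite leqNgt; apply/negP => k'k; case/andP: mt => mt _.
  have : (Jn k'.+1 w <= t%:E)%E.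
    apply: le_trans (step_path_nd stepn k'k) _; rewrite arrival_spliced//.
    by apply: le_trans mt; exact: (step_path_nd step).
  by move/(lt_le_trans tk); rewrite ltxx.
rewrite (@lt_return_time _ _ _ _ _ stepn _ k') ?kt//; apply/negbTE/avoidsP => /(_ k).
rewrite k0 kk' /spliced_state -(addn0 k) (age_some lv nl) => /(_ isT); exact.
Qed.

Lemma spliced_path_live m t : (J m <= t%:E < J m.+1)%E -> alive n m ->
  xn t = inord (x t) /\ (x t <= n)%N.
Proof.
move=> mt lv; have /aliveP lv' := lv.
case: step => _ _ xE _ _; rewrite (xE m t mt); split; last by case/andP: (lv' m (leqnn m)).
case: stepn => _ _ xnE _ _; rewrite (xnE m t) ?spliced_state_live//.
by rewrite !arrival_spliced// => l lm; apply: lv'; rewrite // ltnW.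
Qed.

End OneTruncation.

Variables (g : nat -> R) (N : nat).
Variables (Y2 : forall n, nat -> Omega2 -> 'I_n.+1) (S2 : forall n : nat, nat -> Omega2 -> \bar R).
Variable (xn : forall n, R -> 'I_n.+1).
Hypothesis Y0j : Y 0 w.1 <> j.
Hypothesis NY : (maxn (Y 0 w.1) j <= N)%N.
Hypothesis Y20 : forall n, Y2 n 0 w.2 = inord j.
Hypothesis stepn : forall n, (N <= n)%N -> step_path (@xn n)
  (spliced_state j Y (@Y2 n) ^~ w) (arrival (spliced_hold j n Y S (@S2 n)) ^~ w).

Local Notation delta n := (return_time (inord j) (@xn n)).
Local Notation D n := [set t : R | 0 <= t /\ (t%:E < delta n)%E].
Local Notation Dlim := [set t : R | 0 <= t /\ (t%:E < return_time j x)%E].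

Let start (n : nat) : (N <= n)%N -> live j n (Y 0 w.1).
Proof.
move=> Nn; rewrite /live; apply/andP; split; first exact/eqP.
by apply: leq_trans Nn; apply: leq_trans NY; exact: leq_maxl.
Qed.

Let jN (n : nat) : (N <= n)%N -> (j <= n)%N.
Proof. by apply: leq_trans; apply: leq_trans NY; exact: leq_maxr. Qed.

Let ltE n m t : (N <= n)%N -> (J m <= t%:E < J m.+1)%E ->
  (t%:E < delta n)%E = alive n m.
Proof.
move=> Nn; apply: (lt_return_spliced (jN Nn) (start Nn) (Y20 n) (stepn Nn)).
Qed.

(** Larger windows keep more states alive. *)
Lemma lt_delta_mono n m t : (N <= n)%N -> (n <= m)%N -> 0 <= t ->
  (t%:E < delta n)%E -> (t%:E < delta m)%E.
Proof.
move=> Nn nm t0; have [k kt] := step_path_locate step t0.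
rewrite (ltE Nn kt) (ltE (leq_trans Nn nm) kt) => /aliveP lv.
apply/aliveP => l /lv /andP[lj ln]; rewrite /live lj /=; exact: leq_trans nm.
Qed.

(** Up to a given time the path visits finitely many states, hence remains in
    some window. *)
Lemma lt_return_window t : 0 <= t ->
  (t%:E < return_time j x)%E <-> exists2 n, (N <= n)%N & (t%:E < delta n)%E.
Proof.
move=> t0; have [k kt] := step_path_locate step t0.
rewrite (@lt_return_time _ _ _ _ _ step _ k)//; split.
  (* A crude common bound of the states visited up to time t. *)
  move/avoidsP => av; pose n := (N + \sum_(l < k.+1) Y l w.1)%N.
  have Nn : (N <= n)%N by rewrite leq_addr.
  exists n => //; rewrite (ltE Nn kt); apply/aliveP => l lk; rewrite /live.
  apply/andP; split; first by apply/eqP; case: l lk => [//|l] lk; exact: av.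
  have lk' : (l < k.+1)%N by rewrite ltnS.
  by rewrite /n (bigD1 (Ordinal lk'))//= addnCA leq_addr.
move=> [n Nn]; rewrite (ltE Nn kt) => /aliveP lv; apply/avoidsP => l /andP[_ lk].
by apply/eqP; case/andP: (lv l lk).
Qed.

Lemma delta_le n m : (N <= n)%N -> (n <= m)%N -> (delta n <= delta m)%E.
Proof.
move=> Nn nm; apply: le_real_times => [|t]; first exact: return_time_ge0.
exact: lt_delta_mono.
Qed.

Lemma delta_cvg : delta n @[n --> \oo] --> return_time j x.
Proof.
apply: (@cvg_real_times _ _ _ N); [exact: return_time_ge0|by move=> n; exact: return_time_ge0| |].
- exact: delta_le.
- exact: lt_return_window.
Qed.

Let mD (a : \bar R) : measurable [set t : R | 0 <= t /\ (t%:E < a)%E].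
Proof.
rewrite [X in measurable X](_ : _ = [set t : R | (0%:E <= t%:E < a)%E]).
  exact: measurable_step_set.
by apply/seteqP; split=> t /=; rewrite lee_fin => /andP.
Qed.

(** Before its return to j each truncated path follows x. *)
Lemma xi_truncated n : (N <= n)%N ->
  xi (inord j) (fun k => `|restrict_to g n k|) (@xn n) =
  (\int[lebesgue_measure]_(t in D n) `|g (x t)|%:E)%E.
Proof.
move=> Nn; apply: eq_integral => t; rewrite inE => -[t0 td].
have [k kt] := step_path_locate step t0.
move: td; rewrite (ltE Nn kt) => lv.
have [-> xtn] := spliced_path_live (stepn Nn) kt lv.
by rewrite /restrict_to inordK.
Qed.

Let mg a : measurable_fun [set t : R | 0 <= t /\ (t%:E < a)%E] (fun t => `|g (x t)|%:E).
Proof.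
apply: (@measurable_funS _ _ _ _ [set t : R | 0 <= t]).
- rewrite [X in measurable X](_ : _ = [set t : R | (0%:E <= t%:E < +oo)%E]).
    exact: measurable_step_set.
  by apply/seteqP; split=> t /=; rewrite lee_fin ltry andbT.
- by move=> t [].
- exact: (measurable_fun_step_path step (fun k => `|g k|)).
Qed.

Lemma xi_truncated_le n m : (N <= n)%N -> (n <= m)%N ->
  (xi (inord j) (fun k => `|restrict_to g n k|%R) (@xn n) <=
   xi (inord j) (fun k => `|restrict_to g m k|%R) (@xn m))%E.
Proof.
move=> Nn nm; rewrite !xi_truncated//; last exact: leq_trans nm.
apply: ge0_subset_integral; [exact: mD|exact: mD|exact: mg| |].
- by move=> t _; rewrite lee_fin.
- by move=> t [t0 td]; split => //; exact: lt_delta_mono td.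
Qed.

Lemma xi_truncated_cvg :
  xi (inord j) (fun k => `|restrict_to g n k|) (@xn n) @[n --> \oo]
    --> xi j (fun k => `|g k|) x.
Proof.
rewrite -(cvg_shiftn N (fun n => xi (inord j) (fun k => `|restrict_to g n k|) (@xn n))).
rewrite [X in X @ _](_ : _ = fun n => (\int[lebesgue_measure]_(t in D (n + N)%N) `|g (x t)|%:E)%E).
  rewrite /xi (_ : Dlim = \bigcup_n D (n + N)%N); last first.
    apply/seteqP; split => t /=.
      move=> [t0 /(lt_return_window t0)[n Nn tn]]; exists (n - N)%N => //=.
      by rewrite subnK.
    move=> [n _ [t0 tn]]; split => //; apply/(lt_return_window t0).
    by exists (n + N)%N => //; rewrite leq_addl.
  apply: ge0_nondecreasing_set_cvg_integral.
  - move=> n m nm; apply/subsetPset => t [t0 td]; split => //.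
    by apply: lt_delta_mono td; rewrite ?leq_addl// leq_add2r.
  - by move=> n; exact: mD.
  - by move=> n; exact: mg.
  - by move=> n t _; rewrite lee_fin.
apply/funext => n /=; rewrite xi_truncated//; exact: leq_addl.
Qed.

End Pathwise.

(** * Realization on a common probability space *)

Section ProductExtension.
Context {R : realType}.
Variables (d1 d2 : measure_display).
Variables (Omega1 : measurableType d1) (Omega2 : measurableType d2).

Lemma ctmc_product_fst (E : countType) (Q : E -> E -> R) (P1 : probability Omega1 R)
    (P2 : probability Omega2 R) (i : E) (Phi : R -> Omega1 -> E) :
  is_ctmc Q P1 i Phi ->
  is_ctmc Q (P1 \x P2)%E i (fun t (w : Omega1 * Omega2) => Phi t w.1).
Proof.
move=> hPhi; case: (hPhi) => mPhi rc _ exp; split.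
- move=> t k t0; exact: (discrete_measurable_fst (f := Phi t) (fun k => mPhi t k t0)).
- by move=> w t; exact: rc.
- move=> n y t t0; have m1 := measurable_ctmc_event hPhi n y t.
  have P2T : P2 setT = 1%R%:E by exact: probability_setT.
  have := product_rectangle m1 measurableT (ctmc_law hPhi n y t0) P2T.
  rewrite mulr1 => <-; congr (_ _).
  by apply/seteqP; split => w /= => [h|[]].
- exact: (ae_product_fst P2 exp).
Qed.

End ProductExtension.

Section Realization.
Context {R : realType} {d : measure_display} {Omega : measurableType d}.
Variables (Q : nat -> nat -> R) (P : nat -> probability Omega R).
Variables (Phi : R -> Omega -> nat) (j : nat).
Hypothesis hQ : conservative_qmatrix Q.
Hypothesis hPhi : forall i, is_ctmc Q (P i) i Phi.
Hypothesis Qneg : forall a, Q a a < 0.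

Let J m (w : Omega) := jump_time (Phi ^~ w) m.
Let Y m (w : Omega) := Phi (fine (J m w)) w.
Let S := holding Phi.

Let law i : jump_hold (P i) (fun k => - Q k k) (jump_prob Q) i Y S.
Proof.
by apply: (ctmc_jump_hold (hPhi i) Qneg (c := id)) => // a b /(_ b).
Qed.

Lemma jump_time_sum w m : (forall l, (J l w < +oo)%E) ->
  J m w = (\sum_(l < m) S l w)%:E.
Proof.
move=> fin; elim: m => [|m IH]; first by rewrite big_ord0.
have Jfine l : (fine (J l w))%:E = J l w.
  by apply: fineK; rewrite ge0_fin_numE ?fin//; exact: jump_time_ge0.
rewrite big_ord_recr /= -[LHS]Jfine; congr (_%:E).
by apply: EFin_inj; rewrite EFinD -IH /S (holdingE _ fin) EFinB !Jfine addeC subeK// -Jfine.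
Qed.

Lemma ctmc_start i : {ae P i, forall w, Y 0 w = i}.
Proof.
have mY0 := jh_state (law i) 0%N i.
have PY0 : P i [set w | Y 0 w = i] = 1%E.
  have := jh_law (law i) 0 (fun=> i) (fun _ => lexx 0).
  rewrite /path_prob eqxx big_ord0 big_ord_recl big_ord0 mulr0 oppr0 expR0 !mulr1 => law0.
  apply/eqP; rewrite eq_le; apply/andP; split; first exact: probability_le1.
  rewrite -law0; apply: le_measure; rewrite ?inE//; last by move=> w /(_ 0%N (leqnn _))[].
  apply: measurable_forall_le => m; apply: measurableI; first exact: (jh_state (law i)).
  by apply: measurable_gt; exact: (jh_hold (law i)).
exists (~` [set w | Y 0 w = i]); split => //; first exact: measurableC.
by apply: etrans (probability_setC _ mY0) _; rewrite PY0 subee.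
Qed.

Let holding_regular i : {ae P i, forall w, [/\ forall m, 0 < S m w,
  forall m, Y m.+1 w <> Y m w & forall K : nat, exists m, K%:R < \sum_(l < m) S l w]}.
Proof.
apply: ae_imply (ae_and (ctmc_step_path (hPhi i) Qneg) (jh_pos (law i))) => w.
move=> [[fin step] Spos]; case: step => _ _ _ jump oo; split => // [m|K].
  by apply: jump; exact: fin.
have /cvgeyPgt /(_ K%:R) [m _ /(_ m (leqnn m))] := oo.
by move=> h; exists m; rewrite -lte_fin -jump_time_sum.
Qed.

(** The second coordinate of the product space carries the original chain started
    from j, which only serves as a source of independent uniform variables. *)
Let V := holding_uniform (fun k => - Q k k) Y S.
Let uniformV : uniform_seq (P j) V.
Proof.
apply: (uniform_seq_holding (law j)).
- by move=> k; rewrite oppr_gt0.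
- exact: jump_prob_ge0.
- exact: jump_prob_sum1.
Qed.

Let Y2 n := drive_state V (Qtilde Q j n) (inord j : 'I_n.+1).
Let S2 n := drive_hold V (Qtilde Q j n) (inord j : 'I_n.+1).

Definition coupled_chain n : R -> Omega * Omega -> 'I_n.+1 :=
  sojourn_path (inord j) (spliced_state j Y (@Y2 n)) (spliced_hold j n Y S (@S2 n)).

Let regular_coupled i n : (j <= n)%N -> {ae (P i \x P j)%E, forall w,
  regular_sojourns (spliced_state j Y (@Y2 n)) (spliced_hold j n Y S (@S2 n)) w}.
Proof.
move=> jn; apply: regular_spliced => //.
apply: (regular_drive uniformV); last exact: Qtilde_row_sum.
by move=> a b ab; exact: Qtilde_offdiag_ge0.
Qed.

Lemma coupled_chain_ctmc i n : (maxn i j <= n)%N ->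
  is_ctmc (Qtilde Q j n) (P i \x P j)%E (inord i) (coupled_chain n).
Proof.
rewrite geq_max => /andP[i_n jn].
have mY2 : forall m, discrete_measurable (@Y2 n m).
  by move=> m; exact: (measurable_drive_state uniformV).
have mS2 : forall m, measurable_fun setT (@S2 n m).
  by move=> m; exact: (measurable_drive_hold uniformV).
have mY m := jh_state (law i) m; have mS m := jh_hold (law i) m.
apply: ctmc_of_sojourns.
- exact: measurable_spliced_state.
- exact: measurable_spliced_hold.
- exact: regular_coupled.
- move=> N y t t0; apply: (spliced_law hQ Qneg jn i_n (law i)) => //.
    by move=> m w; rewrite /S2 /drive_hold -/(Y2 _ _); case: eqP => // _; rewrite ltry.
  move=> {}N {}y {}t {}t0 yneg; apply: (drive_law uniformV) => //.
    by move=> a b ab; exact: Qtilde_offdiag_ge0.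
  exact: Qtilde_row_sum.
Qed.

Lemma coupled_chain_monotone (g : nat -> R) i : i <> j ->
  {ae (P i \x P j)%E, forall w : Omega * Omega,
    let delta n := return_time (inord j) (coupled_chain n ^~ w) in
    let xin n := xi (inord j) (fun k => `|restrict_to g n k|) (coupled_chain n ^~ w) in
    [/\ forall n m : nat, (maxn i j <= n)%N -> (n <= m)%N ->
          (delta n <= delta m)%E /\ (xin n <= xin m)%E,
        delta n @[n --> \oo] --> return_time j (Phi ^~ w.1)
      & xin n @[n --> \oo] --> xi j (fun k => `|g k|) (Phi ^~ w.1)]}.
Proof.
move=> ij; pose reg n (w : Omega * Omega) := (maxn i j <= n)%N ->
  regular_sojourns (spliced_state j Y (@Y2 n)) (spliced_hold j n Y S (@S2 n)) w.
have aereg : {ae (P i \x P j)%E, forall w, forall n, reg n w}.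
  apply: ae_count => n; have [nij|nij] := leqP (maxn i j) n; last first.
    by apply: ae_imply (ae_product_fst (P j) (ctmc_start i)) => w _; rewrite /reg leqNgt nij.
  apply: ae_imply (@regular_coupled i n _) => // [w h _ //|].
  by apply: leq_trans nij; exact: leq_maxr.
have aepath := ae_product_fst (P j) (ae_and (ctmc_step_path (hPhi i) Qneg) (ctmc_start i)).
apply: ae_imply (ae_and aereg aepath) => w [regw [[fin step] Y0]] /=.
have Jsum m : jump_time (Phi ^~ w.1) m = (\sum_(l < m) S l w.1)%:E by exact: jump_time_sum.
have Y0j : Y 0 w.1 <> j by rewrite Y0.
have NY : (maxn (Y 0 w.1) j <= maxn i j)%N by rewrite Y0.
have Y20 n : @Y2 n 0%N w.2 = inord j by [].
have stepn n : (maxn i j <= n)%N -> step_path (coupled_chain n ^~ w)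
    (spliced_state j Y (@Y2 n) ^~ w) (arrival (spliced_hold j n Y S (@S2 n)) ^~ w).
  by move=> nij; apply: step_sojourn_path; exact: regw.
split.
- move=> n m nij nm; split; first exact: (delta_le step Jsum Y0j NY Y20 stepn).
  exact: (xi_truncated_le step Jsum g Y0j NY Y20 stepn).
- exact: (delta_cvg step Jsum Y0j NY Y20 stepn).
- exact: (xi_truncated_cvg step Jsum (g := g) Y0j NY Y20 stepn).
Qed.

End Realization.

Theorem theorem4p3 (R : realType) (Q : nat -> nat -> R)
  (d : measure_display) (Omega : measurableType d)
  (P : nat -> probability Omega R) (Phi : R -> Omega -> nat)
  (p g : nat -> R) (j : nat)
  (dn : nat -> measure_display) (Omegan : forall n, measurableType (dn n))
  (Pn : forall n : nat, 'I_n.+1 -> probability (Omegan n) R)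
  (Phin : forall n : nat, R -> Omegan n -> 'I_n.+1)
  (pn : forall n : nat, 'cV[R]_n.+1)
  (hQ : conservative_qmatrix Q)
  (hPhi : forall i : nat, is_ctmc Q (P i) i Phi)
  (hirr : irreducible P Phi)
  (hrec : positive_recurrent P Phi)
  (hp : invariant_prob Q p)
  (hg : cvgn (series (fun k => p k * `|g k|)))
  (hPhin : forall n : nat, (j <= n)%N -> forall i : 'I_n.+1,
     is_ctmc (Qtilde Q j n) (Pn n i) i (Phin n))
  (hpn : forall n : nat, (j <= n)%N -> invariant_prob_mx (Qtilde Q j n) (pn n)) :
  (exists (d' : measure_display) (Omega' : measurableType d')
      (P' : nat -> probability Omega' R) (Phi' : R -> Omega' -> nat)
      (Phin' : forall n : nat, R -> Omega' -> 'I_n.+1),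
    [/\ forall i : nat, is_ctmc Q (P' i) i Phi',
        forall n i : nat, (maxn i j <= n)%N ->
          is_ctmc (Qtilde Q j n) (P' i) (inord i) (Phin' n)
      & forall i : nat, i <> j ->
        {ae P' i, forall w : Omega',
          let delta n := return_time (inord j) (Phin' n ^~ w) in
          let xin n :=
            xi (inord j) (fun k => `|restrict_to g n k|) (Phin' n ^~ w) in
          [/\ forall n m : nat, (maxn i j <= n)%N -> (n <= m)%N ->
                (delta n <= delta m)%E /\ (xin n <= xin m)%E,
              delta n @[n --> \oo] --> return_time j (Phi' ^~ w)
            & xin n @[n --> \oo] --> xi j (fun k => `|g k|) (Phi' ^~ w)]}])
  /\
  (forall i : nat,
     expected_xi (Pn n (inord i)) (Phin n) (inord j)
       (centered_mx (pn n) (restrict_to g n)) @[n --> \oo]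
     --> expected_xi (P i) Phi j (centered p g)).
Proof.
have Qneg := chain_no_absorption hQ hPhi hirr.
split; last by move=> i; exact: (poisson_limit hQ hPhi hirr hrec hp hg hPhin hpn).
exists _, (Omega * Omega)%type, (fun i => (P i \x P j)%E), (fun t w => Phi t w.1).
exists (coupled_chain Q Phi j); split.
- by move=> i; exact: ctmc_product_fst.
- by move=> n i nij; exact: coupled_chain_ctmc.
- by move=> i ij; exact: coupled_chain_monotone.
Qed.
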